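(* For an elastic momentum strip with Lagrange multiplier $\mu$, defined by a curve $\gamma$, the binormal $B$ of $\gamma$ is a spherical elastic curve with Lagrange multiplier $-\mu$. Conversely, for each arclength parametrized spherical elastic curve $B:[0,\hat L]\to S^2$ with Lagrange multiplier $-\mu$ and with non-vanishing, non-constant geodesic curvature $\lambda$, and with $T:=B\times B'$, the space curve $$\gamma(t)=\int_0^t\left(1+\frac{1}{\lambda^2(s)}\right)T(s)\,ds$$ defines an elastic momentum strip with $$S_\mu(\gamma)=\int_0^{\hat L}(1+\lambda^2)\,dt-\mu L(\gamma),$$ where $L(\gamma)$ is the length of $\gamma$.
   Context: Let $\gamma:[0,L]\to\mathbb{R}^3$ be a regular Frenet curve with speed $v=|\gamma'|$, curvature $\kappa$, torsion $\tau=\det(\gamma',\gamma'',\gamma''')/|\gamma'\times\gamma''|^2$ and modified torsion $\lambda=\tau/\kappa$. Its Frenet frame $(T,N,B)$ satisfies $\gamma'=vT$, $T'=v\kappa N$, $N'=-v\kappa T+v\lambda\kappa B$, $B'=-v\lambda\kappa N$; $B$ is the binormal. For $\mu\in\mathbb{R}$ the modified Sadowsky functional is $$S_\mu(\gamma)=\int_0^L\left(\kappa^2(1+\lambda^2)^2-\mu\right)v\,dt.$$ The curve $\gamma$ defines an elastic strip with Lagrange multiplier $\mu$ if it is a critical point of $S_\mu$ under proper variations (end points fixed, boundary terms of the first variation vanishing); $\mu$ stands for the length constraint. The curve $\gamma$ defines a momentum strip if $s_1:=2\kappa\lambda(1+\lambda^2)$ is a constant non-zero function. (Here $s_1=\langle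 b_1+\gamma\times b_0,T\rangle$, where $b_0$ is the force vector and $b_1=s_1T+s_2N+s_3B-\gamma\times b_0$ the torque vector of the strip, with $s_2=\frac1\kappa s_1'$ and $s_3=\kappa(1+\lambda^2)(1-\lambda^2)$ in arclength parametrization.) An elastic momentum strip is a momentum strip that is also an elastic strip. A spherical elastic curve with Lagrange multiplier $l$ is a curve in the unit sphere $S^2$ that is critical for $\int (k^2+l)\,ds$, where $k$ is the geodesic curvature and $s$ the arclength; in arclength parametrization it satisfies $k'^2+\frac14k^4+\left(1-\frac l2\right)k^2=A$ for some constant $A$. In the first assertion $B$ is regarded as a curve in $S^2$ up to reparametrization. In the converse, $\lambda$ denotes the geodesic curvature of the spherical curve $B$.
   Formalization: In the first assertion the Lagrange multiplier of B is -(2/s_1)^2 μ instead of -μ; the stated -μ is false under rescaling of γ (e.g. the helix κ=τ=1, μ=-12, s_1=4 gives 3, not 12) and is recovered when |s_1|=2. *)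

(* Defs.v *)
From Stdlib Require Export Reals.
From Coquelicot Require Export Coquelicot.
Open Scope R_scope.

Definition R3 : Type := (R * R * R)%type.

Definition X1 (u : R3) : R := fst (fst u).
Definition X2 (u : R3) : R := snd (fst u).
Definition X3 (u : R3) : R := snd u.

Definition vzero : R3 := (0, 0, 0).
Definition vscale (a : R) (u : R3) : R3 := (a * X1 u, a * X2 u, a * X3 u).
Definition vdot (u w : R3) : R := X1 u * X1 w + X2 u * X2 w + X3 u * X3 w.
Definition vnorm (u : R3) : R := sqrt (vdot u u).
Definition vcross (u w : R3) : R3 :=
  (X2 u * X3 w - X3 u * X2 w,
   X3 u * X1 w - X1 u * X3 w,
   X1 u * X2 w - X2 u * X1 w).
Definition vdet (u v w : R3) : R := vdot (vcross u v) w.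

Definition vD (c : R -> R3) (t : R) : R3 :=
  (Derive (fun r => X1 (c r)) t,
   Derive (fun r => X2 (c r)) t,
   Derive (fun r => X3 (c r)) t).

Definition vRInt (c : R -> R3) (a b : R) : R3 :=
  (RInt (fun r => X1 (c r)) a b,
   RInt (fun r => X2 (c r)) a b,
   RInt (fun r => X3 (c r)) a b).

(* A curve on the closed interval [0, L] is a total function of which only the
   values on [0, L] matter.  It is smooth if it is C^oo on an open interval
   containing [0, L]; this is how one-sided smoothness at the two end points is
   expressed, and derivatives at the end points do not depend on the chosen
   extension. *)
Definition smooth_fun (L : R) (f : R -> R) : Prop :=
  exists del : R, 0 < del /\
    forall t, - del < t < L + del -> forall n : nat, ex_derive_n f n t.

Definition smooth_curve (L : R) (c : R -> R3) : Prop :=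
  smooth_fun L (fun t => X1 (c t)) /\
  smooth_fun L (fun t => X2 (c t)) /\
  smooth_fun L (fun t => X3 (c t)).

Definition speed (c : R -> R3) (t : R) : R := vnorm (vD c t).

Definition curve_length (L : R) (c : R -> R3) : R := RInt (speed c) 0 L.

(* G s is the curve with parameter s in (-eps, eps); the family is jointly
   C^oo on a neighbourhood of (-eps, eps) x [0, L]. *)
Definition smooth_fun2 (eps L : R) (f : R -> R -> R) : Prop :=
  exists del : R, 0 < del /\
    forall s t, - eps < s < eps -> - del < t < L + del ->
      forall n : nat, ex_diff_n f n s t.

Definition variation (eps L : R) (c : R -> R3) (G : R -> R -> R3) : Prop :=
  smooth_fun2 eps L (fun s t => X1 (G s t)) /\
  smooth_fun2 eps L (fun s t => X2 (G s t)) /\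
  smooth_fun2 eps L (fun s t => X3 (G s t)) /\
  (forall t, 0 <= t <= L -> G 0 t = c t).

Definition fixes_ends (eps L : R) (c : R -> R3) (G : R -> R -> R3) : Prop :=
  forall s, - eps < s < eps -> G s 0 = c 0 /\ G s L = c L.

Definition curvature (c : R -> R3) (t : R) : R :=
  vnorm (vcross (vD c t) (vD (vD c) t)) / speed c t ^ 3.

Definition torsion (c : R -> R3) (t : R) : R :=
  vdet (vD c t) (vD (vD c) t) (vD (vD (vD c)) t)
  / vnorm (vcross (vD c t) (vD (vD c) t)) ^ 2.

Definition mod_torsion (c : R -> R3) (t : R) : R := torsion c t / curvature c t.

Definition frenet_T (c : R -> R3) (t : R) : R3 := vscale (/ speed c t) (vD c t).

Definition frenet_B (c : R -> R3) (t : R) : R3 :=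
  vscale (/ vnorm (vcross (vD c t) (vD (vD c) t))) (vcross (vD c t) (vD (vD c) t)).

Definition frenet_N (c : R -> R3) (t : R) : R3 := vcross (frenet_B c t) (frenet_T c t).

Definition frenet_curve (L : R) (c : R -> R3) : Prop :=
  smooth_curve L c /\
  forall t, 0 <= t <= L ->
    vD c t <> vzero /\ vcross (vD c t) (vD (vD c) t) <> vzero.

Definition sadowsky (mu L : R) (c : R -> R3) : R :=
  RInt (fun t =>
    (curvature c t ^ 2 * (1 + mod_torsion c t ^ 2) ^ 2 - mu) * speed c t) 0 L.

Definition s1 (c : R -> R3) (t : R) : R :=
  2 * curvature c t * mod_torsion c t * (1 + mod_torsion c t ^ 2).

(* The derivative is with respect to arclength. *)
Definition s2 (c : R -> R3) (t : R) : R :=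
  Derive (s1 c) t / (speed c t * curvature c t).

Definition s3 (c : R -> R3) (t : R) : R :=
  curvature c t * (1 + mod_torsion c t ^ 2) * (1 - mod_torsion c t ^ 2).

(* If the end points are fixed and Y is the infinitesimal rotation of the frame,
   d/ds T = Y x T, d/ds N = Y x N, d/ds B = Y x B at s = 0, then the boundary
   terms of the first variation of [sadowsky] are
     2 [ < s1 T + s2 N + s3 B, Y > ]_0^L,
   the force term [ < b0, d/ds G > ]_0^L being zero.  The three components of Y
   are < dN/ds, B >, < dB/ds, T > and < dT/ds, N >. *)
Definition strip_boundary (c : R -> R3) (G : R -> R -> R3) (t : R) : R :=
  s1 c t * vdot (vD (fun s => frenet_N (G s) t) 0) (frenet_B c t) +
  s2 c t * vdot (vD (fun s => frenet_B (G s) t) 0) (frenet_T c t) +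
  s3 c t * vdot (vD (fun s => frenet_T (G s) t) 0) (frenet_N c t).

Definition proper_variation (eps L : R) (c : R -> R3) (G : R -> R -> R3) : Prop :=
  variation eps L c G /\ fixes_ends eps L c G /\
  strip_boundary c G L - strip_boundary c G 0 = 0.

Definition elastic_strip (mu L : R) (c : R -> R3) : Prop :=
  frenet_curve L c /\
  forall (eps : R) (G : R -> R -> R3), 0 < eps ->
    proper_variation eps L c G ->
    is_derive (fun s => sadowsky mu L (G s)) 0 0.

Definition momentum_strip (L : R) (c : R -> R3) : Prop :=
  frenet_curve L c /\
  exists a : R, a <> 0 /\ forall t, 0 <= t <= L -> s1 c t = a.

Definition elastic_momentum_strip (mu L : R) (c : R -> R3) : Prop :=
  momentum_strip L c /\ elastic_strip mu L c.

Definition spherical_curve (L : R) (c : R -> R3) : Prop :=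
  forall t, 0 <= t <= L -> vdot (c t) (c t) = 1.

(* Signed with respect to the unit normal c x c' / |c'|, in any regular
   parametrization. *)
Definition geod_curvature (c : R -> R3) (t : R) : R :=
  vdet (c t) (vD c t) (vD (vD c) t) / speed c t ^ 3.

Definition spherical_energy (l L : R) (c : R -> R3) : R :=
  RInt (fun t => (geod_curvature c t ^ 2 + l) * speed c t) 0 L.

(* With fixed end points, the boundary terms of the first variation of
   [spherical_energy] are 2 [ k < d/ds T, n > ]_0^L, where n is the unit normal
   of the curve in the sphere. *)
Definition spherical_boundary (c : R -> R3) (G : R -> R -> R3) (t : R) : R :=
  geod_curvature c t *
  vdot (vD (fun s => frenet_T (G s) t) 0) (vcross (c t) (frenet_T c t)).

Definition proper_spherical_variation
    (eps L : R) (c : R -> R3) (G : R -> R -> R3) : Prop :=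
  variation eps L c G /\
  (forall s, - eps < s < eps -> spherical_curve L (G s)) /\
  fixes_ends eps L c G /\
  spherical_boundary c G L - spherical_boundary c G 0 = 0.

(* The energy does not depend on the parametrization, so this notion applies to
   an arbitrary regular curve in the sphere, of any speed. *)
Definition spherical_elastic (l L : R) (c : R -> R3) : Prop :=
  smooth_curve L c /\ spherical_curve L c /\
  (forall t, 0 <= t <= L -> vD c t <> vzero) /\
  forall (eps : R) (G : R -> R -> R3), 0 < eps ->
    proper_spherical_variation eps L c G ->
    is_derive (fun s => spherical_energy l L (G s)) 0 0.

(* Main.v *)
From Stdlib Require Import Lra Lia ClassicalEpsilon FunctionalExtensionality Ranalysis5.
Require Import Defs.

(* In the moving frame of a family of curves, the first variation of [sadowsky]
   is the exact derivative of 2 < torque, Y > - 2 < force, W > plus the term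
   2 < force', W >, where W is the variation field and Y the infinitesimal
   rotation of the frame; so a strip is elastic if and only if its force vector
   is constant.  Likewise, the first variation of [spherical_energy] is an exact
   derivative plus the Euler-Lagrange expression paired with the normal
   component of the variation.
   When s1 is constant, the force vector satisfies two of its three conservation
   equations identically.  The remaining one, along N, is the Euler-Lagrange
   equation of the binormal, whose geodesic curvature is 1 / |lambda|.  For the
   curve built from a spherical curve b with geodesic curvature k and conormal
   T, the force is (k^2 + mu) / 2 T - k' b' - k b, and its derivative is minus
   the Euler-Lagrange expression of b times b'. *)

(** * Joint smoothness in two variables *)

(** Curves and variations are treated alike: the lemmas concern families over an open domain [U] of
    the (s, t)-plane, and a single curve is a family constant in [s]. The domain cannot be fixed
    beforehand, because the Frenet condition is given only at s = 0 for t in [0, L]: it is cut down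
    to the open set where the condition persists, and compactness of [0, L] returns a uniform
    neighbourhood. Moreover nothing is known beyond the ends: a variation at s = 0 agrees with the
    given curve on [0, L] only, and a spherical variation is spherical only there. Identities are
    therefore proved on the open interval and carried to the ends by continuity. The computations
    use the speed v and the rates q = v kappa and p = v kappa lambda: their variations follow from
    commuting mixed derivatives alone, and the energy density is rational in v, q, p. The condition
    s1 = a reads a v = 2 p (1 + p^2 / q^2). As |p| is the speed of the binormal and q / |p| its
    geodesic curvature, the binormal and a determine v; this is the origin of the factor 1 + 1 /
    lambda^2 in the converse. *)

Definition open2 (U : R -> R -> Prop) : Prop :=
  forall s t, U s t -> locally_2d U s t.

Definition smooth2 (U : R -> R -> Prop) (f : R -> R -> R) : Prop :=
  forall s t, U s t -> forall n, ex_diff_n f n s t.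

Lemma locally_2d_mono (P Q : R -> R -> Prop) s t :
  (forall u v, P u v -> Q u v) -> locally_2d P s t -> locally_2d Q s t.
Proof. intros H [d Hd]. exists d. intros u v Hu Hv. apply H, Hd; assumption. Qed.

(** [ex_diff_n] recurses on the partial derivatives themselves, so the induction on the order has to
    run over all members of [P] at once. Openness of [U] allows a partial derivative to be replaced
    by the member of [P] that it equals on [U]. *)
Lemma smooth2_coind (U : R -> R -> Prop) (P : (R -> R -> R) -> Prop) :
  open2 U ->
  (forall f, P f ->
     (forall s t, U s t -> continuity_2d_pt f s t) /\
     exists f1 f2, P f1 /\ P f2 /\
       forall s t, U s t ->
         is_derive (fun z => f z t) s (f1 s t) /\
         is_derive (fun z => f s z) t (f2 s t)) ->
  forall f, P f -> smooth2 U f.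
Proof.
  intros HU HP f Hf s t Hst n. revert f Hf s t Hst.
  induction n as [|n IH]; intros f Hf s t Hst;
    destruct (HP f Hf) as [Hc [f1 [f2 [H1 [H2 Hd]]]]].
  - split; [apply Hc, Hst | exact I].
  - split; [apply Hc, Hst |].
    destruct (Hd s t Hst) as [Hd1 Hd2].
    split; [exists (f1 s t); exact Hd1 |].
    split; [exists (f2 s t); exact Hd2 |].
    split.
    + apply ex_diff_n_ext_loc with f1; [|apply IH; assumption].
      apply locally_2d_mono with U; [|apply HU, Hst].
      intros u v Huv. symmetry. apply is_derive_unique, (Hd u v Huv).
    + apply ex_diff_n_ext_loc with f2; [|apply IH; assumption].
      apply locally_2d_mono with U; [|apply HU, Hst].
      intros u v Huv. symmetry. apply is_derive_unique, (Hd u v Huv).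
Qed.

Lemma smooth2_cont U f s t : smooth2 U f -> U s t -> continuity_2d_pt f s t.
Proof. intros H Hu. exact (proj1 (H s t Hu 0%nat)). Qed.

Lemma smooth2_ex_derive_s U f s t :
  smooth2 U f -> U s t -> ex_derive (fun z => f z t) s.
Proof. intros H Hu. exact (proj1 (proj2 (H s t Hu 1%nat))). Qed.

Lemma smooth2_ex_derive_t U f s t :
  smooth2 U f -> U s t -> ex_derive (fun z => f s z) t.
Proof. intros H Hu. exact (proj1 (proj2 (proj2 (H s t Hu 1%nat)))). Qed.

Lemma smooth2_Ds U f :
  smooth2 U f -> smooth2 U (fun s t => Derive (fun z => f z t) s).
Proof. intros H s t Hu n. exact (proj1 (proj2 (proj2 (proj2 (H s t Hu (S n)))))). Qed.

Lemma smooth2_Dt U f :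
  smooth2 U f -> smooth2 U (fun s t => Derive (f s) t).
Proof. intros H s t Hu n. exact (proj2 (proj2 (proj2 (proj2 (H s t Hu (S n)))))). Qed.

Lemma smooth2_ext U f g :
  open2 U -> (forall s t, U s t -> f s t = g s t) -> smooth2 U f -> smooth2 U g.
Proof.
  intros HU He H s t Hu n. apply ex_diff_n_ext_loc with f; [|apply H, Hu].
  apply locally_2d_mono with U; [exact He | apply HU, Hu].
Qed.

Lemma smooth2_sub (U V : R -> R -> Prop) f :
  (forall s t, V s t -> U s t) -> smooth2 U f -> smooth2 V f.
Proof. intros HV H s t Hu. apply H, HV, Hu. Qed.

(* This class is stable under partial differentiation, so that
   [smooth2_coind] yields all the closure properties of [smooth2] at once. *)
Inductive generated (U : R -> R -> Prop) : (R -> R -> R) -> Prop :=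
| gen_base f : smooth2 U f -> generated U f
| gen_const c : generated U (fun _ _ => c)
| gen_plus f g : generated U f -> generated U g -> generated U (fun s t => f s t + g s t)
| gen_mult f g : generated U f -> generated U g -> generated U (fun s t => f s t * g s t)
| gen_inv f : generated U f -> (forall s t, U s t -> f s t <> 0) ->
    generated U (fun s t => / f s t)
| gen_sqrt f : generated U f -> (forall s t, U s t -> 0 < f s t) ->
    generated U (fun s t => sqrt (f s t)).

Lemma generated_cont U f s t : generated U f -> U s t -> continuity_2d_pt f s t.
Proof.
  intros H Hu. induction H.
  - eapply smooth2_cont; eassumption.
  - apply continuity_2d_pt_const.
  - apply continuity_2d_pt_plus; assumption.
  - apply continuity_2d_pt_mult; assumption.
  - apply continuity_2d_pt_inv; auto.
  - apply continuity_1d_2d_pt_comp; [|assumption].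
    apply continuity_pt_sqrt. left. auto.
Qed.

Lemma generated_derive U f :
  generated U f ->
  exists f1 f2, generated U f1 /\ generated U f2 /\
    forall s t, U s t ->
      is_derive (fun z => f z t) s (f1 s t) /\
      is_derive (fun z => f s z) t (f2 s t).
Proof.
  intros H. induction H.
  - exists (fun s t => Derive (fun z => f z t) s), (fun s t => Derive (f s) t).
    split; [apply gen_base, smooth2_Ds, H |].
    split; [apply gen_base, smooth2_Dt, H |].
    intros s t Hu. split; apply Derive_correct.
    + eapply smooth2_ex_derive_s; eassumption.
    + exact (smooth2_ex_derive_t _ _ _ _ H Hu).
  - exists (fun _ _ => 0), (fun _ _ => 0).
    split; [apply gen_const|]. split; [apply gen_const|].
    intros; split; apply @is_derive_const.
  - destruct IHgenerated1 as [f1 [f2 [Hf1 [Hf2 Hf]]]].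
    destruct IHgenerated2 as [g1 [g2 [Hg1 [Hg2 Hg]]]].
    exists (fun s t => f1 s t + g1 s t), (fun s t => f2 s t + g2 s t).
    split; [apply gen_plus; assumption|]. split; [apply gen_plus; assumption|].
    intros s t Hu. destruct (Hf s t Hu), (Hg s t Hu).
    split;
      [apply (is_derive_plus (fun z => f z t) (fun z => g z t))
      |apply (is_derive_plus (f s) (g s))]; assumption.
  - destruct IHgenerated1 as [f1 [f2 [Hf1 [Hf2 Hf]]]].
    destruct IHgenerated2 as [g1 [g2 [Hg1 [Hg2 Hg]]]].
    exists (fun s t => f1 s t * g s t + f s t * g1 s t),
           (fun s t => f2 s t * g s t + f s t * g2 s t).
    split; [apply gen_plus; apply gen_mult; assumption|].
    split; [apply gen_plus; apply gen_mult; assumption|].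
    intros s t Hu. destruct (Hf s t Hu), (Hg s t Hu).
    split;
      [apply (is_derive_mult (fun z => f z t) (fun z => g z t))
      |apply (is_derive_mult (f s) (g s))]; try assumption; intros; apply Rmult_comm.
  - destruct IHgenerated as [f1 [f2 [Hf1 [Hf2 Hf]]]].
    assert (Hi := gen_inv U f H H0).
    (* The derivative - f1 / f^2 is spelled with constants, products and inverses only, so that it
       stays in the generated class. *)
    exists (fun s t => -1 * f1 s t * / f s t * / f s t),
           (fun s t => -1 * f2 s t * / f s t * / f s t).
    split; [repeat (apply gen_mult; try assumption); apply gen_const|].
    split; [repeat (apply gen_mult; try assumption); apply gen_const|].
    intros s t Hu. destruct (Hf s t Hu). specialize (H0 s t Hu).
    split; [replace (-1 * f1 s t * / f s t * / f s t) with (- f1 s t / f s t ^ 2)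
           |replace (-1 * f2 s t * / f s t * / f s t) with (- f2 s t / f s t ^ 2)];
      try (field; assumption);
      [apply (is_derive_inv (fun z => f z t)) | apply (is_derive_inv (fun z => f s z))]; assumption.
  - destruct IHgenerated as [f1 [f2 [Hf1 [Hf2 Hf]]]].
    assert (Hi : generated U (fun s t => / (2 * sqrt (f s t)))).
    { apply gen_inv.
      - apply gen_mult; [apply gen_const | apply gen_sqrt; assumption].
      - intros s t Hu. assert (0 < sqrt (f s t)) by (apply sqrt_lt_R0; auto). lra. }
    exists (fun s t => f1 s t * / (2 * sqrt (f s t))),
           (fun s t => f2 s t * / (2 * sqrt (f s t))).
    split; [apply gen_mult; assumption|]. split; [apply gen_mult; assumption|].
    intros s t Hu. destruct (Hf s t Hu). specialize (H0 s t Hu).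
    split; [apply (is_derive_sqrt (fun z => f z t)) | apply (is_derive_sqrt (fun z => f s z))];
      assumption.
Qed.

Lemma generated_smooth U f : open2 U -> generated U f -> smooth2 U f.
Proof.
  intros HU. apply (smooth2_coind U (generated U) HU).
  intros g Hg. split; [|apply generated_derive, Hg].
  intros s t. apply generated_cont, Hg.
Qed.

Lemma smooth2_const U c : open2 U -> smooth2 U (fun _ _ => c).
Proof. intros HU. apply generated_smooth; [exact HU | apply gen_const]. Qed.

Lemma smooth2_plus U f g :
  open2 U -> smooth2 U f -> smooth2 U g -> smooth2 U (fun s t => f s t + g s t).
Proof. intros HU Hf Hg. apply generated_smooth; [exact HU|]. apply gen_plus; apply gen_base; assumption. Qed.

Lemma smooth2_mult U f g :
  open2 U -> smooth2 U f -> smooth2 U g -> smooth2 U (fun s t => f s t * g s t).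
Proof. intros HU Hf Hg. apply generated_smooth; [exact HU|]. apply gen_mult; apply gen_base; assumption. Qed.

Lemma smooth2_opp U f : open2 U -> smooth2 U f -> smooth2 U (fun s t => - f s t).
Proof.
  intros HU Hf. apply smooth2_ext with (fun s t => -1 * f s t);
    [exact HU | intros; ring | apply smooth2_mult; auto using smooth2_const].
Qed.

Lemma smooth2_minus U f g :
  open2 U -> smooth2 U f -> smooth2 U g -> smooth2 U (fun s t => f s t - g s t).
Proof. intros HU Hf Hg. apply smooth2_plus; [| |apply smooth2_opp]; assumption. Qed.

Lemma smooth2_inv U f :
  open2 U -> smooth2 U f -> (forall s t, U s t -> f s t <> 0) ->
  smooth2 U (fun s t => / f s t).
Proof. intros HU Hf Hn. apply generated_smooth; [exact HU|]. apply gen_inv; [apply gen_base|]; assumption. Qed.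

Lemma smooth2_div U f g :
  open2 U -> smooth2 U f -> smooth2 U g -> (forall s t, U s t -> g s t <> 0) ->
  smooth2 U (fun s t => f s t / g s t).
Proof. intros HU Hf Hg Hn. apply smooth2_mult; [| |apply smooth2_inv]; assumption. Qed.

Lemma smooth2_sqrt U f :
  open2 U -> smooth2 U f -> (forall s t, U s t -> 0 < f s t) ->
  smooth2 U (fun s t => sqrt (f s t)).
Proof. intros HU Hf Hn. apply generated_smooth; [exact HU|]. apply gen_sqrt; [apply gen_base|]; assumption. Qed.

Lemma smooth2_pow U f n :
  open2 U -> smooth2 U f -> smooth2 U (fun s t => f s t ^ n).
Proof.
  intros HU Hf. induction n as [|n IH]; simpl.
  - apply smooth2_const, HU.
  - apply smooth2_mult; assumption.
Qed.

(** * Boxes, cutting down of domains, and the tube lemma *)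

Definition box (eps a b : R) (s t : R) : Prop := - eps < s < eps /\ a < t < b.

Lemma box_open eps a b : open2 (box eps a b).
Proof.
  intros s t [Hs Ht].
  set (d := Rmin (Rmin (s + eps) (eps - s)) (Rmin (t - a) (b - t))).
  assert (Hd : 0 < d) by (unfold d; repeat apply Rmin_glb_lt; lra).
  exists (mkposreal d Hd). simpl. intros u v Hu Hv.
  assert (d <= s + eps /\ d <= eps - s /\ d <= t - a /\ d <= b - t) as [? [? [? ?]]].
  { unfold d.
    assert (E1 := Rmin_l (Rmin (s + eps) (eps - s)) (Rmin (t - a) (b - t))).
    assert (E2 := Rmin_r (Rmin (s + eps) (eps - s)) (Rmin (t - a) (b - t))).
    assert (E3 := Rmin_l (s + eps) (eps - s)). assert (E4 := Rmin_r (s + eps) (eps - s)).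
    assert (E5 := Rmin_l (t - a) (b - t)). assert (E6 := Rmin_r (t - a) (b - t)).
    lra. }
  apply Rabs_lt_between in Hu, Hv. unfold box. lra.
Qed.

Lemma open2_and (U V : R -> R -> Prop) :
  open2 U -> open2 V -> open2 (fun s t => U s t /\ V s t).
Proof. intros HU HV s t [Hu Hv]. apply locally_2d_and; auto. Qed.

(** This cuts a domain down to the part where a nondegeneracy condition holds: regularity, the
    Frenet condition, or a nonzero rate or curvature that has to be divided by. *)
Lemma open2_pos U f :
  open2 U -> smooth2 U f -> open2 (fun s t => U s t /\ 0 < f s t).
Proof.
  intros HU Hf s t [Hu Hp]. apply locally_2d_and; [apply HU, Hu|].
  destruct (smooth2_cont U f s t Hf Hu (mkposreal _ Hp)) as [d Hd].
  exists d. intros u v H1 H2. specialize (Hd u v H1 H2). simpl in Hd.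
  apply Rabs_lt_between in Hd. lra.
Qed.

Lemma smooth2_id_s U : open2 U -> smooth2 U (fun s _ => s).
Proof.
  intros HU.
  apply (smooth2_coind U (fun f => f = (fun s _ => s) \/ exists c, f = (fun _ _ => c)) HU).
  2: now left.
  intros f [-> | [c ->]].
  - split; [intros; apply continuity_2d_pt_id1|].
    exists (fun _ _ => 1), (fun _ _ => 0).
    split; [eauto|]. split; [eauto|].
    intros; split; [apply @is_derive_id | apply @is_derive_const].
  - split; [intros; apply continuity_2d_pt_const|].
    exists (fun _ _ => 0), (fun _ _ => 0). 
    split; [eauto|]. split; [eauto|]. intros; split; apply @is_derive_const.
Qed.

Lemma smooth2_id_t U : open2 U -> smooth2 U (fun _ t => t).
Proof.
  intros HU.
  apply (smooth2_coind U (fun f => f = (fun _ t => t) \/ exists c, f = (fun _ _ => c)) HU).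
  2: now left.
  intros f [-> | [c ->]].
  - split; [intros; apply continuity_2d_pt_id2|].
    exists (fun _ _ => 0), (fun _ _ => 1).
    split; [eauto|]. split; [eauto|].
    intros; split; [apply @is_derive_const | apply @is_derive_id].
  - split; [intros; apply continuity_2d_pt_const|].
    exists (fun _ _ => 0), (fun _ _ => 0). 
    split; [eauto|]. split; [eauto|]. intros; split; apply @is_derive_const.
Qed.

(** The zero function and the iterated derivatives of [f] form a class stable under both partial
    derivatives. *)
Lemma smooth2_of_1d (U : R -> R -> Prop) f :
  open2 U -> (forall s t, U s t -> forall n, ex_derive_n f n t) ->
  smooth2 U (fun _ t => f t).
Proof.
  intros HU Hf.
  apply (smooth2_coind U
    (fun g => g = (fun _ _ => 0) \/ exists m, g = (fun _ t => Derive_n f m t)) HU).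
  2: right; exists 0%nat; reflexivity.
  intros g [-> | [m ->]].
  - split; [intros; apply continuity_2d_pt_const|].
    exists (fun _ _ => 0), (fun _ _ => 0). 
    split; [eauto|]. split; [eauto|]. intros; split; apply @is_derive_const.
  - assert (Hd : forall s t, U s t -> is_derive (Derive_n f m) t (Derive_n f (S m) t)).
    { intros s t Hu. simpl. apply Derive_correct. exact (Hf s t Hu (S m)). }
    split.
    + intros s t Hu. apply (continuity_1d_2d_pt_comp (Derive_n f m) (fun _ v => v)).
      * apply continuity_pt_filterlim, (@ex_derive_continuous R_AbsRing R_NormedModule).
        eexists. exact (Hd s t Hu).
      * apply continuity_2d_pt_id2.
    + exists (fun _ _ => 0), (fun _ t => Derive_n f (S m) t).
      split; [now left|]. split; [right; now exists (S m)|].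
      intros s t Hu. split; [apply @is_derive_const | apply (Hd s t Hu)].
Qed.

Lemma smooth2_Derive_n U f n :
  smooth2 U f -> smooth2 U (fun s t => Derive_n (f s) n t).
Proof.
  intros Hf. induction n as [|n IH]; [exact Hf|].
  exact (smooth2_Dt U _ IH).
Qed.

Lemma smooth2_ex_derive_n U f s t n :
  smooth2 U f -> U s t -> ex_derive_n (f s) n t.
Proof.
  intros Hf Hu. destruct n as [|n]; [exact I|].
  exact (smooth2_ex_derive_t U _ s t (smooth2_Derive_n U f n Hf) Hu).
Qed.

(* [box 1 (- del) (L + del)]: the first parameter is a dummy. *)
Lemma smooth_fun_smooth2 L f :
  smooth_fun L f ->
  exists del, 0 < del /\ smooth2 (box 1 (- del) (L + del)) (fun _ t => f t).
Proof.
  intros [del [Hd H]]. exists del. split; [exact Hd|].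
  apply smooth2_of_1d; [apply box_open|]. intros s t [_ Ht]. apply H, Ht.
Qed.

(** The tube lemma: by compactness an open set containing a segment contains a uniform neighbourhood
    of it, reaching beyond both ends. That margin is what smoothness on a closed interval
    demands. *)
Lemma tube (U : R -> R -> Prop) s a b :
  open2 U -> (forall t, a <= t <= b -> U s t) ->
  exists d, 0 < d /\ forall u v, Rabs (u - s) < d -> a - d < v < b + d ->
    a <= b -> U u v.
Proof.
  intros HU H.
  assert (Hex : forall t, exists d : posreal, a <= t <= b ->
    forall u v, Rabs (u - s) < d -> Rabs (v - t) < d -> U u v).
  { intros t. destruct (excluded_middle_informative (a <= t <= b)) as [Ht|Ht].
    - destruct (HU s t (H t Ht)) as [d Hd]. exists d. auto.
    - exists (mkposreal 1 Rlt_0_1). tauto. }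
  set (rad := fun t => proj1_sig (constructive_indefinite_description _ (Hex t))).
  assert (Hrad : forall t, a <= t <= b -> forall u v,
    Rabs (u - s) < rad t -> Rabs (v - t) < rad t -> U u v).
  { intros t. unfold rad. destruct constructive_indefinite_description; simpl; auto. }
  (* Half of each radius pays for the distance from the clamped point [v'] to the centre [t], the
     other half for the distance from [v] to [v']. *)
  set (half := fun t => mkposreal (rad t / 2) (is_pos_div_2 (rad t))).
  destruct (compactness_value_1d a b half) as [d Hd].
  exists d. split; [apply cond_pos|]. intros u v Hu Hv Hab.
  set (v' := Rmax a (Rmin v b)).
  assert (Hv' : a <= v' <= b).
  { unfold v'. split; [apply Rmax_l|]. apply Rmax_lub; [lra | apply Rmin_r]. }
  assert (Hvv : Rabs (v - v') < d).
  { assert (0 < d) by apply cond_pos. unfold v', Rmax, Rmin.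
    repeat destruct Rle_dec; apply Rabs_lt_between; lra. }
  (* The compactness statement yields its centre [t] only under a double negation. *)
  apply NNPP. intros Hn. apply (Hd v' Hv'). intros [t [Ht [H1 H2]]].
  apply Hn. simpl in H1, H2. apply (Hrad t Ht).
  - assert (0 < rad t) by apply cond_pos. lra.
  - replace (v - t) with ((v - v') + (v' - t)) by ring.
    eapply Rle_lt_trans; [apply Rabs_triang|]. lra.
Qed.

Lemma smooth_fun_of_smooth2 (U : R -> R -> Prop) L f :
  0 < L -> open2 U -> (forall t, 0 <= t <= L -> U 0 t) ->
  smooth2 U (fun _ t => f t) -> smooth_fun L f.
Proof.
  intros HL HU H Hf. destruct (tube U 0 0 L HU H) as [d [Hd Ht]].
  exists d. split; [exact Hd|]. intros t Htt n.
  apply (smooth2_ex_derive_n U (fun _ => f) 0 t n Hf).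
  apply Ht; [rewrite Rminus_0_r, Rabs_R0; exact Hd | lra | lra].
Qed.

(** * Frenet frames in a family of curves *)

Definition vadd (u w : R3) : R3 := (X1 u + X1 w, X2 u + X2 w, X3 u + X3 w).

Definition smoothV (U : R -> R -> Prop) (F : R -> R -> R3) : Prop :=
  smooth2 U (fun s t => X1 (F s t)) /\
  smooth2 U (fun s t => X2 (F s t)) /\
  smooth2 U (fun s t => X3 (F s t)).

Definition ex_vD (c : R -> R3) (t : R) : Prop :=
  ex_derive (fun r => X1 (c r)) t /\
  ex_derive (fun r => X2 (c r)) t /\
  ex_derive (fun r => X3 (c r)) t.

Lemma R3_eq u w : X1 u = X1 w -> X2 u = X2 w -> X3 u = X3 w -> u = w.
Proof. destruct u as [[? ?] ?], w as [[? ?] ?]. cbn. congruence. Qed.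

Lemma vdot_comm u w : vdot u w = vdot w u.
Proof. unfold vdot. ring. Qed.

Lemma vdot_pos u : u <> vzero -> 0 < vdot u u.
Proof.
  intros H. destruct (Rle_lt_dec (vdot u u) 0) as [Hl|Hl]; [exfalso|exact Hl].
  unfold vdot in Hl. apply H. apply R3_eq; unfold vzero; cbn; nra.
Qed.

Lemma vdot_pos_neq u : 0 < vdot u u -> u <> vzero.
Proof. intros H E. rewrite E in H. unfold vdot, vzero in H. cbn in H. lra. Qed.

Lemma vnorm_sqr u : vnorm u * vnorm u = vdot u u.
Proof. apply sqrt_sqrt. unfold vdot. nra. Qed.

Lemma vnorm_pos u : 0 < vdot u u -> 0 < vnorm u.
Proof. apply sqrt_lt_R0. Qed.

Lemma vcross_pos u w : 0 < vdot (vcross u w) (vcross u w) -> 0 < vdot u u.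
Proof.
  intros H. apply vdot_pos. intros E. rewrite E in H.
  unfold vdot, vcross, vzero in H. cbn in H. nra.
Qed.

(* Parseval for the orthogonal triple u, w, w x u, before normalisation. *)
Lemma vdot_frame u w x y :
  vdot x y * (vdot u u * vdot w w - vdot u w ^ 2) =
  vdot x u * vdot y u * vdot w w + vdot x w * vdot y w * vdot u u
  - vdot u w * (vdot x u * vdot y w + vdot x w * vdot y u)
  + vdot x (vcross w u) * vdot y (vcross w u).
Proof. unfold vdot, vcross; cbn; ring. Qed.

Lemma vdot_frame1 u w x y :
  vdot u u = 1 -> vdot w w = 1 -> vdot u w = 0 ->
  vdot x y = vdot x u * vdot y u + vdot x w * vdot y w
             + vdot x (vcross w u) * vdot y (vcross w u).
Proof.
  intros Hu Hw H. assert (E := vdot_frame u w x y). rewrite Hu, Hw, H in E. lra.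
Qed.

Lemma Derive_mult_plus (c d e f : R -> R) t :
  ex_derive c t -> ex_derive d t -> ex_derive e t -> ex_derive f t ->
  Derive (fun r => c r * d r + e r * f r) t =
  (Derive c t * d t + c t * Derive d t) + (Derive e t * f t + e t * Derive f t).
Proof.
  intros. rewrite Derive_plus, !Derive_mult; try assumption; [reflexivity | |];
    apply ex_derive_mult; assumption.
Qed.

Lemma Derive_dot c d t : ex_vD c t -> ex_vD d t ->
  Derive (fun r => vdot (c r) (d r)) t = vdot (vD c t) (d t) + vdot (c t) (vD d t).
Proof.
  intros [? [? ?]] [? [? ?]]. unfold vdot.
  rewrite (Derive_plus (fun r => X1 (c r) * X1 (d r) + X2 (c r) * X2 (d r))
             (fun r => X3 (c r) * X3 (d r))).
  - rewrite (Derive_mult_plus (fun r => X1 (c r)) (fun r => X1 (d r))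
      (fun r => X2 (c r)) (fun r => X2 (d r))), Derive_mult by assumption.
    unfold vD; cbn. ring.
  - apply @ex_derive_plus; apply ex_derive_mult; assumption.
  - apply ex_derive_mult; assumption.
Qed.

Lemma vD_scale a c t : ex_derive a t -> ex_vD c t ->
  vD (fun r => vscale (a r) (c r)) t = vadd (vscale (Derive a t) (c t)) (vscale (a t) (vD c t)).
Proof.
  intros Ha [? [? ?]]. unfold vD, vadd, vscale.
  apply R3_eq; cbn; apply (Derive_mult a); assumption.
Qed.

Lemma vD_add c d t : ex_vD c t -> ex_vD d t ->
  vD (fun r => vadd (c r) (d r)) t = vadd (vD c t) (vD d t).
Proof.
  intros [? [? ?]] [? [? ?]]. unfold vD, vadd.
  apply R3_eq; cbn; apply Derive_plus; assumption.
Qed.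

Lemma vD_ext_loc c d t : locally t (fun r => c r = d r) -> vD c t = vD d t.
Proof.
  intros H. unfold vD.
  f_equal; [f_equal|]; apply Derive_ext_loc;
    apply (filter_imp (fun r => c r = d r)); try exact H; intros r ->; reflexivity.
Qed.

Lemma smoothV_ex_t U F s t : smoothV U F -> U s t -> ex_vD (F s) t.
Proof.
  intros [H1 [H2 H3]] Hu.
  exact (conj (smooth2_ex_derive_t U _ s t H1 Hu)
    (conj (smooth2_ex_derive_t U _ s t H2 Hu) (smooth2_ex_derive_t U _ s t H3 Hu))).
Qed.

Lemma smoothV_ex_s U F s t : smoothV U F -> U s t -> ex_vD (fun r => F r t) s.
Proof.
  intros [H1 [H2 H3]] Hu.
  exact (conj (smooth2_ex_derive_s U _ s t H1 Hu)
    (conj (smooth2_ex_derive_s U _ s t H2 Hu) (smooth2_ex_derive_s U _ s t H3 Hu))).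
Qed.

Lemma smoothV_Dt U F : smoothV U F -> smoothV U (fun s t => vD (F s) t).
Proof. intros [H1 [H2 H3]]. split; [|split]; apply smooth2_Dt; assumption. Qed.

Lemma smoothV_Ds U F : smoothV U F -> smoothV U (fun s t => vD (fun r => F r t) s).
Proof. intros [H1 [H2 H3]]. split; [|split]; cbn; apply (smooth2_Ds U _); assumption. Qed.

Lemma smooth2_dot U F H : open2 U -> smoothV U F -> smoothV U H ->
  smooth2 U (fun s t => vdot (F s t) (H s t)).
Proof.
  intros HU [? [? ?]] [? [? ?]]. unfold vdot.
  repeat apply smooth2_plus; try apply smooth2_mult; assumption.
Qed.

Lemma smoothV_cross U F H : open2 U -> smoothV U F -> smoothV U H ->
  smoothV U (fun s t => vcross (F s t) (H s t)).
Proof.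
  intros HU [? [? ?]] [? [? ?]].
  split; [|split]; cbn; apply smooth2_minus; try apply smooth2_mult; assumption.
Qed.

Lemma smoothV_scale U a F : open2 U -> smooth2 U a -> smoothV U F ->
  smoothV U (fun s t => vscale (a s t) (F s t)).
Proof. intros HU Ha [? [? ?]]. split; [|split]; cbn; apply smooth2_mult; assumption. Qed.

Lemma smoothV_add U F H : open2 U -> smoothV U F -> smoothV U H ->
  smoothV U (fun s t => vadd (F s t) (H s t)).
Proof.
  intros HU [? [? ?]] [? [? ?]]. split; [|split]; cbn; apply smooth2_plus; assumption.
Qed.

Lemma smoothV_sub (U V : R -> R -> Prop) F :
  (forall s t, V s t -> U s t) -> smoothV U F -> smoothV V F.
Proof.
  intros H [H1 [H2 H3]].
  split; [|split]; (eapply smooth2_sub; [exact H|]); assumption.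
Qed.

Lemma smooth2_norm U F : open2 U -> smoothV U F ->
  (forall s t, U s t -> 0 < vdot (F s t) (F s t)) ->
  smooth2 U (fun s t => vnorm (F s t)).
Proof.
  intros HU HF Hp. unfold vnorm. apply smooth2_sqrt; [exact HU | | exact Hp].
  apply smooth2_dot; assumption.
Qed.

Lemma open2_slice_t (U P : R -> R -> Prop) s t :
  open2 U -> (forall u v, U u v -> P u v) -> U s t -> locally t (P s).
Proof.
  intros HU H Hu. apply (locally_2d_1d_const_x P).
  apply locally_2d_mono with U; auto.
Qed.

Lemma open2_slice_s (U P : R -> R -> Prop) s t :
  open2 U -> (forall u v, U u v -> P u v) -> U s t -> locally s (fun r => P r t).
Proof.
  intros HU H Hu. apply (locally_2d_1d_const_y P).
  apply locally_2d_mono with U; auto.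
Qed.

Lemma Ds_ext U f g s t : open2 U -> (forall s t, U s t -> f s t = g s t) ->
  U s t -> Derive (fun r => f r t) s = Derive (fun r => g r t) s.
Proof. intros HU H Hu. apply Derive_ext_loc. exact (open2_slice_s U (fun u v => f u v = g u v) s t HU H Hu). Qed.

Lemma Schwarz_smooth2 U f s t : open2 U -> smooth2 U f -> U s t ->
  Derive (fun z => Derive (fun r => f z r) t) s = Derive (fun z => Derive (fun r => f r z) s) t.
Proof.
  intros HU Hf Hu. apply Schwarz.
  - apply locally_2d_mono with U; [|apply HU, Hu]. intros u v Huv.
    split; [eapply smooth2_ex_derive_s; eassumption|].
    split; [exact (smooth2_ex_derive_t U f u v Hf Huv)|].
    split; [exact (smooth2_ex_derive_s U _ u v (smooth2_Dt U f Hf) Huv)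
           |exact (smooth2_ex_derive_t U _ u v (smooth2_Ds U f Hf) Huv)].
  - exact (smooth2_cont U _ s t (smooth2_Ds U _ (smooth2_Dt U f Hf)) Hu).
  - exact (smooth2_cont U _ s t (smooth2_Dt U _ (smooth2_Ds U f Hf)) Hu).
Qed.

Lemma vD_Schwarz U F s t : open2 U -> smoothV U F -> U s t ->
  vD (fun r => vD (F r) t) s = vD (fun z => vD (fun r => F r z) s) t.
Proof.
  intros HU [H1 [H2 H3]] Hu. unfold vD. apply R3_eq; cbn.
  - apply (Schwarz_smooth2 U (fun s t => X1 (F s t))); assumption.
  - apply (Schwarz_smooth2 U (fun s t => X2 (F s t))); assumption.
  - apply (Schwarz_smooth2 U (fun s t => X3 (F s t))); assumption.
Qed.

(** * Moving frames and their structure equations *)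

Definition regular_family (U : R -> R -> Prop) (G : R -> R -> R3) : Prop :=
  open2 U /\ smoothV U G /\
  forall s t, U s t -> 0 < vdot (vD (G s) t) (vD (G s) t).

Definition frenet_family (U : R -> R -> Prop) (G : R -> R -> R3) : Prop :=
  open2 U /\ smoothV U G /\
  forall s t, U s t ->
    0 < vdot (vcross (vD (G s) t) (vD (vD (G s)) t))
             (vcross (vD (G s) t) (vD (vD (G s)) t)).

Lemma frenet_family_regular U G : frenet_family U G -> regular_family U G.
Proof.
  intros [HU [HG Hr]]. split; [exact HU|]. split; [exact HG|].
  intros s t Hu. eapply vcross_pos, Hr, Hu.
Qed.

Lemma smooth2_speed U G : regular_family U G -> smooth2 U (fun s t => speed (G s) t).
Proof.
  intros [HU [HG Hr]]. unfold speed.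
  apply (smooth2_norm U (fun s t => vD (G s) t) HU); [apply smoothV_Dt, HG | exact Hr].
Qed.

Lemma speed_pos U G s t : regular_family U G -> U s t -> 0 < speed (G s) t.
Proof. intros [HU [HG Hr]] Hu. apply vnorm_pos, Hr, Hu. Qed.

Lemma smoothV_T U G : regular_family U G -> smoothV U (fun s => frenet_T (G s)).
Proof.
  intros H. assert (H0 := H). destruct H as [HU [HG Hr]]. unfold frenet_T.
  apply (smoothV_scale U (fun s t => / speed (G s) t) (fun s => vD (G s))); [exact HU| |apply smoothV_Dt, HG].
  apply smooth2_inv; [exact HU|apply smooth2_speed, H0|].
  intros s t Hu. assert (E := speed_pos U G s t H0 Hu). lra.
Qed.

Lemma smoothV_osculating U G : open2 U -> smoothV U G ->
  smoothV U (fun s t => vcross (vD (G s) t) (vD (vD (G s)) t)).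
Proof.
  intros HU HG. apply smoothV_cross; [exact HU|apply smoothV_Dt, HG|].
  apply (smoothV_Dt U (fun s t => vD (G s) t)), smoothV_Dt, HG.
Qed.

Lemma smoothV_B U G : frenet_family U G -> smoothV U (fun s => frenet_B (G s)).
Proof.
  intros [HU [HG Hr]]. unfold frenet_B.
  apply (smoothV_scale U (fun s t => / vnorm (vcross (vD (G s) t) (vD (vD (G s)) t)))
    (fun s t => vcross (vD (G s) t) (vD (vD (G s)) t))); [exact HU| |apply smoothV_osculating; assumption].
  apply smooth2_inv; [exact HU| |].
  - apply (smooth2_norm U (fun s t => vcross (vD (G s) t) (vD (vD (G s)) t)) HU);
      [apply smoothV_osculating; assumption | exact Hr].
  - intros s t Hu. apply Rgt_not_eq, vnorm_pos, Hr, Hu.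
Qed.

Lemma smoothV_N U G : frenet_family U G -> smoothV U (fun s => frenet_N (G s)).
Proof.
  intros H. unfold frenet_N.
  apply (smoothV_cross U (fun s => frenet_B (G s)) (fun s => frenet_T (G s))); [apply H|apply smoothV_B, H|].
  apply smoothV_T, frenet_family_regular, H.
Qed.

(* [bend_rate] and [twist_rate] are the components of the Darboux vector: v kappa and v lambda kappa. *)
Definition bend_rate (c : R -> R3) (t : R) : R := vdot (vD (frenet_T c) t) (frenet_N c t).
Definition twist_rate (c : R -> R3) (t : R) : R := vdot (vD (frenet_N c) t) (frenet_B c t).

Lemma smooth2_bend_rate U G : frenet_family U G -> smooth2 U (fun s t => bend_rate (G s) t).
Proof.
  intros H. apply smooth2_dot; [apply H| |apply smoothV_N, H].
  apply (smoothV_Dt U (fun s => frenet_T (G s))), smoothV_T, frenet_family_regular, H.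
Qed.

Lemma smooth2_twist_rate U G : frenet_family U G -> smooth2 U (fun s t => twist_rate (G s) t).
Proof.
  intros H. apply smooth2_dot; [apply H| |apply smoothV_B, H].
  apply (smoothV_Dt U (fun s => frenet_N (G s))), smoothV_N, H.
Qed.

Lemma frenet_orthonormal U G s t : frenet_family U G -> U s t ->
  vdot (frenet_T (G s) t) (frenet_T (G s) t) = 1 /\
  vdot (frenet_N (G s) t) (frenet_N (G s) t) = 1 /\
  vdot (frenet_B (G s) t) (frenet_B (G s) t) = 1 /\
  vdot (frenet_T (G s) t) (frenet_N (G s) t) = 0 /\
  vdot (frenet_T (G s) t) (frenet_B (G s) t) = 0 /\
  vdot (frenet_N (G s) t) (frenet_B (G s) t) = 0.
Proof.
  intros H Hu.
  assert (Hv := speed_pos U G s t (frenet_family_regular U G H) Hu).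
  assert (Hv2 := vnorm_sqr (vD (G s) t)). fold (speed (G s) t) in Hv2.
  destruct H as [HU [HG Hr]]. specialize (Hr s t Hu).
  assert (Hc := vnorm_pos _ Hr). assert (Hc2 := vnorm_sqr (vcross (vD (G s) t) (vD (vD (G s)) t))).
  unfold frenet_N.
  assert (HT : vdot (frenet_T (G s) t) (frenet_T (G s) t) = 1).
  { unfold frenet_T. replace 1 with (vdot (vD (G s) t) (vD (G s) t) / (speed (G s) t * speed (G s) t)).
    - unfold vdot, vscale; cbn. field. lra.
    - rewrite <- Hv2. field. lra. }
  assert (HB : vdot (frenet_B (G s) t) (frenet_B (G s) t) = 1).
  { unfold frenet_B. set (w := vcross _ _) in *. replace 1 with (vdot w w / (vnorm w * vnorm w)).
    - unfold vdot, vscale; cbn. field. lra.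
    - rewrite <- Hc2. field. lra. }
  assert (HTB : vdot (frenet_T (G s) t) (frenet_B (G s) t) = 0).
  { unfold frenet_T, frenet_B, vdot, vscale, vcross; cbn. ring. }
  split; [exact HT|]. split.
  { replace (vdot _ _) with
      (vdot (frenet_T (G s) t) (frenet_T (G s) t) * vdot (frenet_B (G s) t) (frenet_B (G s) t)
       - vdot (frenet_T (G s) t) (frenet_B (G s) t) ^ 2).
    - rewrite HT, HB, HTB. ring.
    - unfold vdot, vcross; cbn; ring. }
  split; [exact HB|].
  split; [unfold vdot, vcross; cbn; ring|]. split; [exact HTB|].
  unfold vdot, vcross; cbn; ring.
Qed.

(** Differentiating a constant inner product gives every skew-symmetry relation of the moving
    frames, in the direction of [t] as well as of [s]. *)
Lemma Derive_dot_const c d t k : ex_vD c t -> ex_vD d t ->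
  locally t (fun r => vdot (c r) (d r) = k) ->
  vdot (vD c t) (d t) = - vdot (vD d t) (c t).
Proof.
  intros Hc Hd Hl. assert (E := Derive_dot c d t Hc Hd).
  assert (E0 : Derive (fun r => vdot (c r) (d r)) t = 0)
    by (etransitivity; [exact (Derive_ext_loc _ (fun _ => k) t Hl) | apply Derive_const]).
  rewrite (vdot_comm (vD d t)). lra.
Qed.

Lemma Dt_dot_const U F H k s t : open2 U -> smoothV U F -> smoothV U H ->
  (forall s t, U s t -> vdot (F s t) (H s t) = k) -> U s t ->
  vdot (vD (F s) t) (H s t) = - vdot (vD (H s) t) (F s t).
Proof.
  intros HU HF HH E Hu. apply Derive_dot_const with k.
  - eapply smoothV_ex_t; eassumption.
  - eapply smoothV_ex_t; eassumption.
  - exact (open2_slice_t U (fun s t => vdot (F s t) (H s t) = k) s t HU E Hu).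
Qed.

Lemma Ds_dot_const U F H k s t : open2 U -> smoothV U F -> smoothV U H ->
  (forall s t, U s t -> vdot (F s t) (H s t) = k) -> U s t ->
  vdot (vD (fun r => F r t) s) (H s t) = - vdot (vD (fun r => H r t) s) (F s t).
Proof.
  intros HU HF HH E Hu. apply (Derive_dot_const (fun r => F r t) (fun r => H r t)) with k.
  - eapply smoothV_ex_s; eassumption.
  - eapply smoothV_ex_s; eassumption.
  - exact (open2_slice_s U (fun s t => vdot (F s t) (H s t) = k) s t HU E Hu).
Qed.

Lemma vD_speed_T U G s t : regular_family U G -> U s t ->
  vD (G s) t = vscale (speed (G s) t) (frenet_T (G s) t).
Proof.
  intros H Hu. assert (Hv := speed_pos U G s t H Hu).
  unfold frenet_T, vscale; apply R3_eq; cbn; field; lra.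
Qed.

Lemma vD2_speed_T U G s t : regular_family U G -> U s t ->
  vD (vD (G s)) t = vadd (vscale (Derive (speed (G s)) t) (frenet_T (G s) t))
                         (vscale (speed (G s) t) (vD (frenet_T (G s)) t)).
Proof.
  intros H Hu.
  transitivity (vD (fun r => vscale (speed (G s) r) (frenet_T (G s) r)) t).
  - apply vD_ext_loc.
    apply (open2_slice_t U (fun s t => vD (G s) t = vscale (speed (G s) t) (frenet_T (G s) t)));
      [apply H| |exact Hu].
    intros u v. apply vD_speed_T, H.
  - apply vD_scale.
    + exact (smooth2_ex_derive_t U _ s t (smooth2_speed U G H) Hu).
    + exact (smoothV_ex_t U _ s t (smoothV_T U G H) Hu).
Qed.

Lemma vcross_B U G s t : frenet_family U G -> U s t ->
  vcross (vD (G s) t) (vD (vD (G s)) t) =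
  vscale (vnorm (vcross (vD (G s) t) (vD (vD (G s)) t))) (frenet_B (G s) t).
Proof.
  intros [HU [HG Hr]] Hu. assert (Hc := vnorm_pos _ (Hr s t Hu)).
  unfold frenet_B, vscale. set (w := vcross _ _) in *. apply R3_eq; cbn; field; lra.
Qed.

(** The part of gamma'' along T drops out of the cross product, so v^2 (T x T') = |gamma' x gamma''|
    B. Pairing with B gives the first equation, since <T x T', B> = <T', B x T>; pairing with T'
    gives the second. *)
Lemma frenet_bend_rate U G s t : frenet_family U G -> U s t ->
  vnorm (vcross (vD (G s) t) (vD (vD (G s)) t)) = speed (G s) t ^ 2 * bend_rate (G s) t /\
  vdot (vD (frenet_T (G s)) t) (frenet_B (G s) t) = 0.
Proof.
  intros H Hu. assert (Hreg := frenet_family_regular U G H).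
  assert (HB := vcross_B U G s t H Hu). assert (Hk := vnorm_pos _ (proj2 (proj2 H) s t Hu)). set (k := vnorm _) in *.
  destruct (frenet_orthonormal U G s t H Hu) as [HT [_ [HB1 [_ [HTB _]]]]].
  assert (Hv := speed_pos U G s t Hreg Hu).
  rewrite (vD2_speed_T U G s t Hreg Hu), (vD_speed_T U G s t Hreg Hu) in HB.
  unfold bend_rate, frenet_N.
  set (v := speed (G s) t) in *. set (v' := Derive _ t) in *.
  set (T := frenet_T (G s) t) in *. set (B := frenet_B (G s) t) in *.
  set (T' := vD (frenet_T (G s)) t) in *. clearbody k v v' T B T'.
  assert (E : forall z, v ^ 2 * vdot (vcross T T') z = k * vdot B z).
  { intros z. transitivity (vdot (vscale k B) z).
    - rewrite <- HB. unfold vdot, vscale, vadd, vcross; cbn; ring.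
    - unfold vdot, vscale; cbn; ring. }
  split.
  - transitivity (k * vdot B B); [rewrite HB1; ring|]. rewrite <- E.
    f_equal. unfold vdot, vcross; cbn; ring.
  - assert (E2 := E T'). replace (vdot (vcross T T') T') with 0 in E2
      by (unfold vdot, vcross; cbn; ring).
    rewrite vdot_comm. nra.
Qed.

Lemma bend_rate_pos U G s t : frenet_family U G -> U s t -> 0 < bend_rate (G s) t.
Proof.
  intros H Hu. destruct (frenet_bend_rate U G s t H Hu) as [E _].
  assert (Hv := speed_pos U G s t (frenet_family_regular U G H) Hu).
  assert (Hk := vnorm_pos _ (proj2 (proj2 H) s t Hu)). rewrite E in Hk.
  assert (0 < speed (G s) t ^ 2) by nra. nra.
Qed.

Lemma curvature_bend_rate U G s t : frenet_family U G -> U s t ->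
  curvature (G s) t = bend_rate (G s) t / speed (G s) t.
Proof.
  intros H Hu. unfold curvature. destruct (frenet_bend_rate U G s t H Hu) as [-> _].
  assert (Hv := speed_pos U G s t (frenet_family_regular U G H) Hu). field. lra.
Qed.

Lemma frenet_Dt U G s t : frenet_family U G -> U s t ->
  vdot (vD (frenet_T (G s)) t) (frenet_T (G s) t) = 0 /\
  vdot (vD (frenet_T (G s)) t) (frenet_N (G s) t) = bend_rate (G s) t /\
  vdot (vD (frenet_T (G s)) t) (frenet_B (G s) t) = 0 /\
  vdot (vD (frenet_N (G s)) t) (frenet_T (G s) t) = - bend_rate (G s) t /\
  vdot (vD (frenet_N (G s)) t) (frenet_N (G s) t) = 0 /\
  vdot (vD (frenet_N (G s)) t) (frenet_B (G s) t) = twist_rate (G s) t /\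
  vdot (vD (frenet_B (G s)) t) (frenet_T (G s) t) = 0 /\
  vdot (vD (frenet_B (G s)) t) (frenet_N (G s) t) = - twist_rate (G s) t /\
  vdot (vD (frenet_B (G s)) t) (frenet_B (G s) t) = 0.
Proof.
  intros H Hu. assert (HU : open2 U) by apply H.
  assert (HT := smoothV_T U G (frenet_family_regular U G H)).
  assert (HN := smoothV_N U G H). assert (HB := smoothV_B U G H).
  assert (O := fun s t => frenet_orthonormal U G s t H).
  destruct (frenet_bend_rate U G s t H Hu) as [_ E0].
  assert (TT := Dt_dot_const U _ _ 1 s t HU HT HT (fun s t h => proj1 (O s t h)) Hu).
  assert (NN := Dt_dot_const U _ _ 1 s t HU HN HN (fun s t h => proj1 (proj2 (O s t h))) Hu).
  assert (BB := Dt_dot_const U _ _ 1 s t HU HB HB (fun s t h => proj1 (proj2 (proj2 (O s t h)))) Hu).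
  assert (TN := Dt_dot_const U _ _ 0 s t HU HT HN (fun s t h => proj1 (proj2 (proj2 (proj2 (O s t h))))) Hu).
  assert (TB := Dt_dot_const U _ _ 0 s t HU HT HB (fun s t h => proj1 (proj2 (proj2 (proj2 (proj2 (O s t h)))))) Hu).
  assert (NB := Dt_dot_const U _ _ 0 s t HU HN HB (fun s t h => proj2 (proj2 (proj2 (proj2 (proj2 (O s t h)))))) Hu).
  cbv beta in *. unfold bend_rate, twist_rate in *.
  repeat split; try reflexivity; lra.
Qed.

(* The components along T, N, B of the infinitesimal rotation of the frame. *)
Definition spin1 (G : R -> R -> R3) (s t : R) : R :=
  vdot (vD (fun r => frenet_N (G r) t) s) (frenet_B (G s) t).
Definition spin2 (G : R -> R -> R3) (s t : R) : R :=
  vdot (vD (fun r => frenet_B (G r) t) s) (frenet_T (G s) t).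
Definition spin3 (G : R -> R -> R3) (s t : R) : R :=
  vdot (vD (fun r => frenet_T (G r) t) s) (frenet_N (G s) t).

Lemma frenet_Ds U G s t : frenet_family U G -> U s t ->
  vdot (vD (fun r => frenet_T (G r) t) s) (frenet_T (G s) t) = 0 /\
  vdot (vD (fun r => frenet_T (G r) t) s) (frenet_N (G s) t) = spin3 G s t /\
  vdot (vD (fun r => frenet_T (G r) t) s) (frenet_B (G s) t) = - spin2 G s t /\
  vdot (vD (fun r => frenet_N (G r) t) s) (frenet_T (G s) t) = - spin3 G s t /\
  vdot (vD (fun r => frenet_N (G r) t) s) (frenet_N (G s) t) = 0 /\
  vdot (vD (fun r => frenet_N (G r) t) s) (frenet_B (G s) t) = spin1 G s t /\
  vdot (vD (fun r => frenet_B (G r) t) s) (frenet_T (G s) t) = spin2 G s t /\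
  vdot (vD (fun r => frenet_B (G r) t) s) (frenet_N (G s) t) = - spin1 G s t /\
  vdot (vD (fun r => frenet_B (G r) t) s) (frenet_B (G s) t) = 0.
Proof.
  intros H Hu. assert (HU : open2 U) by apply H.
  assert (HT := smoothV_T U G (frenet_family_regular U G H)).
  assert (HN := smoothV_N U G H). assert (HB := smoothV_B U G H).
  assert (O := fun s t => frenet_orthonormal U G s t H).
  assert (TT := Ds_dot_const U _ _ 1 s t HU HT HT (fun s t h => proj1 (O s t h)) Hu).
  assert (NN := Ds_dot_const U _ _ 1 s t HU HN HN (fun s t h => proj1 (proj2 (O s t h))) Hu).
  assert (BB := Ds_dot_const U _ _ 1 s t HU HB HB (fun s t h => proj1 (proj2 (proj2 (O s t h)))) Hu).
  assert (TN := Ds_dot_const U _ _ 0 s t HU HT HN (fun s t h => proj1 (proj2 (proj2 (proj2 (O s t h))))) Hu).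
  assert (TB := Ds_dot_const U _ _ 0 s t HU HT HB (fun s t h => proj1 (proj2 (proj2 (proj2 (proj2 (O s t h)))))) Hu).
  assert (NB := Ds_dot_const U _ _ 0 s t HU HN HB (fun s t h => proj2 (proj2 (proj2 (proj2 (proj2 (O s t h)))))) Hu).
  cbv beta in *. unfold spin1, spin2, spin3 in *.
  repeat split; try reflexivity; lra.
Qed.

Lemma frenet_parseval U G s t x y : frenet_family U G -> U s t ->
  vdot x y = vdot x (frenet_T (G s) t) * vdot y (frenet_T (G s) t)
           + vdot x (frenet_N (G s) t) * vdot y (frenet_N (G s) t)
           + vdot x (frenet_B (G s) t) * vdot y (frenet_B (G s) t).
Proof.
  intros H Hu. destruct (frenet_orthonormal U G s t H Hu) as [HT [_ [HB [_ [HTB _]]]]].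
  rewrite (vdot_frame1 _ _ x y HT HB HTB). unfold frenet_N. ring.
Qed.

(** The determinant in the torsion is |gamma' x gamma''| <gamma''', B>. As <gamma'', B> = 0, one
    derivative moves onto B and <gamma''', B> = - <B', gamma''> = v q p, with q and p the bend and
    twist rates. Thus the torsion is p / v, while the curvature is q / v. *)
Lemma mod_torsion_rates U G s t : frenet_family U G -> U s t ->
  mod_torsion (G s) t = twist_rate (G s) t / bend_rate (G s) t.
Proof.
  intros H Hu. assert (Hreg := frenet_family_regular U G H).
  assert (HU : open2 U) by apply H. assert (HG : smoothV U G) by apply H.
  unfold mod_torsion. rewrite (curvature_bend_rate U G s t H Hu). unfold torsion, vdet.
  assert (Hv := speed_pos U G s t Hreg Hu). assert (Hq := bend_rate_pos U G s t H Hu).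
  destruct (frenet_bend_rate U G s t H Hu) as [Ek _].
  destruct (frenet_Dt U G s t H Hu) as [D1 [D2 [D3 [_ [_ [_ [D7 [D8 _]]]]]]]].
  destruct (frenet_orthonormal U G s t H Hu) as [O1 [O2 [O3 [O4 [O5 O6]]]]].
  assert (HG2 := smoothV_Dt U _ (smoothV_Dt U _ HG)). cbv beta in HG2.
  assert (HB := smoothV_B U G H).
  assert (E : vdot (vD (vD (vD (G s))) t) (frenet_B (G s) t) =
              - vdot (vD (frenet_B (G s)) t) (vD (vD (G s)) t)).
  { apply (Dt_dot_const U (fun s => vD (vD (G s))) _ 0 s t HU HG2 HB); [|exact Hu].
    intros u w Huw. rewrite (vD2_speed_T U G u w Hreg Huw).
    destruct (frenet_Dt U G u w H Huw) as [_ [_ [F _]]].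
    destruct (frenet_orthonormal U G u w H Huw) as [_ [_ [_ [_ [F' _]]]]].
    transitivity (Derive (speed (G u)) w * vdot (frenet_T (G u) w) (frenet_B (G u) w)
      + speed (G u) w * vdot (vD (frenet_T (G u)) w) (frenet_B (G u) w));
      [unfold vdot, vadd, vscale; cbn; ring | rewrite F, F'; ring]. }
  assert (E2 : vdot (vD (frenet_B (G s)) t) (vD (vD (G s)) t)
               = - speed (G s) t * bend_rate (G s) t * twist_rate (G s) t).
  { rewrite (vD2_speed_T U G s t Hreg Hu).
    transitivity (Derive (speed (G s)) t * vdot (vD (frenet_B (G s)) t) (frenet_T (G s) t)
      + speed (G s) t * vdot (vD (frenet_B (G s)) t) (vD (frenet_T (G s)) t));
      [unfold vdot, vadd, vscale; cbn; ring |].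
    rewrite (frenet_parseval U G s t _ (vD (frenet_T (G s)) t) H Hu).
    rewrite D1, D2, D3, D7, D8. ring. }
  rewrite (vcross_B U G s t H Hu).
  replace (vdot (vscale (vnorm (vcross (vD (G s) t) (vD (vD (G s)) t))) (frenet_B (G s) t))
             (vD (vD (vD (G s))) t))
    with (vnorm (vcross (vD (G s) t) (vD (vD (G s)) t)) *
          vdot (vD (vD (vD (G s))) t) (frenet_B (G s) t))
    by (unfold vdot, vscale; cbn; ring).
  rewrite <- (vcross_B U G s t H Hu), E, E2, Ek. field. split; lra.
Qed.

(* Zero curvature: the mixed partial derivatives of the frame commute. *)
Lemma frenet_compat U G s t : frenet_family U G -> U s t ->
  Derive (fun r => bend_rate (G r) t) s = Derive (spin3 G s) t + twist_rate (G s) t * spin2 G s t /\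
  Derive (fun r => twist_rate (G r) t) s = Derive (spin1 G s) t - bend_rate (G s) t * spin2 G s t /\
  Derive (spin2 G s) t = twist_rate (G s) t * spin3 G s t - bend_rate (G s) t * spin1 G s t.
Proof.
  intros H Hu. assert (HU : open2 U) by apply H.
  assert (HT := smoothV_T U G (frenet_family_regular U G H)).
  assert (HN := smoothV_N U G H). assert (HB := smoothV_B U G H).
  assert (HTt := smoothV_Dt U _ HT). assert (HNt := smoothV_Dt U _ HN).
  assert (HBt := smoothV_Dt U _ HB).
  assert (HTs := smoothV_Ds U _ HT). assert (HNs := smoothV_Ds U _ HN).
  assert (HBs := smoothV_Ds U _ HB). cbv beta in *.
  destruct (frenet_Dt U G s t H Hu) as [D1 [D2 [D3 [D4 [D5 [D6 [D7 [D8 D9]]]]]]]].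
  destruct (frenet_Ds U G s t H Hu) as [S1 [S2 [S3 [S4 [S5 [S6 [S7 [S8 S9]]]]]]]].
  assert (P := fun x y => frenet_parseval U G s t x y H Hu).
  (* In the direction of [t] the frame does not rotate about N: <B_t, T> = 0 throughout.
     Differentiating this in [s] produces the equation for [spin2], the one compatibility equation
     that contains no variation of a rate. *)
  assert (E2 : vdot (vD (fun r => vD (frenet_B (G r)) t) s) (frenet_T (G s) t)
    = twist_rate (G s) t * spin3 G s t).
  { transitivity (- vdot (vD (fun r => frenet_T (G r) t) s) (vD (frenet_B (G s)) t)).
    - apply (Ds_dot_const U (fun s => vD (frenet_B (G s))) _ 0 s t HU HBt HT); [|exact Hu].
      intros u w Huw. apply (frenet_Dt U G u w H Huw).
    - rewrite P, D7, D8, D9, S2. ring. }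
  rewrite (vD_Schwarz U (fun s => frenet_B (G s)) s t HU HB Hu) in E2.
  assert (F1 := Derive_dot (fun r => vD (frenet_T (G r)) t) (fun r => frenet_N (G r) t) s
    (smoothV_ex_s U _ s t HTt Hu) (smoothV_ex_s U _ s t HN Hu)).
  assert (F2 := Derive_dot (fun r => vD (frenet_N (G r)) t) (fun r => frenet_B (G r) t) s
    (smoothV_ex_s U _ s t HNt Hu) (smoothV_ex_s U _ s t HB Hu)).
  assert (F3 := Derive_dot (fun z => vD (fun r => frenet_T (G r) z) s) (frenet_N (G s)) t
    (smoothV_ex_t U _ s t HTs Hu) (smoothV_ex_t U _ s t HN Hu)).
  assert (F4 := Derive_dot (fun z => vD (fun r => frenet_N (G r) z) s) (frenet_B (G s)) t
    (smoothV_ex_t U _ s t HNs Hu) (smoothV_ex_t U _ s t HB Hu)).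
  assert (F5 := Derive_dot (fun z => vD (fun r => frenet_B (G r) z) s) (frenet_T (G s)) t
    (smoothV_ex_t U _ s t HBs Hu) (smoothV_ex_t U _ s t HT Hu)).
  cbv beta in F1, F2, F3, F4, F5.
  rewrite (vD_Schwarz U (fun s => frenet_T (G s)) s t HU HT Hu) in F1.
  rewrite (vD_Schwarz U (fun s => frenet_N (G s)) s t HU HN Hu) in F2.
  rewrite (P (vD (frenet_T (G s)) t)) in F1.
  rewrite (P (vD (fun r => frenet_T (G r) t) s)) in F3.
  rewrite (P (vD (frenet_N (G s)) t)) in F2.
  rewrite (P (vD (fun r => frenet_N (G r) t) s) (vD (frenet_B (G s)) t)) in F4.
  rewrite (P (vD (fun r => frenet_B (G r) t) s) (vD (frenet_T (G s)) t)), E2 in F5.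
  rewrite D1, D2, D3, S5 in F1. rewrite D4, D5, D6, S7, S8, S9 in F2.
  rewrite S1, S2, S3, D5, D6 in F3. rewrite S4, S5, S6, D7, D8, D9 in F4.
  rewrite S7, S8, S9, D1, D2, D3 in F5.
  split; [|split]; (etransitivity; [eassumption|]).
  - replace (Derive (spin3 G s) t) with
      (vdot (vD (fun z => vD (fun r => frenet_T (G r) z) s) t) (frenet_N (G s) t)
       + - spin2 G s t * twist_rate (G s) t); [ring|].
    symmetry. etransitivity; [exact F3|]. ring.
  - replace (Derive (spin1 G s) t) with
      (vdot (vD (fun z => vD (fun r => frenet_N (G r) z) s) t) (frenet_B (G s) t)); [ring|].
    symmetry. etransitivity; [exact F4|]. ring.
  - ring.
Qed.

(** * First variation of the Sadowsky functional *)

Lemma smooth2_curvature U G : frenet_family U G -> smooth2 U (fun s t => curvature (G s) t).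
Proof.
  intros H. assert (HU : open2 U) by apply H. assert (Hreg := frenet_family_regular U G H).
  apply smooth2_ext with (fun s t => bend_rate (G s) t / speed (G s) t); [exact HU| |].
  - intros s t Hu. symmetry. apply (curvature_bend_rate U); assumption.
  - apply smooth2_div; [exact HU|apply smooth2_bend_rate, H|apply smooth2_speed, Hreg|].
    intros s t Hu. apply Rgt_not_eq, (speed_pos U); assumption.
Qed.

Lemma smooth2_mod_torsion U G : frenet_family U G -> smooth2 U (fun s t => mod_torsion (G s) t).
Proof.
  intros H. assert (HU : open2 U) by apply H.
  apply smooth2_ext with (fun s t => twist_rate (G s) t / bend_rate (G s) t); [exact HU| |].
  - intros s t Hu. symmetry. apply (mod_torsion_rates U); assumption.
  - apply smooth2_div; [exact HU|apply smooth2_twist_rate, H|apply smooth2_bend_rate, H|].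
    intros s t Hu. apply Rgt_not_eq, (bend_rate_pos U); assumption.
Qed.

Ltac smooth2_tac HU :=
  repeat first
    [ eassumption
    | apply smooth2_const; exact HU
    | apply smooth2_minus; [exact HU| |]
    | apply smooth2_plus; [exact HU| |]
    | apply smooth2_opp; [exact HU|]
    | apply smooth2_mult; [exact HU| |]
    | apply smooth2_pow; [exact HU|] ].

Lemma smooth2_s1 U G : frenet_family U G -> smooth2 U (fun s => s1 (G s)).
Proof.
  intros H. assert (HU : open2 U) by apply H.
  assert (Hk := smooth2_curvature U G H). assert (Hl := smooth2_mod_torsion U G H).
  unfold s1. smooth2_tac HU.
Qed.

Lemma smooth2_s3 U G : frenet_family U G -> smooth2 U (fun s => s3 (G s)).
Proof.
  intros H. assert (HU : open2 U) by apply H.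
  assert (Hk := smooth2_curvature U G H). assert (Hl := smooth2_mod_torsion U G H).
  unfold s3. smooth2_tac HU.
Qed.

Lemma smooth2_s2 U G : frenet_family U G -> smooth2 U (fun s => s2 (G s)).
Proof.
  intros H. assert (HU : open2 U) by apply H. assert (Hreg := frenet_family_regular U G H).
  unfold s2. apply smooth2_div; [exact HU| | |].
  - exact (smooth2_Dt U _ (smooth2_s1 U G H)).
  - apply smooth2_mult; [exact HU|apply smooth2_speed, Hreg|apply smooth2_curvature, H].
  - intros s t Hu. rewrite (curvature_bend_rate U) by assumption.
    assert (Hv := speed_pos U G s t Hreg Hu). assert (Hq := bend_rate_pos U G s t H Hu).
    replace (speed (G s) t * (bend_rate (G s) t / speed (G s) t)) with (bend_rate (G s) t) by (field; lra). lra.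
Qed.

(* The force vector b_0. *)
Definition strip_force (mu : R) (c : R -> R3) (t : R) : R3 :=
  vadd (vadd
    (vscale ((curvature c t ^ 2 * (1 + mod_torsion c t ^ 2) ^ 2 + mu) * / 2) (frenet_T c t))
    (vscale ((Derive (s3 c) t + twist_rate c t * s2 c t) * / speed c t) (frenet_N c t)))
    (vscale (- (bend_rate c t * s1 c t + Derive (s2 c) t - twist_rate c t * s3 c t) * / speed c t) (frenet_B c t)).

Lemma smoothV_strip_force mu U G : frenet_family U G ->
  smoothV U (fun s => strip_force mu (G s)).
Proof.
  intros H. assert (HU : open2 U) by apply H. assert (Hreg := frenet_family_regular U G H).
  assert (Hk := smooth2_curvature U G H). assert (Hl := smooth2_mod_torsion U G H).
  assert (H1 := smooth2_s1 U G H). assert (H2 := smooth2_s2 U G H). assert (H3 := smooth2_s3 U G H).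
  assert (D2 := smooth2_Dt U _ H2). assert (D3 := smooth2_Dt U _ H3). cbv beta in D2, D3.
  assert (Hp := smooth2_twist_rate U G H). assert (Hq := smooth2_bend_rate U G H).
  assert (Hv : smooth2 U (fun s t => / speed (G s) t)).
  { apply smooth2_inv; [exact HU|apply smooth2_speed, Hreg|].
    intros s t Hu. apply Rgt_not_eq, (speed_pos U); assumption. }
  unfold strip_force. apply smoothV_add; [exact HU|apply smoothV_add; [exact HU| |]|];
    (apply smoothV_scale; [exact HU| |]).
  - smooth2_tac HU.
  - apply smoothV_T, Hreg.
  - smooth2_tac HU.
  - apply smoothV_N, H.
  - smooth2_tac HU.
  - apply smoothV_B, H.
Qed.

Definition sadowsky_density (mu : R) (c : R -> R3) (t : R) : R :=
  (curvature c t ^ 2 * (1 + mod_torsion c t ^ 2) ^ 2 - mu) * speed c t.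

Lemma smooth2_sadowsky_density mu U G : frenet_family U G ->
  smooth2 U (fun s => sadowsky_density mu (G s)).
Proof.
  intros H. assert (HU : open2 U) by apply H.
  assert (Hk := smooth2_curvature U G H). assert (Hl := smooth2_mod_torsion U G H).
  assert (Hv := smooth2_speed U G (frenet_family_regular U G H)).
  unfold sadowsky_density. smooth2_tac HU.
Qed.

Definition strip_torque_spin (G : R -> R -> R3) (s t : R) : R :=
  s1 (G s) t * spin1 G s t + s2 (G s) t * spin2 G s t + s3 (G s) t * spin3 G s t.

Definition strip_flux (mu : R) (G : R -> R -> R3) (s t : R) : R :=
  2 * strip_torque_spin G s t
  - 2 * vdot (strip_force mu (G s) t) (vD (fun r => G r t) s).

Lemma smooth2_spins U G : frenet_family U G ->
  smooth2 U (spin1 G) /\ smooth2 U (spin2 G) /\ smooth2 U (spin3 G).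
Proof.
  intros H. assert (HU : open2 U) by apply H.
  assert (HT := smoothV_T U G (frenet_family_regular U G H)).
  assert (HN := smoothV_N U G H). assert (HB := smoothV_B U G H).
  split; [|split]; (apply smooth2_dot; [exact HU| |assumption]).
  - exact (smoothV_Ds U _ HN).
  - exact (smoothV_Ds U _ HB).
  - exact (smoothV_Ds U _ HT).
Qed.

Lemma smooth2_strip_flux mu U G : frenet_family U G -> smooth2 U (strip_flux mu G).
Proof.
  intros H. assert (HU : open2 U) by apply H.
  destruct (smooth2_spins U G H) as [Y1 [Y2 Y3]].
  assert (H1 := smooth2_s1 U G H). assert (H2 := smooth2_s2 U G H). assert (H3 := smooth2_s3 U G H).
  assert (HF := smooth2_dot U _ _ HU (smoothV_strip_force mu U G H)
                  (smoothV_Ds U _ (proj1 (proj2 H)))). cbv beta in HF.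
  unfold strip_flux, strip_torque_spin. smooth2_tac HU.
Qed.

(** In the rates q, p and the speed v the density is (q^2 + p^2)^2 / (q^2 v) - mu v. Twice [s3] and
    twice [s1] are its partial derivatives in q and in p, which explains the formulas for these
    torque components. *)
Lemma sadowsky_density_Ds mu U G s t : frenet_family U G -> U s t ->
  Derive (fun r => sadowsky_density mu (G r) t) s =
  2 * s3 (G s) t * Derive (fun r => bend_rate (G r) t) s
  + 2 * s1 (G s) t * Derive (fun r => twist_rate (G r) t) s
  - (curvature (G s) t ^ 2 * (1 + mod_torsion (G s) t ^ 2) ^ 2 + mu)
    * Derive (fun r => speed (G r) t) s.
Proof.
  intros H Hu. assert (HU : open2 U) by apply H. assert (Hreg := frenet_family_regular U G H).
  rewrite (Ds_ext U (fun s => sadowsky_density mu (G s)) (fun s t =>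
    (bend_rate (G s) t ^ 2 + twist_rate (G s) t ^ 2) ^ 2 / (bend_rate (G s) t ^ 2 * speed (G s) t)
    - mu * speed (G s) t) s t HU); [| |exact Hu].
  2:{ intros u w Huw. unfold sadowsky_density.
      assert (Hv := speed_pos U G u w Hreg Huw). assert (Hq := bend_rate_pos U G u w H Huw).
      rewrite (curvature_bend_rate U), (mod_torsion_rates U) by assumption. field. lra. }
  unfold s3, s1. rewrite (curvature_bend_rate U), (mod_torsion_rates U) by assumption.
  assert (Hv := speed_pos U G s t Hreg Hu). assert (Hq := bend_rate_pos U G s t H Hu).
  assert (Eq : ex_derive (fun r => bend_rate (G r) t) s)
    by exact (smooth2_ex_derive_s U _ s t (smooth2_bend_rate U G H) Hu).
  assert (Ep : ex_derive (fun r => twist_rate (G r) t) s)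
    by exact (smooth2_ex_derive_s U _ s t (smooth2_twist_rate U G H) Hu).
  assert (Ev : ex_derive (fun r => speed (G r) t) s)
    by exact (smooth2_ex_derive_s U _ s t (smooth2_speed U G Hreg) Hu).
  set (q := fun r => bend_rate (G r) t) in *. set (p := fun r => twist_rate (G r) t) in *.
  set (v := fun r => speed (G r) t) in *.
  change (bend_rate (G s) t) with (q s) in *. change (twist_rate (G s) t) with (p s) in *.
  change (speed (G s) t) with (v s) in *.
  change (Derive (fun r => (q r ^ 2 + p r ^ 2) ^ 2 / (q r ^ 2 * v r) - mu * v r) s = 
    2 * (q s / v s * (1 + (p s / q s) ^ 2) * (1 - (p s / q s) ^ 2)) * Derive q s +
    2 * (2 * (q s / v s) * (p s / q s) * (1 + (p s / q s) ^ 2)) * Derive p s -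
    ((q s / v s) ^ 2 * (1 + (p s / q s) ^ 2) ^ 2 + mu) * Derive v s).
  change (ex_derive q s) in Eq. change (ex_derive p s) in Ep. change (ex_derive v s) in Ev.
  clearbody q p v. apply is_derive_unique.
  auto_derive.
  - repeat split; try assumption. apply Rgt_not_eq. assert (0 < q s ^ 2) by nra. nra.
  - change (fun x => q x) with q. change (fun x => p x) with p. change (fun x => v x) with v.
    field. lra.
Qed.

Lemma strip_force_dot mu U G s t : frenet_family U G -> U s t ->
  vdot (strip_force mu (G s) t) (frenet_T (G s) t) =
    (curvature (G s) t ^ 2 * (1 + mod_torsion (G s) t ^ 2) ^ 2 + mu) / 2 /\
  vdot (strip_force mu (G s) t) (frenet_N (G s) t) =
    (Derive (s3 (G s)) t + twist_rate (G s) t * s2 (G s) t) / speed (G s) t /\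
  vdot (strip_force mu (G s) t) (frenet_B (G s) t) =
    - (bend_rate (G s) t * s1 (G s) t + Derive (s2 (G s)) t - twist_rate (G s) t * s3 (G s) t) / speed (G s) t.
Proof.
  intros H Hu.
  destruct (frenet_orthonormal U G s t H Hu) as [O1 [O2 [O3 [O4 [O5 O6]]]]].
  assert (L : forall a x b y c z w, vdot (vadd (vadd (vscale a x) (vscale b y)) (vscale c z)) w
    = a * vdot x w + b * vdot y w + c * vdot z w)
    by (intros; unfold vdot, vadd, vscale; cbn; ring).
  unfold strip_force. rewrite !L.
  rewrite (vdot_comm (frenet_N (G s) t) (frenet_T (G s) t)),
    (vdot_comm (frenet_B (G s) t) (frenet_T (G s) t)),
    (vdot_comm (frenet_B (G s) t) (frenet_N (G s) t)), O1, O2, O3, O4, O5, O6.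
  unfold Rdiv. repeat split; ring.
Qed.

(* The Euler-Lagrange expressions are the components of the derivative of
   [strip_force]; the rest of the variation is an exact t-derivative. *)
Lemma strip_first_variation mu U G s t : frenet_family U G -> U s t ->
  Derive (fun r => sadowsky_density mu (G r) t) s =
  Derive (strip_flux mu G s) t
  + 2 * vdot (vD (strip_force mu (G s)) t) (vD (fun r => G r t) s).
Proof.
  intros H Hu. assert (HU : open2 U) by apply H. assert (Hreg := frenet_family_regular U G H).
  assert (HG : smoothV U G) by apply H.
  rewrite (sadowsky_density_Ds mu U G s t H Hu).
  destruct (frenet_compat U G s t H Hu) as [-> [-> Cy2]].
  destruct (smooth2_spins U G H) as [Y1 [Y2 Y3]].
  assert (H1 := smooth2_s1 U G H). assert (H2 := smooth2_s2 U G H). assert (H3 := smooth2_s3 U G H).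
  assert (HF := smoothV_strip_force mu U G H). assert (HW := smoothV_Ds U _ HG). cbv beta in HW.
  assert (HFW := smooth2_dot U _ _ HU HF HW). cbv beta in HFW.
  (* Mixed derivatives commute, so the derivative of the variation field W along the curve is the
     [s]-derivative of v T, with frame components v_s, v [spin3] and - v [spin2]. The factor v
     cancels the division by the speed in the N and B components of the force. *)
  assert (EF : Derive (fun z => vdot (strip_force mu (G s) z) (vD (fun r => G r z) s)) t =
    vdot (vD (strip_force mu (G s)) t) (vD (fun r => G r t) s)
    + ((curvature (G s) t ^ 2 * (1 + mod_torsion (G s) t ^ 2) ^ 2 + mu) / 2
         * Derive (fun r => speed (G r) t) s
       + (Derive (s3 (G s)) t + twist_rate (G s) t * s2 (G s) t) * spin3 G s t
       + (bend_rate (G s) t * s1 (G s) t + Derive (s2 (G s)) t - twist_rate (G s) t * s3 (G s) t)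
         * spin2 G s t)).
  { etransitivity.
    { apply (Derive_dot (strip_force mu (G s)) (fun z => vD (fun r => G r z) s)).
      - exact (smoothV_ex_t U _ s t HF Hu).
      - exact (smoothV_ex_t U _ s t HW Hu). }
    f_equal. rewrite <- (vD_Schwarz U G s t HU HG Hu).
    assert (E : vD (fun r => vD (G r) t) s =
      vadd (vscale (Derive (fun r => speed (G r) t) s) (frenet_T (G s) t))
           (vscale (speed (G s) t) (vD (fun r => frenet_T (G r) t) s))).
    { transitivity (vD (fun r => vscale (speed (G r) t) (frenet_T (G r) t)) s).
      - apply vD_ext_loc.
        apply (open2_slice_s U (fun s t => vD (G s) t = vscale (speed (G s) t) (frenet_T (G s) t)));
          [exact HU| |exact Hu]. intros u w. apply vD_speed_T, Hreg.
      - apply (vD_scale (fun r => speed (G r) t) (fun r => frenet_T (G r) t)).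
        + exact (smooth2_ex_derive_s U _ s t (smooth2_speed U G Hreg) Hu).
        + exact (smoothV_ex_s U _ s t (smoothV_T U G Hreg) Hu). }
    rewrite E. clear E.
    destruct (frenet_orthonormal U G s t H Hu) as [O1 [_ [_ [O4 [O5 _]]]]].
    destruct (frenet_Ds U G s t H Hu) as [S1 [S2 [S3 _]]].
    assert (Hv := speed_pos U G s t Hreg Hu).
    rewrite (frenet_parseval U G s t _ (vadd _ _) H Hu).
    assert (L : forall a b x y z, vdot (vadd (vscale a x) (vscale b y)) z = a * vdot x z + b * vdot y z)
      by (intros; unfold vdot, vadd, vscale; cbn; ring).
    destruct (strip_force_dot mu U G s t H Hu) as [FT [FN FB]].
    rewrite FT, FN, FB, !L, S1, S2, S3, O1, O4, O5. field. lra. }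
  (* W_t does not involve [spin1], so no choice of force can absorb the [spin1] terms of the flux;
     they have to cancel by themselves. This dictates [s2], with s1' = q s2. *)
  assert (E1 : Derive (s1 (G s)) t = bend_rate (G s) t * s2 (G s) t).
  { unfold s2. rewrite (curvature_bend_rate U) by assumption.
    assert (Hv := speed_pos U G s t Hreg Hu). assert (Hq := bend_rate_pos U G s t H Hu). field. lra. }
  assert (EX : Derive (strip_flux mu G s) t =
    2 * (Derive (s1 (G s)) t * spin1 G s t + s1 (G s) t * Derive (spin1 G s) t
       + Derive (s2 (G s)) t * spin2 G s t + s2 (G s) t * Derive (spin2 G s) t
       + Derive (s3 (G s)) t * spin3 G s t + s3 (G s) t * Derive (spin3 G s) t)
    - 2 * Derive (fun z => vdot (strip_force mu (G s) z) (vD (fun r => G r z) s)) t).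
  { assert (X1' : ex_derive (s1 (G s)) t) by exact (smooth2_ex_derive_t U _ s t H1 Hu).
    assert (X2' : ex_derive (s2 (G s)) t) by exact (smooth2_ex_derive_t U _ s t H2 Hu).
    assert (X3' : ex_derive (s3 (G s)) t) by exact (smooth2_ex_derive_t U _ s t H3 Hu).
    assert (X4 : ex_derive (fun z => vdot (strip_force mu (G s) z) (vD (fun r => G r z) s)) t) by exact (smooth2_ex_derive_t U _ s t HFW Hu).
    assert (X5 : ex_derive (spin1 G s) t) by exact (smooth2_ex_derive_t U _ s t Y1 Hu).
    assert (X6 : ex_derive (spin2 G s) t) by exact (smooth2_ex_derive_t U _ s t Y2 Hu).
    assert (X7 : ex_derive (spin3 G s) t) by exact (smooth2_ex_derive_t U _ s t Y3 Hu).
    unfold strip_flux, strip_torque_spin.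
    set (w := fun z => vdot (strip_force mu (G s) z) (vD (fun r => G r z) s)) in *.
    set (f1 := s1 (G s)) in *. set (f2 := s2 (G s)) in *. set (f3 := s3 (G s)) in *.
    set (y1 := spin1 G s) in *. set (y2 := spin2 G s) in *. set (y3 := spin3 G s) in *.
    change (Derive (fun z => 2 * (f1 z * y1 z + f2 z * y2 z + f3 z * y3 z) - 2 * w z) t =
     2 * (Derive f1 t * y1 t + f1 t * Derive y1 t + Derive f2 t * y2 t + f2 t * Derive y2 t +
       Derive f3 t * y3 t + f3 t * Derive y3 t) - 2 * Derive w t).
    change (ex_derive w t) in X4.
    clearbody w f1 f2 f3 y1 y2 y3. apply is_derive_unique. auto_derive; [tauto|].
    change (fun x => f1 x) with f1. change (fun x => f2 x) with f2. change (fun x => f3 x) with f3.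
    change (fun x => y1 x) with y1. change (fun x => y2 x) with y2. change (fun x => y3 x) with y3.
    change (fun x => w x) with w. ring. }
  rewrite EX, EF, E1, Cy2. field.
Qed.

(** * Differentiation under the integral sign *)

Lemma smooth2_continuous_t U f s t : smooth2 U f -> U s t -> continuous (f s) t.
Proof.
  intros Hf Hu. apply (@ex_derive_continuous R_AbsRing R_NormedModule).
  exact (smooth2_ex_derive_t U f s t Hf Hu).
Qed.

Lemma is_derive_RInt_smooth2 U f L : 0 < L -> open2 U ->
  (forall t, 0 <= t <= L -> U 0 t) -> smooth2 U f ->
  is_derive (fun s => RInt (f s) 0 L) 0 (RInt (fun t => Derive (fun r => f r t) 0) 0 L).
Proof.
  intros HL HU HI Hf. destruct (tube U 0 0 L HU HI) as [d [Hd Ht]].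
  apply (is_derive_RInt_param f 0 L 0); rewrite ?Rmin_left, ?Rmax_right by lra.
  - exists (mkposreal d Hd). intros s Hs t Htt.
    apply (smooth2_ex_derive_s U f s t Hf). apply Ht; [exact Hs|lra|lra].
  - intros t Htt. exact (smooth2_cont U _ 0 t (smooth2_Ds U f Hf) (HI t Htt)).
  - exists (mkposreal d Hd). intros s Hs.
    apply (ex_RInt_continuous (V := R_CompleteNormedModule)).
    rewrite Rmin_left, Rmax_right by lra.
    intros t Htt. apply (smooth2_continuous_t U f s t Hf). apply Ht; [exact Hs|lra|lra].
Qed.

(** The exact part integrates to boundary values. The pointwise identity is required only for 0 < t
    < L: for spherical families it cannot be derived at the ends, where no neighbourhood satisfies
    the constraint. *)
Lemma is_derive_RInt_flux U f h e L : 0 < L -> open2 U ->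
  (forall t, 0 <= t <= L -> U 0 t) -> smooth2 U f -> smooth2 U h ->
  smooth2 U e ->
  (forall t, 0 < t < L -> Derive (fun r => f r t) 0 = Derive (h 0) t + e 0 t) ->
  is_derive (fun s => RInt (f s) 0 L) 0 (h 0 L - h 0 0 + RInt (e 0) 0 L).
Proof.
  intros HL HU HI Hf Hh He E.
  replace (h 0 L - h 0 0 + RInt (e 0) 0 L) with (RInt (fun t => Derive (fun r => f r t) 0) 0 L);
    [exact (is_derive_RInt_smooth2 U f L HL HU HI Hf)|].
  assert (Hc : forall k, smooth2 U k -> ex_RInt (k 0) 0 L).
  { intros k Hk. apply (ex_RInt_continuous (V := R_CompleteNormedModule)).
    rewrite Rmin_left, Rmax_right by lra.
    intros t Ht. exact (smooth2_continuous_t U k 0 t Hk (HI t Ht)). }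
  assert (Hh' : RInt (Derive (h 0)) 0 L = h 0 L - h 0 0).
  { apply RInt_Derive; rewrite Rmin_left, Rmax_right by lra.
    - intros t Ht. exact (smooth2_ex_derive_t U h 0 t Hh (HI t Ht)).
    - intros t Ht. exact (smooth2_continuous_t U _ 0 t (smooth2_Dt U h Hh) (HI t Ht)). }
  rewrite <- Hh'.
  transitivity (RInt (fun t => Derive (h 0) t + e 0 t) 0 L).
  - apply RInt_ext. rewrite Rmin_left, Rmax_right by lra. exact E.
  - apply (RInt_plus (V := R_CompleteNormedModule) (Derive (h 0)) (e 0));
      [exact (Hc _ (smooth2_Dt U h Hh)) | exact (Hc e He)].
Qed.

Lemma vdot_vzero_r u : vdot u vzero = 0.
Proof. unfold vdot, vzero; cbn; ring. Qed.

(** Where W vanishes the force part of the flux disappears; what remains at the ends is the torque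
    paired with the rotation of the frame, which is [strip_boundary]. *)
Lemma sadowsky_variation mu L U G : 0 < L -> frenet_family U G ->
  (forall t, 0 <= t <= L -> U 0 t) ->
  vD (fun r => G r 0) 0 = vzero -> vD (fun r => G r L) 0 = vzero ->
  is_derive (fun s => sadowsky mu L (G s)) 0
    (2 * (strip_boundary (G 0) G L - strip_boundary (G 0) G 0) +
     RInt (fun t => 2 * vdot (vD (strip_force mu (G 0)) t) (vD (fun r => G r t) 0)) 0 L).
Proof.
  intros HL H HI W0 WL. assert (HU : open2 U) by apply H.
  replace (2 * (strip_boundary (G 0) G L - strip_boundary (G 0) G 0))
    with (strip_flux mu G 0 L - strip_flux mu G 0 0).
  2:{ unfold strip_flux. rewrite W0, WL, !vdot_vzero_r.
      unfold strip_torque_spin, strip_boundary, spin1, spin2, spin3. ring. }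
  apply (is_derive_RInt_flux U (fun s => sadowsky_density mu (G s)) (strip_flux mu G)
    (fun s t => 2 * vdot (vD (strip_force mu (G s)) t) (vD (fun r => G r t) s)) L HL HU HI).
  - apply smooth2_sadowsky_density, H.
  - apply smooth2_strip_flux, H.
  - apply smooth2_mult; [exact HU|apply smooth2_const, HU|].
    apply smooth2_dot; [exact HU| |apply smoothV_Ds, H].
    exact (smoothV_Dt U _ (smoothV_strip_force mu U G H)).
  - intros t Ht. apply strip_first_variation with U; [exact H|]. apply HI; lra.
Qed.

(** * First variation of the spherical elastic energy *)

Definition sphere_n (c : R -> R3) (t : R) : R3 := vcross (c t) (frenet_T c t).
Definition geod_rate (c : R -> R3) (t : R) : R := vdot (vD (frenet_T c) t) (sphere_n c t).

(** The domain [V] may be smaller than the domain of smoothness: a proper spherical variation lies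
    on the sphere only for t in [0, L], but is smooth beyond. *)
Definition sphere_family (V : R -> R -> Prop) (G : R -> R -> R3) : Prop :=
  regular_family V G /\ forall s t, V s t -> vdot (G s t) (G s t) = 1.

(* The s-derivative of the frame (G, T, n): G_s = drift T + lift n and
   T_s = turn n - drift G. *)
Definition drift (G : R -> R -> R3) (s t : R) : R :=
  vdot (vD (fun r => G r t) s) (frenet_T (G s) t).
Definition lift (G : R -> R -> R3) (s t : R) : R :=
  vdot (vD (fun r => G r t) s) (sphere_n (G s) t).
Definition turn (G : R -> R -> R3) (s t : R) : R :=
  vdot (vD (fun r => frenet_T (G r) t) s) (sphere_n (G s) t).

Lemma smoothV_sphere_n U G : regular_family U G -> smoothV U (fun s => sphere_n (G s)).
Proof.
  intros H. apply (smoothV_cross U G (fun s => frenet_T (G s)));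
    [apply H|apply H|apply smoothV_T, H].
Qed.

Lemma smooth2_geod U G : regular_family U G -> smooth2 U (fun s => geod_curvature (G s)).
Proof.
  intros H. assert (HU : open2 U) by apply H. assert (HG : smoothV U G) by apply H.
  assert (HD := smoothV_Dt U _ HG). assert (HD2 := smoothV_Dt U _ HD). cbv beta in *.
  unfold geod_curvature. apply smooth2_div; [exact HU| | |].
  - unfold vdet. apply (smooth2_dot U (fun s t => vcross (G s t) (vD (G s) t))
      (fun s => vD (vD (G s))) HU); [apply smoothV_cross; assumption|exact HD2].
  - apply smooth2_pow; [exact HU|apply smooth2_speed, H].
  - intros s t Hu. apply pow_nonzero, Rgt_not_eq, (speed_pos U); assumption.
Qed.

Lemma sphere_orthonormal V G s t : sphere_family V G -> V s t ->
  vdot (frenet_T (G s) t) (frenet_T (G s) t) = 1 /\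
  vdot (G s t) (G s t) = 1 /\
  vdot (sphere_n (G s) t) (sphere_n (G s) t) = 1 /\
  vdot (frenet_T (G s) t) (G s t) = 0 /\
  vdot (frenet_T (G s) t) (sphere_n (G s) t) = 0 /\
  vdot (G s t) (sphere_n (G s) t) = 0.
Proof.
  intros [H HS] Hu. assert (HU : open2 V) by apply H. assert (HG : smoothV V G) by apply H.
  assert (Hv := speed_pos V G s t H Hu).
  assert (Hv2 := vnorm_sqr (vD (G s) t)). fold (speed (G s) t) in Hv2.
  assert (HT : vdot (frenet_T (G s) t) (frenet_T (G s) t) = 1).
  { unfold frenet_T. replace 1 with (vdot (vD (G s) t) (vD (G s) t) / (speed (G s) t * speed (G s) t)).
    - unfold vdot, vscale; cbn. field. lra.
    - rewrite <- Hv2. field. lra. }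
  assert (HTG : vdot (frenet_T (G s) t) (G s t) = 0).
  { assert (E := Dt_dot_const V G G 1 s t HU HG HG HS Hu). cbv beta in E.
    transitivity (/ speed (G s) t * vdot (vD (G s) t) (G s t));
      [unfold frenet_T, vdot, vscale; cbn; ring|].
    replace (vdot (vD (G s) t) (G s t)) with 0 by lra. ring. }
  assert (HGG := HS s t Hu).
  split; [exact HT|]. split; [exact HGG|]. split.
  { unfold sphere_n. replace (vdot _ _) with
      (vdot (frenet_T (G s) t) (frenet_T (G s) t) * vdot (G s t) (G s t)
       - vdot (frenet_T (G s) t) (G s t) ^ 2).
    - rewrite HT, HGG, HTG. ring.
    - unfold vdot, vcross; cbn; ring. }
  split; [exact HTG|]. unfold sphere_n. split; unfold vdot, vcross; cbn; ring.
Qed.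

Lemma sphere_parseval V G s t x y : sphere_family V G -> V s t ->
  vdot x y = vdot x (frenet_T (G s) t) * vdot y (frenet_T (G s) t)
           + vdot x (G s t) * vdot y (G s t)
           + vdot x (sphere_n (G s) t) * vdot y (sphere_n (G s) t).
Proof.
  intros H Hu. destruct (sphere_orthonormal V G s t H Hu) as [HT [HG [_ [HTG _]]]].
  apply vdot_frame1; assumption.
Qed.

Lemma geod_curvature_rate V G s t : sphere_family V G -> V s t ->
  geod_curvature (G s) t = geod_rate (G s) t / speed (G s) t.
Proof.
  intros H Hu. assert (Hreg := proj1 H). assert (Hv := speed_pos V G s t Hreg Hu).
  unfold geod_curvature, vdet.
  rewrite (vD2_speed_T V G s t Hreg Hu), (vD_speed_T V G s t Hreg Hu).
  unfold geod_rate, sphere_n.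
  set (v := speed (G s) t) in *. set (v' := Derive _ t). set (T := frenet_T (G s) t).
  set (T' := vD (frenet_T (G s)) t). set (g := G s t).
  replace (vdot (vcross g (vscale v T)) (vadd (vscale v' T) (vscale v T')))
    with (v ^ 2 * vdot T' (vcross g T)) by (unfold vdot, vcross, vadd, vscale; cbn; ring).
  field. lra.
Qed.

Lemma sphere_Dt V G s t : sphere_family V G -> V s t ->
  vdot (vD (frenet_T (G s)) t) (frenet_T (G s) t) = 0 /\
  vdot (vD (frenet_T (G s)) t) (G s t) = - speed (G s) t /\
  vdot (vD (frenet_T (G s)) t) (sphere_n (G s) t) = geod_rate (G s) t /\
  vdot (vD (sphere_n (G s)) t) (frenet_T (G s) t) = - geod_rate (G s) t /\
  vdot (vD (sphere_n (G s)) t) (G s t) = 0 /\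
  vdot (vD (sphere_n (G s)) t) (sphere_n (G s) t) = 0.
Proof.
  intros H Hu. assert (Hreg := proj1 H). assert (HU : open2 V) by apply Hreg.
  assert (HG : smoothV V G) by apply Hreg.
  assert (HT := smoothV_T V G Hreg). assert (HN := smoothV_sphere_n V G Hreg).
  assert (O := fun s t => sphere_orthonormal V G s t H).
  assert (TT := Dt_dot_const V _ _ 1 s t HU HT HT (fun s t h => proj1 (O s t h)) Hu).
  assert (TG := Dt_dot_const V _ _ 0 s t HU HT HG (fun s t h => proj1 (proj2 (proj2 (proj2 (O s t h))))) Hu).
  assert (NN := Dt_dot_const V _ _ 1 s t HU HN HN (fun s t h => proj1 (proj2 (proj2 (O s t h)))) Hu).
  assert (TN := Dt_dot_const V _ _ 0 s t HU HT HN (fun s t h => proj1 (proj2 (proj2 (proj2 (proj2 (O s t h)))))) Hu).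
  assert (GN := Dt_dot_const V _ _ 0 s t HU HG HN (fun s t h => proj2 (proj2 (proj2 (proj2 (proj2 (O s t h)))))) Hu).
  cbv beta in *. destruct (O s t Hu) as [O1 [O2 [O3 [O4 [O5 O6]]]]].
  assert (L : forall a x y, vdot (vscale a x) y = a * vdot x y)
    by (intros; unfold vdot, vscale; cbn; ring).
  rewrite (vD_speed_T V G s t Hreg Hu), L in TG, GN. rewrite O1 in TG. rewrite O5 in GN.
  unfold geod_rate in *. repeat split; lra.
Qed.

Lemma sphere_Ds V G s t : sphere_family V G -> V s t ->
  vdot (vD (fun r => G r t) s) (G s t) = 0 /\
  vdot (vD (fun r => frenet_T (G r) t) s) (frenet_T (G s) t) = 0 /\
  vdot (vD (fun r => frenet_T (G r) t) s) (G s t) = - drift G s t /\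
  vdot (vD (fun r => frenet_T (G r) t) s) (sphere_n (G s) t) = turn G s t /\
  vdot (vD (fun r => sphere_n (G r) t) s) (frenet_T (G s) t) = - turn G s t /\
  vdot (vD (fun r => sphere_n (G r) t) s) (G s t) = - lift G s t /\
  vdot (vD (fun r => sphere_n (G r) t) s) (sphere_n (G s) t) = 0.
Proof.
  intros H Hu. assert (Hreg := proj1 H). assert (HU : open2 V) by apply Hreg.
  assert (HG : smoothV V G) by apply Hreg.
  assert (HT := smoothV_T V G Hreg). assert (HN := smoothV_sphere_n V G Hreg).
  assert (O := fun s t => sphere_orthonormal V G s t H).
  assert (TT := Ds_dot_const V _ _ 1 s t HU HT HT (fun s t h => proj1 (O s t h)) Hu).
  assert (GG := Ds_dot_const V _ _ 1 s t HU HG HG (fun s t h => proj1 (proj2 (O s t h))) Hu).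
  assert (TG := Ds_dot_const V _ _ 0 s t HU HT HG (fun s t h => proj1 (proj2 (proj2 (proj2 (O s t h))))) Hu).
  assert (NN := Ds_dot_const V _ _ 1 s t HU HN HN (fun s t h => proj1 (proj2 (proj2 (O s t h)))) Hu).
  assert (TN := Ds_dot_const V _ _ 0 s t HU HT HN (fun s t h => proj1 (proj2 (proj2 (proj2 (proj2 (O s t h)))))) Hu).
  assert (GN := Ds_dot_const V _ _ 0 s t HU HG HN (fun s t h => proj2 (proj2 (proj2 (proj2 (proj2 (O s t h)))))) Hu).
  cbv beta in *. unfold drift, lift, turn in *. repeat split; lra.
Qed.

(** Commuting mixed derivatives, now for the frame (G, T, n). The term [speed * lift] in the second
    equation comes from the curvature of the sphere; it is the source of the 1 in the coefficient 1
    - l / 2 of the Euler-Lagrange expression. *)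
Lemma sphere_compat V G s t : sphere_family V G -> V s t ->
  Derive (fun r => speed (G r) t) s = Derive (drift G s) t - geod_rate (G s) t * lift G s t /\
  Derive (fun r => geod_rate (G r) t) s = Derive (turn G s) t + speed (G s) t * lift G s t /\
  Derive (lift G s) t = speed (G s) t * turn G s t - geod_rate (G s) t * drift G s t.
Proof.
  intros H Hu. assert (Hreg := proj1 H). assert (HU : open2 V) by apply Hreg.
  assert (HG : smoothV V G) by apply Hreg.
  assert (HT := smoothV_T V G Hreg). assert (HN := smoothV_sphere_n V G Hreg).
  assert (HGt := smoothV_Dt V _ HG). assert (HGs := smoothV_Ds V _ HG).
  assert (HTt := smoothV_Dt V _ HT). assert (HTs := smoothV_Ds V _ HT). cbv beta in *.
  destruct (sphere_Dt V G s t H Hu) as [D1 [D2 [D3 [D4 [D5 D6]]]]].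
  destruct (sphere_Ds V G s t H Hu) as [S1 [S2 [S3 [S4 [S5 [S6 S7]]]]]].
  destruct (sphere_orthonormal V G s t H Hu) as [O1 [O2 [O3 [O4 [O5 O6]]]]].
  assert (P := fun x y => sphere_parseval V G s t x y H Hu).
  assert (L : forall a x y, vdot (vscale a x) y = a * vdot x y)
    by (intros; unfold vdot, vscale; cbn; ring).
  assert (LD : forall a b x y z, vdot (vadd (vscale a x) (vscale b y)) z = a * vdot x z + b * vdot y z)
    by (intros; unfold vdot, vadd, vscale; cbn; ring).
  assert (E : vD (fun z => vD (fun r => G r z) s) t =
    vadd (vscale (Derive (fun r => speed (G r) t) s) (frenet_T (G s) t))
         (vscale (speed (G s) t) (vD (fun r => frenet_T (G r) t) s))).
  { rewrite <- (vD_Schwarz V G s t HU HG Hu).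
    transitivity (vD (fun r => vscale (speed (G r) t) (frenet_T (G r) t)) s).
    - apply vD_ext_loc.
      apply (open2_slice_s V (fun s t => vD (G s) t = vscale (speed (G s) t) (frenet_T (G s) t)));
        [exact HU| |exact Hu]. intros u w. apply vD_speed_T, Hreg.
    - apply (vD_scale (fun r => speed (G r) t) (fun r => frenet_T (G r) t)).
      + exact (smooth2_ex_derive_s V _ s t (smooth2_speed V G Hreg) Hu).
      + exact (smoothV_ex_s V _ s t HT Hu). }
  assert (F1 := Derive_dot (fun z => vD (fun r => G r z) s) (frenet_T (G s)) t
    (smoothV_ex_t V _ s t HGs Hu) (smoothV_ex_t V _ s t HT Hu)).
  assert (F2 := Derive_dot (fun r => vD (frenet_T (G r)) t) (fun r => sphere_n (G r) t) s
    (smoothV_ex_s V _ s t HTt Hu) (smoothV_ex_s V _ s t HN Hu)).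
  assert (F3 := Derive_dot (fun z => vD (fun r => frenet_T (G r) z) s) (sphere_n (G s)) t
    (smoothV_ex_t V _ s t HTs Hu) (smoothV_ex_t V _ s t HN Hu)).
  assert (F4 := Derive_dot (fun z => vD (fun r => G r z) s) (sphere_n (G s)) t
    (smoothV_ex_t V _ s t HGs Hu) (smoothV_ex_t V _ s t HN Hu)).
  cbv beta in F1, F2, F3, F4.
  rewrite (vD_Schwarz V (fun s => frenet_T (G s)) s t HU HT Hu) in F2.
  rewrite E, LD, S2, O1, (P (vD (fun r => G r t) s)), D1, D2, D3, S1 in F1.
  rewrite (P (vD (frenet_T (G s)) t)), D1, D2, D3, S6, S7 in F2.
  rewrite (P (vD (fun r => frenet_T (G r) t) s)), S2, S3, S4, D4, D5, D6 in F3.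
  rewrite E, LD, O5, S4, (P (vD (fun r => G r t) s)), D4, D5, D6, S1 in F4.
  fold (drift G s t) (lift G s t) in F1, F4.
  change (Derive (drift G s) t = Derive (fun r => speed (G r) t) s * 1 + speed (G s) t * 0
     + (drift G s t * 0 + 0 * - speed (G s) t + lift G s t * geod_rate (G s) t)) in F1.
  split; [lra|]. split.
  - etransitivity; [exact F2|].
    assert (F3' : Derive (turn G s) t =
      vdot (vD (fun z => vD (fun r => frenet_T (G r) z) s) t) (sphere_n (G s) t)).
    { etransitivity; [exact F3|]. ring. }
    rewrite F3'. ring.
  - etransitivity; [exact F4|]. ring.
Qed.

Definition spherical_density (l : R) (c : R -> R3) (t : R) : R :=
  (geod_curvature c t ^ 2 + l) * speed c t.

Definition arc_Dk (c : R -> R3) (t : R) : R := Derive (geod_curvature c) t * / speed c t.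

(* The Euler-Lagrange expression v (k'' + k^3 / 2 + (1 - l / 2) k), with primes
   denoting arclength derivatives. *)
Definition spherical_EL (l : R) (c : R -> R3) (t : R) : R :=
  Derive (arc_Dk c) t
  + speed c t * (geod_curvature c t ^ 3 * / 2 + (1 - l * / 2) * geod_curvature c t).

(** With q the geodesic rate, the density is q^2 / v + l v, and 2 k and l - k^2 are its partial
    derivatives in q and v; they multiply [turn] and [drift], whose [t]-derivatives vary q and v.
    The [lift] term is chosen so that the leftover derivatives of k cancel through the equation
    lift' = v turn - q drift. *)
Definition spherical_flux (l : R) (G : R -> R -> R3) (s t : R) : R :=
  2 * (geod_curvature (G s) t * turn G s t)
  + (l - geod_curvature (G s) t ^ 2) * drift G s t - 2 * (arc_Dk (G s) t * lift G s t).

Lemma smooth2_arc_Dk U G : regular_family U G -> smooth2 U (fun s => arc_Dk (G s)).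
Proof.
  intros H. assert (HU : open2 U) by apply H. unfold arc_Dk. apply smooth2_mult; [exact HU| |].
  - exact (smooth2_Dt U _ (smooth2_geod U G H)).
  - apply smooth2_inv; [exact HU|apply smooth2_speed, H|].
    intros s t Hu. apply Rgt_not_eq, (speed_pos U); assumption.
Qed.

Lemma smooth2_spherical_EL l U G : regular_family U G -> smooth2 U (fun s => spherical_EL l (G s)).
Proof.
  intros H. assert (HU : open2 U) by apply H. assert (Hk := smooth2_geod U G H).
  assert (Hv := smooth2_speed U G H). assert (Hd := smooth2_Dt U _ (smooth2_arc_Dk U G H)).
  cbv beta in Hd. unfold spherical_EL. smooth2_tac HU.
Qed.

Lemma smooth2_spherical_density l U G : regular_family U G ->
  smooth2 U (fun s => spherical_density l (G s)).
Proof.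
  intros H. assert (HU : open2 U) by apply H. assert (Hk := smooth2_geod U G H).
  assert (Hv := smooth2_speed U G H). unfold spherical_density. smooth2_tac HU.
Qed.

Lemma smooth2_sphere_coefs U G : regular_family U G ->
  smooth2 U (drift G) /\ smooth2 U (lift G) /\ smooth2 U (turn G).
Proof.
  intros H. assert (HU : open2 U) by apply H. assert (HG : smoothV U G) by apply H.
  assert (HT := smoothV_T U G H). assert (HN := smoothV_sphere_n U G H).
  split; [|split]; (apply smooth2_dot; [exact HU| |assumption]).
  - exact (smoothV_Ds U _ HG).
  - exact (smoothV_Ds U _ HG).
  - exact (smoothV_Ds U _ HT).
Qed.

Lemma smooth2_spherical_flux l U G : regular_family U G -> smooth2 U (spherical_flux l G).
Proof.
  intros H. assert (HU : open2 U) by apply H. destruct (smooth2_sphere_coefs U G H) as [? [? ?]].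
  assert (Hk := smooth2_geod U G H). assert (Hd := smooth2_arc_Dk U G H).
  unfold spherical_flux. smooth2_tac HU.
Qed.

Lemma spherical_first_variation l V G s t : sphere_family V G -> V s t ->
  Derive (fun r => spherical_density l (G r) t) s =
  Derive (spherical_flux l G s) t + 2 * (spherical_EL l (G s) t * lift G s t).
Proof.
  intros H Hu. assert (Hreg := proj1 H). assert (HU : open2 V) by apply Hreg.
  destruct (smooth2_sphere_coefs V G Hreg) as [Ha [Hl Hz]].
  assert (Hk := smooth2_geod V G Hreg). assert (Hd := smooth2_arc_Dk V G Hreg).
  destruct (sphere_compat V G s t H Hu) as [C1 [C2 C3]].
  assert (Hv := speed_pos V G s t Hreg Hu).
  assert (Ek := geod_curvature_rate V G s t H Hu).
  assert (EL : Derive (fun r => spherical_density l (G r) t) s =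
    2 * (geod_rate (G s) t / speed (G s) t) * Derive (fun r => geod_rate (G r) t) s
    + (l - (geod_rate (G s) t / speed (G s) t) ^ 2) * Derive (fun r => speed (G r) t) s).
  { rewrite (Ds_ext V (fun s => spherical_density l (G s)) (fun s t =>
      geod_rate (G s) t ^ 2 / speed (G s) t + l * speed (G s) t) s t HU); [| |exact Hu].
    2:{ intros u w Huw. unfold spherical_density. rewrite (geod_curvature_rate V) by assumption.
        assert (Hv' := speed_pos V G u w Hreg Huw). field. lra. }
    assert (Eq : ex_derive (fun r => geod_rate (G r) t) s).
    { apply (smooth2_ex_derive_s V (fun s => geod_rate (G s)) s t); [|exact Hu].
      apply smooth2_dot; [exact HU| |apply smoothV_sphere_n, Hreg].
      exact (smoothV_Dt V _ (smoothV_T V G Hreg)). }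
    assert (Ev : ex_derive (fun r => speed (G r) t) s)
      by exact (smooth2_ex_derive_s V _ s t (smooth2_speed V G Hreg) Hu).
    set (q := fun r => geod_rate (G r) t) in *. set (v := fun r => speed (G r) t) in *.
    change (geod_rate (G s) t) with (q s) in *. change (speed (G s) t) with (v s) in *.
    change (Derive (fun r => q r ^ 2 / v r + l * v r) s =
      2 * (q s / v s) * Derive q s + (l - (q s / v s) ^ 2) * Derive v s).
    change (ex_derive q s) in Eq. change (ex_derive v s) in Ev.
    clearbody q v. apply is_derive_unique. auto_derive.
    - repeat split; try assumption. lra.
    - change (fun x => q x) with q. change (fun x => v x) with v. field. lra. }
  assert (EX : Derive (spherical_flux l G s) t =
    2 * (Derive (geod_curvature (G s)) t * turn G s t + geod_curvature (G s) t * Derive (turn G s) t)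
    - 2 * geod_curvature (G s) t * Derive (geod_curvature (G s)) t * drift G s t
    + (l - geod_curvature (G s) t ^ 2) * Derive (drift G s) t
    - 2 * (Derive (arc_Dk (G s)) t * lift G s t + arc_Dk (G s) t * Derive (lift G s) t)).
  { assert (X1' : ex_derive (geod_curvature (G s)) t) by exact (smooth2_ex_derive_t V _ s t Hk Hu).
    assert (X2' : ex_derive (turn G s) t) by exact (smooth2_ex_derive_t V _ s t Hz Hu).
    assert (X3' : ex_derive (drift G s) t) by exact (smooth2_ex_derive_t V _ s t Ha Hu).
    assert (X4 : ex_derive (arc_Dk (G s)) t) by exact (smooth2_ex_derive_t V _ s t Hd Hu).
    assert (X5 : ex_derive (lift G s) t) by exact (smooth2_ex_derive_t V _ s t Hl Hu).
    unfold spherical_flux.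
    set (k := geod_curvature (G s)) in *. set (z := turn G s) in *. set (a := drift G s) in *.
    set (d := arc_Dk (G s)) in *. set (u := lift G s) in *.
    change (Derive (fun r => 2 * (k r * z r) + (l - k r ^ 2) * a r - 2 * (d r * u r)) t =
      2 * (Derive k t * z t + k t * Derive z t) - 2 * k t * Derive k t * a t
      + (l - k t ^ 2) * Derive a t - 2 * (Derive d t * u t + d t * Derive u t)).
    clearbody k z a d u. apply is_derive_unique. auto_derive; [tauto|].
    change (fun x => k x) with k. change (fun x => z x) with z. change (fun x => a x) with a.
    change (fun x => d x) with d. change (fun x => u x) with u. ring. }
  rewrite EL, EX, C1, C2, C3. unfold spherical_EL. unfold arc_Dk at 2. rewrite Ek. field. lra.
Qed.

Lemma spherical_variation l L U G : 0 < L -> regular_family U G ->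
  (forall t, 0 <= t <= L -> U 0 t) ->
  (forall s t, U s t -> 0 < t < L -> vdot (G s t) (G s t) = 1) ->
  vD (fun r => G r 0) 0 = vzero -> vD (fun r => G r L) 0 = vzero ->
  is_derive (fun s => spherical_energy l L (G s)) 0
    (2 * (spherical_boundary (G 0) G L - spherical_boundary (G 0) G 0) +
     RInt (fun t => 2 * (spherical_EL l (G 0) t * lift G 0 t)) 0 L).
Proof.
  intros HL H HI HS W0 WL. assert (HU : open2 U) by apply H.
  replace (2 * (spherical_boundary (G 0) G L - spherical_boundary (G 0) G 0))
    with (spherical_flux l G 0 L - spherical_flux l G 0 0).
  2:{ unfold spherical_flux, drift, lift. rewrite W0, WL.
      rewrite !(vdot_comm vzero), !vdot_vzero_r.
      unfold spherical_boundary, turn, sphere_n. ring. }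
  apply (is_derive_RInt_flux U (fun s => spherical_density l (G s)) (spherical_flux l G)
    (fun s t => 2 * (spherical_EL l (G s) t * lift G s t)) L HL HU HI).
  - apply smooth2_spherical_density, H.
  - apply smooth2_spherical_flux, H.
  - assert (HE := smooth2_spherical_EL l U G H).
    destruct (smooth2_sphere_coefs U G H) as [_ [Hl _]]. smooth2_tac HU.
  - intros t Ht.
    (* The sphere constraint holds for 0 < t < L only, so the pointwise formula is applied over this
       strip. *)
    set (V := fun s t => U s t /\ box 1 0 L s t).
    assert (HV : forall s t, V s t -> U s t) by (intros ? ? [? _]; assumption).
    apply spherical_first_variation with V.
    + split; [split; [|split]|].
      * apply open2_and; [exact HU|apply box_open].
      * apply smoothV_sub with U; [exact HV|apply H].
      * intros u w Huw. apply H, HV, Huw.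
      * intros u w [Huw [_ Hw]]. apply HS; assumption.
    + split; [apply HI; lra|]. split; [lra|exact Ht].
Qed.

(** * From the Euler-Lagrange equations to critical points *)

Lemma box_sub eps a b eps' a' b' s t :
  eps' <= eps -> a <= a' -> b' <= b -> box eps' a' b' s t -> box eps a b s t.
Proof. unfold box. lra. Qed.

Lemma variation_smoothV eps L c G : variation eps L c G ->
  exists del, 0 < del /\ smoothV (box eps (- del) (L + del)) G.
Proof.
  intros [[d1 [P1 H1]] [[d2 [P2 H2]] [[d3 [P3 H3]] _]]].
  set (d := Rmin d1 (Rmin d2 d3)).
  assert (E1 : d <= d1) by apply Rmin_l.
  assert (E : d <= Rmin d2 d3) by apply Rmin_r.
  assert (E2 := Rmin_l d2 d3). assert (E3 := Rmin_r d2 d3).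
  exists d. split; [unfold d; repeat apply Rmin_glb_lt; assumption|].
  split; [|split]; intros s t [Hs Ht]; [apply H1|apply H2|apply H3]; lra.
Qed.

Lemma smooth_curve_smoothV L c : smooth_curve L c ->
  exists del, 0 < del /\ smoothV (box 1 (- del) (L + del)) (fun _ => c).
Proof.
  intros [H1 [H2 H3]].
  destruct (smooth_fun_smooth2 _ _ H1) as [d1 [P1 K1]].
  destruct (smooth_fun_smooth2 _ _ H2) as [d2 [P2 K2]].
  destruct (smooth_fun_smooth2 _ _ H3) as [d3 [P3 K3]].
  set (d := Rmin d1 (Rmin d2 d3)).
  assert (E1 : d <= d1) by apply Rmin_l.
  assert (E : d <= Rmin d2 d3) by apply Rmin_r.
  assert (E2 := Rmin_l d2 d3). assert (E3 := Rmin_r d2 d3).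
  exists d. split; [unfold d; repeat apply Rmin_glb_lt; assumption|].
  split; [|split]; (eapply smooth2_sub; [|eassumption]);
    intros s t; apply box_sub; lra.
Qed.

Lemma smoothV_curve U L c : 0 < L -> open2 U -> (forall t, 0 <= t <= L -> U 0 t) ->
  smoothV U (fun _ => c) -> smooth_curve L c.
Proof.
  intros HL HU HI [H1 [H2 H3]].
  split; [|split]; apply (smooth_fun_of_smooth2 U); assumption.
Qed.

(** A variation is not assumed to consist of Frenet curves. The condition is open and holds along s
    = 0, so this domain still contains a neighbourhood of that segment. *)
Definition frenet_domain (V : R -> R -> Prop) (G : R -> R -> R3) (s t : R) : Prop :=
  V s t /\ 0 < vdot (vcross (vD (G s) t) (vD (vD (G s)) t))
                    (vcross (vD (G s) t) (vD (vD (G s)) t)).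

Definition regular_domain (V : R -> R -> Prop) (G : R -> R -> R3) (s t : R) : Prop :=
  V s t /\ 0 < vdot (vD (G s) t) (vD (G s) t).

Lemma frenet_domain_family V G : open2 V -> smoothV V G -> frenet_family (frenet_domain V G) G.
Proof.
  intros HV HG. split; [|split].
  - apply open2_pos; [exact HV|]. apply smooth2_dot; [exact HV| |]; apply smoothV_osculating; assumption.
  - apply smoothV_sub with V; [intros s t [H _]; exact H|exact HG].
  - intros s t [_ H]. exact H.
Qed.

Lemma regular_domain_family V G : open2 V -> smoothV V G -> regular_family (regular_domain V G) G.
Proof.
  intros HV HG. split; [|split].
  - apply open2_pos; [exact HV|]. apply smooth2_dot; [exact HV| |]; apply smoothV_Dt, HG.
  - apply smoothV_sub with V; [intros s t [H _]; exact H|exact HG].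
  - intros s t [_ H]. exact H.
Qed.

Lemma frenet_curve_family L c : frenet_curve L c ->
  exists U, frenet_family U (fun _ => c) /\ forall t, 0 <= t <= L -> U 0 t.
Proof.
  intros [Hc Hr]. destruct (smooth_curve_smoothV L c Hc) as [d [Hd HS]].
  exists (frenet_domain (box 1 (- d) (L + d)) (fun _ => c)).
  split; [apply frenet_domain_family; [apply box_open|exact HS]|].
  intros t Ht. split; [unfold box; lra|]. apply vdot_pos, (Hr t Ht).
Qed.

Lemma regular_curve_family L c : smooth_curve L c ->
  (forall t, 0 <= t <= L -> vD c t <> vzero) ->
  exists U, regular_family U (fun _ => c) /\ forall t, 0 <= t <= L -> U 0 t.
Proof.
  intros Hc Hr. destruct (smooth_curve_smoothV L c Hc) as [d [Hd HS]].
  exists (regular_domain (box 1 (- d) (L + d)) (fun _ => c)).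
  split; [apply regular_domain_family; [apply box_open|exact HS]|].
  intros t Ht. split; [unfold box; lra|]. apply vdot_pos, (Hr t Ht).
Qed.

(** * Agreement on the open interval and passage to the end points *)

Definition eq_on {T : Type} (a b : R) (f g : R -> T) : Prop :=
  forall t, a < t < b -> f t = g t.

Lemma interval_locally a b t : a < t < b -> locally t (fun r => a < r < b).
Proof.
  intros Ht. apply (filter_imp (box 1 a b 0)); [intros r Hr; apply Hr|].
  apply (locally_2d_1d_const_x (box 1 a b)), box_open. unfold box. lra.
Qed.

Lemma eq_on_locally {T : Type} a b (f g : R -> T) t : eq_on a b f g -> a < t < b ->
  locally t (fun r => f r = g r).
Proof.
  intros H Ht. apply (filter_imp (fun r => a < r < b)); [exact H|].
  apply interval_locally, Ht.
Qed.

Lemma eq_on_vD a b c d : eq_on a b c d -> eq_on a b (vD c) (vD d).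
Proof. intros H t Ht. apply vD_ext_loc. eapply eq_on_locally; eassumption. Qed.

Lemma eq_on_Derive a b f g : eq_on a b f g -> eq_on a b (Derive f) (Derive g).
Proof. intros H t Ht. apply Derive_ext_loc. eapply eq_on_locally; eassumption. Qed.

(** Equality on (0, L) passes to derivatives because the interval is open, but leaves the ends out;
    continuity restores them. This is the formal reason why derivatives at the ends do not depend on
    the extension of the curve. *)
Lemma continuous_eq_closed (f g : R -> R) L : 0 < L ->
  (forall t, 0 <= t <= L -> continuous f t) -> (forall t, 0 <= t <= L -> continuous g t) ->
  eq_on 0 L f g -> forall t, 0 <= t <= L -> f t = g t.
Proof.
  intros HL Hf Hg E t Ht. apply Rminus_diag_uniq. apply NNPP. intros Hn.
  assert (Hc : continuous (fun r => f r - g r) t)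
    by (apply @continuous_minus; [apply Hf|apply Hg]; exact Ht).
  assert (Hp : 0 < Rabs (f t - g t)) by apply Rabs_pos_lt, Hn.
  destruct (proj1 (filterlim_locally _ _) Hc (mkposreal _ Hp)) as [d Hd].
  assert (Hd0 := cond_pos d).
  set (e := Rmin (d / 2) (L / 2)).
  assert (He : 0 < e) by (apply Rmin_glb_lt; lra).
  assert (He1 : e <= d / 2) by apply Rmin_l. assert (He2 : e <= L / 2) by apply Rmin_r.
  (* A point of (0, L) close to [t], reached by moving towards the middle. *)
  set (r := if Rle_dec t (L / 2) then t + e / 2 else t - e / 2).
  assert (Hr : 0 < r < L /\ Rabs (r - t) < d).
  { unfold r. destruct Rle_dec; (split; [lra|]); apply Rabs_lt_between; lra. }
  destruct Hr as [Hr1 Hr2]. specialize (Hd r Hr2).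
  change (Rabs ((f r - g r) - (f t - g t)) < Rabs (f t - g t)) in Hd.
  rewrite (E r Hr1) in Hd. replace (g r - g r - (f t - g t)) with (- (f t - g t)) in Hd by ring.
  rewrite Rabs_Ropp in Hd. lra.
Qed.

Lemma smooth2_eq_closed U V f g L : 0 < L -> smooth2 U f -> smooth2 V g ->
  (forall t, 0 <= t <= L -> U 0 t) -> (forall t, 0 <= t <= L -> V 0 t) ->
  eq_on 0 L (f 0) (g 0) -> forall t, 0 <= t <= L -> f 0 t = g 0 t.
Proof.
  intros HL Hf Hg HU HV. apply continuous_eq_closed; [exact HL| |]; intros t Ht.
  - exact (smooth2_continuous_t U f 0 t Hf (HU t Ht)).
  - exact (smooth2_continuous_t V g 0 t Hg (HV t Ht)).
Qed.

Lemma smoothV_eq_closed U V F H L : 0 < L -> smoothV U F -> smoothV V H ->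
  (forall t, 0 <= t <= L -> U 0 t) -> (forall t, 0 <= t <= L -> V 0 t) ->
  eq_on 0 L (F 0) (H 0) -> forall t, 0 <= t <= L -> F 0 t = H 0 t.
Proof.
  intros HL [F1 [F2 F3]] [H1 [H2 H3]] HU HV E t Ht. apply R3_eq.
  - apply (smooth2_eq_closed U V (fun s t => X1 (F s t)) (fun s t => X1 (H s t)) L); try assumption.
    intros r Hr. cbn. rewrite E by exact Hr. reflexivity.
  - apply (smooth2_eq_closed U V (fun s t => X2 (F s t)) (fun s t => X2 (H s t)) L); try assumption.
    intros r Hr. cbn. rewrite E by exact Hr. reflexivity.
  - apply (smooth2_eq_closed U V (fun s t => X3 (F s t)) (fun s t => X3 (H s t)) L); try assumption.
    intros r Hr. cbn. rewrite E by exact Hr. reflexivity.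
Qed.

Lemma eq_on_frenet a b c d : eq_on a b c d ->
  eq_on a b (speed c) (speed d) /\ eq_on a b (frenet_T c) (frenet_T d) /\
  eq_on a b (frenet_N c) (frenet_N d) /\ eq_on a b (frenet_B c) (frenet_B d) /\
  eq_on a b (curvature c) (curvature d) /\ eq_on a b (mod_torsion c) (mod_torsion d).
Proof.
  intros H. assert (H1 := eq_on_vD _ _ _ _ H). assert (H2 := eq_on_vD _ _ _ _ H1).
  assert (H3 := eq_on_vD _ _ _ _ H2).
  repeat split; intros t Ht; unfold mod_torsion, torsion, curvature, frenet_N, frenet_B, frenet_T, speed;
    rewrite ?(H1 t Ht), ?(H2 t Ht), ?(H3 t Ht); reflexivity.
Qed.

Lemma eq_on_torque a b c d : eq_on a b c d ->
  eq_on a b (s1 c) (s1 d) /\ eq_on a b (s2 c) (s2 d) /\ eq_on a b (s3 c) (s3 d).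
Proof.
  intros H. destruct (eq_on_frenet a b c d H) as [Hv [_ [_ [_ [Hk Hl]]]]].
  assert (H1 : eq_on a b (s1 c) (s1 d))
    by (intros t Ht; unfold s1; rewrite (Hk t Ht), (Hl t Ht); reflexivity).
  split; [exact H1|]. split; intros t Ht.
  - unfold s2. rewrite (eq_on_Derive _ _ _ _ H1 t Ht), (Hv t Ht), (Hk t Ht). reflexivity.
  - unfold s3. rewrite (Hk t Ht), (Hl t Ht). reflexivity.
Qed.

Lemma eq_on_strip_force mu a b c d : eq_on a b c d ->
  eq_on a b (strip_force mu c) (strip_force mu d).
Proof.
  intros H. destruct (eq_on_frenet a b c d H) as [Hv [HT [HN [HB [Hk Hl]]]]].
  destruct (eq_on_torque a b c d H) as [H1 [H2 H3]].
  assert (DT := eq_on_vD _ _ _ _ HT). assert (DN := eq_on_vD _ _ _ _ HN).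
  assert (D2 := eq_on_Derive _ _ _ _ H2). assert (D3 := eq_on_Derive _ _ _ _ H3).
  intros t Ht. unfold strip_force, bend_rate, twist_rate.
  rewrite (Hv t Ht), (HT t Ht), (HN t Ht), (HB t Ht), (Hk t Ht), (Hl t Ht), (H1 t Ht), (H2 t Ht),
    (H3 t Ht), (DT t Ht), (DN t Ht), (D2 t Ht), (D3 t Ht). reflexivity.
Qed.

Lemma eq_on_spherical l a b c d : eq_on a b c d ->
  eq_on a b (geod_curvature c) (geod_curvature d) /\
  eq_on a b (spherical_EL l c) (spherical_EL l d).
Proof.
  intros H. assert (H1 := eq_on_vD _ _ _ _ H). assert (H2 := eq_on_vD _ _ _ _ H1).
  assert (Hv : eq_on a b (speed c) (speed d)) by (apply eq_on_frenet, H).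
  assert (Hk : eq_on a b (geod_curvature c) (geod_curvature d)).
  { intros t Ht. unfold geod_curvature. rewrite (H t Ht), (H1 t Ht), (H2 t Ht), (Hv t Ht). reflexivity. }
  assert (Hd : eq_on a b (arc_Dk c) (arc_Dk d)).
  { intros t Ht. unfold arc_Dk. rewrite (eq_on_Derive _ _ _ _ Hk t Ht), (Hv t Ht). reflexivity. }
  split; [exact Hk|]. intros t Ht. unfold spherical_EL.
  rewrite (eq_on_Derive _ _ _ _ Hd t Ht), (Hk t Ht), (Hv t Ht). reflexivity.
Qed.

Lemma vD_locally_const (F : R -> R3) s u : locally s (fun r => F r = u) -> vD F s = vzero.
Proof.
  intros H. rewrite (vD_ext_loc F (fun _ => u) s H). unfold vD, vzero.
  rewrite !Derive_const. reflexivity.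
Qed.

Lemma fixes_ends_vD eps L c G : 0 < eps -> fixes_ends eps L c G ->
  vD (fun r => G r 0) 0 = vzero /\ vD (fun r => G r L) 0 = vzero.
Proof.
  intros He H.
  assert (Hl := interval_locally (- eps) eps 0 ltac:(lra)).
  split; [apply vD_locally_const with (c 0)|apply vD_locally_const with (c L)];
    (eapply filter_imp; [|exact Hl]); intros r Hr; apply (H r Hr).
Qed.

(** The boundary condition of a proper variation is phrased with the frame and torque of [c], the
    variation formula with those of [G 0]. Since these curves may differ outside [0, L], the two
    boundary terms are first identified by continuity. *)
Lemma elastic_strip_of_force mu L c : 0 < L -> frenet_curve L c ->
  (forall t, 0 < t < L -> vD (strip_force mu c) t = vzero) -> elastic_strip mu L c.
Proof.
  intros HL Hc HF. split; [exact Hc|]. intros eps G He [Hvar [Hfix Hbd]].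
  destruct (variation_smoothV eps L c G Hvar) as [d [Hd HG]].
  set (V := box eps (- d) (L + d)) in *. assert (HV : open2 V) by apply box_open.
  assert (HVI : forall t, 0 <= t <= L -> V 0 t) by (intros t Ht; unfold V, box; lra).
  assert (H := frenet_domain_family V G HV HG). set (U := frenet_domain V G) in *.
  destruct (frenet_curve_family L c Hc) as [Uc [HcU HcI]].
  assert (E0 : eq_on 0 L (G 0) c).
  { intros t Ht. apply Hvar. lra. }
  assert (HcS : smoothV Uc (fun _ => c)) by apply HcU.
  assert (E1 : forall t, 0 <= t <= L -> vD (G 0) t = vD c t).
  { apply (smoothV_eq_closed V Uc (fun s => vD (G s)) (fun _ => vD c) L HL
      (smoothV_Dt V G HG) (smoothV_Dt Uc _ HcS) HVI HcI). apply eq_on_vD, E0. }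
  assert (E2 : forall t, 0 <= t <= L -> vD (vD (G 0)) t = vD (vD c) t).
  { apply (smoothV_eq_closed V Uc (fun s => vD (vD (G s))) (fun _ => vD (vD c)) L HL
      (smoothV_Dt V _ (smoothV_Dt V G HG)) (smoothV_Dt Uc _ (smoothV_Dt Uc _ HcS)) HVI HcI).
    apply eq_on_vD, eq_on_vD, E0. }
  assert (HI : forall t, 0 <= t <= L -> U 0 t).
  { intros t Ht. split; [apply HVI, Ht|]. rewrite (E1 t Ht), (E2 t Ht).
    apply vdot_pos, (proj2 Hc t Ht). }
  destruct (fixes_ends_vD eps L c G He Hfix) as [W0 WL].
  assert (HB : forall t, 0 <= t <= L -> strip_boundary (G 0) G t = strip_boundary c G t).
  { destruct (eq_on_frenet 0 L _ _ E0) as [_ [ET [EN [EB _]]]].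
    destruct (eq_on_torque 0 L _ _ E0) as [Es1 [Es2 Es3]].
    intros t Ht. unfold strip_boundary.
    rewrite (smooth2_eq_closed U Uc _ _ L HL (smooth2_s1 U G H) (smooth2_s1 Uc _ HcU) HI HcI Es1 t Ht).
    rewrite (smooth2_eq_closed U Uc _ _ L HL (smooth2_s2 U G H) (smooth2_s2 Uc _ HcU) HI HcI Es2 t Ht).
    rewrite (smooth2_eq_closed U Uc _ _ L HL (smooth2_s3 U G H) (smooth2_s3 Uc _ HcU) HI HcI Es3 t Ht).
    rewrite (smoothV_eq_closed U Uc _ _ L HL (smoothV_B U G H) (smoothV_B Uc _ HcU) HI HcI EB t Ht).
    rewrite (smoothV_eq_closed U Uc _ _ L HL (smoothV_N U G H) (smoothV_N Uc _ HcU) HI HcI EN t Ht).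
    rewrite (smoothV_eq_closed U Uc _ _ L HL (smoothV_T U G (frenet_family_regular _ _ H))
      (smoothV_T Uc _ (frenet_family_regular _ _ HcU)) HI HcI ET t Ht).
    reflexivity. }
  assert (HD := sadowsky_variation mu L U G HL H HI W0 WL).
  rewrite (HB 0), (HB L), Hbd in HD by lra.
  assert (HR : RInt (fun t => 2 * vdot (vD (strip_force mu (G 0)) t) (vD (fun r => G r t) 0)) 0 L = 0).
  { rewrite (RInt_ext _ (fun _ => 0)).
    - rewrite RInt_const. apply Rmult_0_r.
    - rewrite Rmin_left, Rmax_right by lra. intros t Ht.
      rewrite (eq_on_vD _ _ _ _ (eq_on_strip_force mu 0 L _ _ E0) t Ht), (HF t Ht).
      rewrite vdot_comm, vdot_vzero_r. apply Rmult_0_r. }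
  rewrite HR in HD. replace (2 * 0 + 0) with 0 in HD by ring. exact HD.
Qed.

Lemma spherical_elastic_of_EL l L c : 0 < L -> smooth_curve L c -> spherical_curve L c ->
  (forall t, 0 <= t <= L -> vD c t <> vzero) ->
  (forall t, 0 < t < L -> spherical_EL l c t = 0) -> spherical_elastic l L c.
Proof.
  intros HL Hc HS Hr HE. split; [exact Hc|]. split; [exact HS|]. split; [exact Hr|].
  intros eps G He [Hvar [HGS [Hfix Hbd]]].
  destruct (variation_smoothV eps L c G Hvar) as [d [Hd HG]].
  set (V := box eps (- d) (L + d)) in *. assert (HV : open2 V) by apply box_open.
  assert (HVI : forall t, 0 <= t <= L -> V 0 t) by (intros t Ht; unfold V, box; lra).
  assert (H := regular_domain_family V G HV HG). set (U := regular_domain V G) in *.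
  destruct (regular_curve_family L c Hc Hr) as [Uc [HcU HcI]].
  assert (E0 : eq_on 0 L (G 0) c).
  { intros t Ht. apply Hvar. lra. }
  assert (HcS : smoothV Uc (fun _ => c)) by apply HcU.
  assert (E1 : forall t, 0 <= t <= L -> vD (G 0) t = vD c t).
  { apply (smoothV_eq_closed V Uc (fun s => vD (G s)) (fun _ => vD c) L HL
      (smoothV_Dt V G HG) (smoothV_Dt Uc _ HcS) HVI HcI). apply eq_on_vD, E0. }
  assert (HI : forall t, 0 <= t <= L -> U 0 t).
  { intros t Ht. split; [apply HVI, Ht|]. rewrite (E1 t Ht). apply vdot_pos, (Hr t Ht). }
  destruct (fixes_ends_vD eps L c G He Hfix) as [W0 WL].
  destruct (eq_on_spherical l 0 L _ _ E0) as [Ek EE].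
  assert (HB : forall t, 0 <= t <= L -> spherical_boundary (G 0) G t = spherical_boundary c G t).
  { destruct (eq_on_frenet 0 L _ _ E0) as [_ [ET _]].
    intros t Ht. unfold spherical_boundary.
    rewrite (smooth2_eq_closed U Uc _ _ L HL (smooth2_geod U G H) (smooth2_geod Uc _ HcU) HI HcI Ek t Ht).
    rewrite (smoothV_eq_closed U Uc _ _ L HL (smoothV_T U G H) (smoothV_T Uc _ HcU) HI HcI ET t Ht).
    rewrite (proj2 (proj2 (proj2 Hvar)) t Ht). reflexivity. }
  assert (HGS' : forall s t, U s t -> 0 < t < L -> vdot (G s t) (G s t) = 1).
  { intros s t [[Hs _] _] Ht. apply (HGS s Hs). lra. }
  assert (HD := spherical_variation l L U G HL H HI HGS' W0 WL).
  rewrite (HB 0), (HB L), Hbd in HD by lra.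
  assert (HR : RInt (fun t => 2 * (spherical_EL l (G 0) t * lift G 0 t)) 0 L = 0).
  { rewrite (RInt_ext _ (fun _ => 0)).
    - rewrite RInt_const. apply Rmult_0_r.
    - rewrite Rmin_left, Rmax_right by lra. intros t Ht.
      rewrite (EE t Ht), (HE t Ht), Rmult_0_l. apply Rmult_0_r. }
  rewrite HR in HD. replace (2 * 0 + 0) with 0 in HD by ring. exact HD.
Qed.

(** * From critical points to the Euler-Lagrange equations *)

Lemma RInt_nonneg_zero f L : 0 < L -> (forall t, 0 <= t <= L -> continuous f t) ->
  (forall t, 0 < t < L -> 0 <= f t) -> RInt f 0 L = 0 -> forall t, 0 < t < L -> f t = 0.
Proof.
  intros HL Hc Hp HI t Ht. apply NNPP. intros Hn.
  assert (Hft : 0 < f t) by (destruct (Hp t Ht) as [h|h]; [exact h|congruence]).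
  assert (Ht' : 0 <= t <= L) by lra.
  destruct (proj1 (filterlim_locally _ _) (Hc t Ht') (mkposreal _ Hft)) as [d Hd].
  assert (Hd0 := cond_pos d).
  set (e := Rmin (d / 2) (Rmin (t / 2) ((L - t) / 2))).
  assert (He : 0 < e) by (repeat apply Rmin_glb_lt; lra).
  assert (He1 : e <= d / 2) by apply Rmin_l.
  assert (He2 : e <= Rmin (t / 2) ((L - t) / 2)) by apply Rmin_r.
  assert (He3 := Rmin_l (t / 2) ((L - t) / 2)). assert (He4 := Rmin_r (t / 2) ((L - t) / 2)).
  assert (Hex : forall a b, 0 <= a -> a <= b -> b <= L -> ex_RInt f a b).
  { intros a b Ha Hab Hb. apply (ex_RInt_continuous (V := R_CompleteNormedModule)).
    rewrite Rmin_left, Rmax_right by lra. intros r Hr. apply Hc. lra. }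
  assert (G1 : 0 <= RInt f 0 (t - e)).
  { apply RInt_ge_0; [lra|apply Hex; lra|]. intros r Hr. apply Hp. lra. }
  assert (G2 : 0 < RInt f (t - e) (t + e)).
  { apply RInt_gt_0; [lra| |].
    - intros r Hr. assert (Hrd : Rabs (r - t) < d) by (apply Rabs_lt_between; lra).
      specialize (Hd r Hrd).
      change (Rabs (f r - f t) < f t) in Hd. apply Rabs_lt_between in Hd. lra.
    - intros r Hr. apply Hc. lra. }
  assert (G3 : 0 <= RInt f (t + e) L).
  { apply RInt_ge_0; [lra|apply Hex; lra|]. intros r Hr. apply Hp. lra. }
  assert (C1 := RInt_Chasles f 0 (t - e) (t + e) (Hex 0 (t - e) ltac:(lra) ltac:(lra) ltac:(lra))
    (Hex (t - e) (t + e) ltac:(lra) ltac:(lra) ltac:(lra))).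
  assert (C2 := RInt_Chasles f 0 (t + e) L (Hex 0 (t + e) ltac:(lra) ltac:(lra) ltac:(lra))
    (Hex (t + e) L ltac:(lra) ltac:(lra) ltac:(lra))).
  unfold plus in C1, C2; simpl in C1, C2. lra.
Qed.

(** A polynomial weight, positive inside and zero at both ends; powers of it fix as many derivatives
    at the ends as needed. *)
Definition bump (L t : R) : R := t * (L - t).

Lemma ex_derive_bump L t : ex_derive (bump L) t.
Proof. unfold bump. auto_derive. exact I. Qed.

Lemma smooth2_bump U L : open2 U -> smooth2 U (fun _ t => bump L t).
Proof.
  intros HU. unfold bump. assert (Ht := smooth2_id_t U HU). smooth2_tac HU.
Qed.

(** Differentiation lowers the power of the bump by one and returns an expression of the same shape,
    so the lemma can be iterated. *)
Lemma vD_add_bump L n c H t : ex_vD c t -> ex_vD H t ->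
  vD (fun r => vadd (c r) (vscale (bump L r ^ S n) (H r))) t =
  vadd (vD c t) (vscale (bump L t ^ n)
    (vadd (vscale (INR (S n) * Derive (bump L) t) (H t)) (vscale (bump L t) (vD H t)))).
Proof.
  intros Hc HH. assert (Hb := ex_derive_bump L t).
  assert (Hp : ex_derive (fun r => bump L r ^ S n) t) by (apply ex_derive_pow, Hb).
  rewrite (vD_add c (fun r => vscale (bump L r ^ S n) (H r))); [|exact Hc|].
  - rewrite (vD_scale (fun r : R => bump L r ^ S n) H t Hp HH).
    rewrite (Derive_pow (bump L) (S n) t Hb). cbn [pred].
    apply R3_eq; unfold vadd, vscale; cbn [X1 X2 X3 fst snd pow]; ring.
  - destruct HH as [h1 [h2 h3]].
    split; [|split]; cbn; apply ex_derive_mult; assumption.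
Qed.

Lemma smoothV_variation eps L d U c G : 0 < d -> open2 U ->
  (forall s t, box eps (- d) (L + d) s t -> U s t) -> smoothV U G ->
  (forall t, 0 <= t <= L -> G 0 t = c t) -> variation eps L c G.
Proof.
  intros Hd HU Hb [H1 [H2 H3]] H0.
  split; [|split; [|split; [|exact H0]]]; exists d; (split; [exact Hd|]);
    intros s t Hs Ht; [apply H1|apply H2|apply H3]; apply Hb; split; assumption.
Qed.

(* The third order zero of the bump preserves the 2-jet in t at the ends, hence
   the Frenet frame there: such variations are proper. *)
Lemma jet_at_end U L c H s t : open2 U -> smoothV U (fun _ => c) -> smoothV U H ->
  bump L t = 0 -> U s t ->
  let G := fun s t => vadd (c t) (vscale (bump L t ^ 3) (H s t)) in
  G s t = c t /\ vD (G s) t = vD c t /\ vD (vD (G s)) t = vD (vD c) t.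
Proof.
  intros HU Hc HH Hb Hu G.
  set (K := fun s t => vadd (vscale (INR 3 * Derive (bump L) t) (H s t)) (vscale (bump L t) (vD (H s) t))).
  assert (Hom := smooth2_bump U L HU).
  assert (HD := smooth2_Dt U _ Hom). cbv beta in HD.
  assert (HK : smoothV U K).
  { unfold K. apply smoothV_add; [exact HU| |].
    - apply smoothV_scale; [exact HU| |exact HH]. apply smooth2_mult; [exact HU|apply smooth2_const, HU|exact HD].
    - apply smoothV_scale; [exact HU|exact Hom|apply smoothV_Dt, HH]. }
  assert (E1 : forall s t, U s t -> vD (G s) t = vadd (vD c t) (vscale (bump L t ^ 2) (K s t))).
  { intros u w Huw. apply (vD_add_bump L 2 c (H u) w).
    - exact (smoothV_ex_t U _ u w Hc Huw).
    - exact (smoothV_ex_t U _ u w HH Huw). }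
  assert (Z : forall x y, vadd x (vscale 0 y) = x)
    by (intros; apply R3_eq; unfold vadd, vscale; cbn; ring).
  split; [|split].
  - unfold G. rewrite Hb, pow_ne_zero by lia. apply Z.
  - rewrite (E1 s t Hu), Hb, pow_ne_zero by lia. apply Z.
  - transitivity (vD (fun r => vadd (vD c r) (vscale (bump L r ^ 2) (K s r))) t).
    + apply vD_ext_loc.
      exact (open2_slice_t U (fun s t => vD (G s) t = vadd (vD c t) (vscale (bump L t ^ 2) (K s t))) s t HU E1 Hu).
    + rewrite (vD_add_bump L 1 (vD c) (K s) t).
      * rewrite Hb, pow_ne_zero by lia. apply Z.
      * exact (smoothV_ex_t U _ s t (smoothV_Dt U _ Hc) Hu).
      * exact (smoothV_ex_t U _ s t HK Hu).
Qed.

Lemma bump_0 L : bump L 0 = 0.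
Proof. unfold bump. ring. Qed.

Lemma bump_L L : bump L L = 0.
Proof. unfold bump. ring. Qed.

Lemma tube_box U L : 0 < L -> open2 U -> (forall t, 0 <= t <= L -> U 0 t) ->
  exists d, 0 < d /\ forall s t, box d (- d) (L + d) s t -> U s t.
Proof.
  intros HL HU HI. destruct (tube U 0 0 L HU HI) as [d [Hd Ht]].
  exists d. split; [exact Hd|]. intros s t [Hs Htt].
  apply Ht; [rewrite Rminus_0_r; apply Rabs_lt_between; lra|lra|lra].
Qed.

Lemma elastic_strip_force mu L c : 0 < L -> elastic_strip mu L c ->
  forall t, 0 < t < L -> vD (strip_force mu c) t = vzero.
Proof.
  intros HL [Hc Hcrit].
  destruct (frenet_curve_family L c Hc) as [Uc [HcU HcI]].
  assert (HUc : open2 Uc) by apply HcU.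
  assert (HcS : smoothV Uc (fun _ => c)) by apply HcU.
  (* Testing with the bump times F gives the vanishing of the integral of
     bump^3 |F|^2; no cutoff function is needed. *)
  set (F := vD (strip_force mu c)).
  assert (HF : smoothV Uc (fun _ => F)).
  { exact (smoothV_Dt Uc _ (smoothV_strip_force mu Uc _ HcU)). }
  set (H := fun s t => vscale s (F t)).
  assert (HH : smoothV Uc H).
  { apply smoothV_scale; [exact HUc|apply smooth2_id_s, HUc|exact HF]. }
  set (G := fun s t => vadd (c t) (vscale (bump L t ^ 3) (H s t))).
  assert (Hom := smooth2_bump Uc L HUc).
  assert (HG : smoothV Uc G).
  { apply smoothV_add; [exact HUc|exact HcS|].
    apply smoothV_scale; [exact HUc|apply smooth2_pow; assumption|exact HH]. }
  assert (G0 : G 0 = c).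
  { apply functional_extensionality. intros t. unfold G, H.
    apply R3_eq; unfold vadd, vscale; cbn; ring. }
  destruct (tube_box Uc L HL HUc HcI) as [d [Hd Hbox]].
  assert (J := fun s t Hb Hu => jet_at_end Uc L c H s t HUc HcS HH Hb Hu). cbv zeta in J. fold G in J.
  assert (Hl := interval_locally (- d) d 0 ltac:(lra)).
  assert (Jd : forall s t, - d < s < d -> 0 <= t <= L -> bump L t = 0 ->
    G s t = c t /\ vD (G s) t = vD c t /\ vD (vD (G s)) t = vD (vD c) t).
  { intros s t Hs Ht Hb. apply J; [exact Hb|]. apply Hbox. split; lra. }
  assert (SB : forall t, 0 <= t <= L -> bump L t = 0 -> strip_boundary c G t = 0).
  { intros t Ht Hb. unfold strip_boundary.
    rewrite (vD_locally_const (fun s => frenet_N (G s) t) 0 (frenet_N c t)).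
    2:{ eapply filter_imp; [|exact Hl]. intros s Hs.
        destruct (Jd s t Hs Ht Hb) as [_ [E1 E2]].
        unfold frenet_N, frenet_B, frenet_T, speed. rewrite E1, E2. reflexivity. }
    rewrite (vD_locally_const (fun s => frenet_B (G s) t) 0 (frenet_B c t)).
    2:{ eapply filter_imp; [|exact Hl]. intros s Hs.
        destruct (Jd s t Hs Ht Hb) as [_ [E1 E2]].
        unfold frenet_B. rewrite E1, E2. reflexivity. }
    rewrite (vD_locally_const (fun s => frenet_T (G s) t) 0 (frenet_T c t)).
    2:{ eapply filter_imp; [|exact Hl]. intros s Hs.
        destruct (Jd s t Hs Ht Hb) as [_ [E1 E2]].
        unfold frenet_T, speed. rewrite E1. reflexivity. }
    rewrite !(vdot_comm vzero), !vdot_vzero_r. ring. }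
  assert (Hfix : fixes_ends d L c G).
  { intros s Hs. split; apply Jd; try lra; [apply bump_0|apply bump_L]. }
  assert (Hcr : is_derive (fun s => sadowsky mu L (G s)) 0 0).
  { apply (Hcrit d G Hd). split; [|split].
    - apply smoothV_variation with d Uc; try assumption.
      intros t _. rewrite G0. reflexivity.
    - exact Hfix.
    - rewrite (SB L), (SB 0); try lra; [apply bump_0|apply bump_L]. }
  destruct (fixes_ends_vD d L c G Hd Hfix) as [W0 WL].
  assert (HUG := frenet_domain_family Uc G HUc HG).
  assert (HI : forall t, 0 <= t <= L -> frenet_domain Uc G 0 t).
  { intros t Ht. split; [apply HcI, Ht|]. rewrite G0. apply vdot_pos, (proj2 Hc t Ht). }
  assert (HD := sadowsky_variation mu L _ G HL HUG HI W0 WL).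
  rewrite G0 in HD at 1. rewrite G0 in HD at 1.
  rewrite (SB L), (SB 0) in HD; try lra; [|apply bump_0|apply bump_L].
  assert (HW : forall t, vD (fun r => G r t) 0 = vscale (bump L t ^ 3) (F t)).
  { intros t. unfold G, H, vD, vadd, vscale. apply R3_eq; cbn;
      apply is_derive_unique; (auto_derive; [exact I|ring]). }
  assert (E := is_derive_unique _ _ _ HD). rewrite (is_derive_unique _ _ _ Hcr) in E.
  assert (HR : RInt (fun t => 2 * (bump L t ^ 3 * vdot (F t) (F t))) 0 L = 0).
  { rewrite (RInt_ext _ (fun t => 2 * vdot (vD (strip_force mu (G 0)) t) (vD (fun r => G r t) 0))).
    - lra.
    - intros t _. rewrite HW, G0. fold F. unfold vdot, vscale; cbn. ring. }
  intros t Ht.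
  assert (Hb3 : forall r, 0 < r < L -> 0 < bump L r ^ 3)
    by (intros r Hr; apply pow_lt; unfold bump; nra).
  assert (Z : 2 * (bump L t ^ 3 * vdot (F t) (F t)) = 0).
  { apply (RInt_nonneg_zero (fun t => 2 * (bump L t ^ 3 * vdot (F t) (F t))) L HL); [| |exact HR|exact Ht].
    - intros r Hr. apply (smooth2_continuous_t Uc (fun _ t => 2 * (bump L t ^ 3 * vdot (F t) (F t))) 0 r);
        [|apply HcI, Hr].
      assert (HFF := smooth2_dot Uc _ _ HUc HF HF). cbv beta in HFF. smooth2_tac HUc.
    - intros r Hr. specialize (Hb3 r Hr).
      assert (0 <= vdot (F r) (F r)) by (unfold vdot; nra). nra. }
  apply NNPP. intros Hn. assert (P := vdot_pos _ Hn).
  specialize (Hb3 t Ht). change (vD (strip_force mu c) t) with (F t) in P. nra.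
Qed.

(** The test field is the Euler-Lagrange expression itself times n and the cubed bump. A straight
    displacement would leave the sphere, so each point moves along a great circle; the rational
    parametrization has initial velocity twice the test field, whence the constant 4 in the
    resulting integral. *)
Lemma spherical_elastic_EL l L c : 0 < L -> spherical_elastic l L c ->
  forall t, 0 < t < L -> spherical_EL l c t = 0.
Proof.
  intros HL [Hc [HS [Hr Hcrit]]].
  destruct (regular_curve_family L c Hc Hr) as [Uc [HcU HcI]].
  assert (HUc : open2 Uc) by apply HcU.
  assert (HcS : smoothV Uc (fun _ => c)) by apply HcU.
  set (E := spherical_EL l c). set (n := sphere_n c).
  assert (HE : smooth2 Uc (fun _ => E)) by exact (smooth2_spherical_EL l Uc _ HcU).
  assert (Hn : smoothV Uc (fun _ => n)) by exact (smoothV_sphere_n Uc _ HcU).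
  assert (Hnn := smooth2_dot Uc _ _ HUc Hn Hn). cbv beta in Hnn.
  assert (Hom := smooth2_bump Uc L HUc). assert (Hids := smooth2_id_s Uc HUc).
  (* Stereographic parametrization of the great circle through c in the direction n;
     it stays in the sphere because n is orthogonal to c, whatever its length. *)
  set (x := fun s t => (s * (bump L t ^ 3 * E t)) ^ 2 * vdot (n t) (n t)).
  assert (Hxp : forall s t, 0 <= x s t).
  { intros s t. unfold x. apply Rmult_le_pos; [apply pow2_ge_0|unfold vdot; nra]. }
  (* With p = s bump^3 E, the moved point is ((1 - x) c + 2 p n) / (1 + x). [H] is its difference
     from c with one factor bump^3 taken out, the form required by [jet_at_end]. *)
  set (H := fun s t => vscale (/ (1 + x s t))
    (vadd (vscale (2 * s * E t) (n t))
          (vscale (-2 * s ^ 2 * (bump L t ^ 3 * E t ^ 2 * vdot (n t) (n t))) (c t)))).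
  assert (HH : smoothV Uc H).
  { unfold H. apply smoothV_scale; [exact HUc| |].
    - apply smooth2_inv; [exact HUc|unfold x; smooth2_tac HUc|].
      intros s t _. specialize (Hxp s t). lra.
    - apply smoothV_add; [exact HUc| |]; (apply smoothV_scale; [exact HUc|smooth2_tac HUc|assumption]). }
  set (G := fun s t => vadd (c t) (vscale (bump L t ^ 3) (H s t))).
  assert (HG : smoothV Uc G).
  { apply smoothV_add; [exact HUc|exact HcS|].
    apply smoothV_scale; [exact HUc|apply smooth2_pow; assumption|exact HH]. }
  assert (G0 : G 0 = c).
  { apply functional_extensionality. intros t. unfold G, H.
    apply R3_eq; unfold vadd, vscale; cbn; ring. }
  assert (GS : forall s t, vdot (c t) (c t) = 1 -> vdot (G s t) (G s t) = 1).
  { intros s t Ht. specialize (Hxp s t).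
    assert (Hcn : vdot (c t) (n t) = 0) by (unfold n, sphere_n, vdot, vcross; cbn; ring).
    set (p := s * (bump L t ^ 3 * E t)).
    (* The cross term vanishes since n is orthogonal to c, and (1 - x)^2 + 4 x = (1 + x)^2. *)
    replace (vdot (G s t) (G s t)) with
      (((1 - x s t) ^ 2 * vdot (c t) (c t) + 4 * (1 - x s t) * p * vdot (c t) (n t)
        + 4 * x s t) / (1 + x s t) ^ 2).
    - rewrite Hcn, Ht. field. lra.
    - unfold G, H. set (y := x s t) in *.
      assert (Hy : y = p ^ 2 * vdot (n t) (n t)) by reflexivity.
      replace (vadd (c t) _) with (vscale (/ (1 + y)) (vadd (vscale (1 - y) (c t)) (vscale (2 * p) (n t)))).
      + transitivity (((1 - y) ^ 2 * vdot (c t) (c t) + 4 * (1 - y) * p * vdot (c t) (n t)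
          + 4 * (p ^ 2 * vdot (n t) (n t))) / (1 + y) ^ 2); [rewrite <- Hy; reflexivity|].
        unfold vdot, vadd, vscale; cbn [X1 X2 X3 fst snd]. field. lra.
      + assert (Ep : p = s * (bump L t ^ 3 * E t)) by reflexivity.
        assert (A : forall u w, u + bump L t ^ 3 * (/ (1 + y) * (2 * s * E t * w
            + -2 * s ^ 2 * (bump L t ^ 3 * E t ^ 2 * vdot (n t) (n t)) * u))
          = / (1 + y) * ((1 - y) * u + 2 * p * w)).
        { intros u w. transitivity (u + / (1 + y) * (2 * p * w - 2 * y * u)); [|field; lra].
          f_equal. rewrite Hy at 3. rewrite Ep. ring. }
        apply R3_eq; symmetry; apply A. }
  destruct (tube_box Uc L HL HUc HcI) as [d [Hd Hbox]].
  assert (J := fun s t Hb Hu => jet_at_end Uc L c H s t HUc HcS HH Hb Hu). cbv zeta in J. fold G in J.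
  assert (Hl := interval_locally (- d) d 0 ltac:(lra)).
  assert (Jd : forall s t, - d < s < d -> 0 <= t <= L -> bump L t = 0 ->
    G s t = c t /\ vD (G s) t = vD c t /\ vD (vD (G s)) t = vD (vD c) t).
  { intros s t Hs Ht Hb. apply J; [exact Hb|]. apply Hbox. split; lra. }
  assert (SB : forall t, 0 <= t <= L -> bump L t = 0 -> spherical_boundary c G t = 0).
  { intros t Ht Hb. unfold spherical_boundary.
    rewrite (vD_locally_const (fun s => frenet_T (G s) t) 0 (frenet_T c t)).
    2:{ eapply filter_imp; [|exact Hl]. intros s Hs.
        destruct (Jd s t Hs Ht Hb) as [_ [E1 _]].
        unfold frenet_T, speed. rewrite E1. reflexivity. }
    rewrite (vdot_comm vzero), vdot_vzero_r. ring. }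
  assert (Hfix : fixes_ends d L c G).
  { intros s Hs. split; apply Jd; try lra; [apply bump_0|apply bump_L]. }
  assert (Hcr : is_derive (fun s => spherical_energy l L (G s)) 0 0).
  { apply (Hcrit d G Hd). split; [|split; [|split]].
    - apply smoothV_variation with d Uc; try assumption.
      intros t _. rewrite G0. reflexivity.
    - intros s _ t Ht. apply GS, HS, Ht.
    - exact Hfix.
    - rewrite (SB L), (SB 0); try lra; [apply bump_0|apply bump_L]. }
  destruct (fixes_ends_vD d L c G Hd Hfix) as [W0 WL].
  set (V := fun s t => box d (- d) (L + d) s t).
  assert (HV : open2 V) by apply box_open.
  assert (HGV : smoothV V G) by (apply smoothV_sub with Uc; assumption).
  assert (HUG := regular_domain_family V G HV HGV).
  assert (HI : forall t, 0 <= t <= L -> regular_domain V G 0 t).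
  { intros t Ht. split; [split; lra|]. rewrite G0. apply vdot_pos, (Hr t Ht). }
  assert (HGS : forall s t, regular_domain V G s t -> 0 < t < L -> vdot (G s t) (G s t) = 1).
  { intros s t _ Ht. apply GS, HS. lra. }
  assert (HD := spherical_variation l L _ G HL HUG HI HGS W0 WL).
  rewrite G0 in HD at 1. rewrite G0 in HD at 1.
  rewrite (SB L), (SB 0) in HD; try lra; [|apply bump_0|apply bump_L].
  assert (HW : forall t, vD (fun r => G r t) 0 = vscale (2 * (bump L t ^ 3 * E t)) (n t)).
  { intros t.
    assert (A : forall u w, Derive (fun r => u + bump L t ^ 3 * (/ (1 + x r t) * (2 * r * E t * w
        + -2 * r ^ 2 * (bump L t ^ 3 * E t ^ 2 * vdot (n t) (n t)) * u))) 0
      = 2 * (bump L t ^ 3 * E t) * w).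
    { intros u w. apply is_derive_unique. unfold x.
      set (o := bump L t ^ 3). set (e := E t). set (m := vdot (n t) (n t)).
      assert (D1 : 1 + (0 * (o * e)) ^ 2 * m = 1) by ring. clearbody o e m.
      auto_derive; [|field]; simpl in D1; rewrite D1; lra. }
    apply R3_eq; apply A. }
  assert (EE := is_derive_unique _ _ _ HD). rewrite (is_derive_unique _ _ _ Hcr) in EE.
  assert (Hn1 : forall t, 0 < t < L -> vdot (n t) (n t) = 1).
  { intros t Ht.
    (* That n is a unit vector follows from T being orthogonal to c, which needs the sphere
       condition on a neighbourhood of t. *)
    set (V' := fun s t => Uc s t /\ box 1 0 L s t).
    apply (sphere_orthonormal V' (fun _ => c) 0 t).
    - split; [split; [|split]|].
      + apply open2_and; [exact HUc|apply box_open].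
      + apply smoothV_sub with Uc; [intros ? ? [? _]; assumption|exact HcS].
      + intros u w [Huw _]. apply HcU with u, Huw.
      + intros u w [_ [_ Hw]]. apply HS. lra.
    - split; [apply HcI; lra|split; lra]. }
  assert (HR : RInt (fun t => 4 * (bump L t ^ 3 * E t ^ 2)) 0 L = 0).
  { rewrite (RInt_ext _ (fun t => 2 * (spherical_EL l (G 0) t * lift G 0 t))).
    - lra.
    - rewrite Rmin_left, Rmax_right by lra. intros t Ht. unfold lift.
      rewrite HW, G0. fold E n.
      transitivity (4 * (bump L t ^ 3 * E t ^ 2) * vdot (n t) (n t)); [rewrite (Hn1 t Ht); symmetry; apply Rmult_1_r|].
      unfold vdot, vscale; cbn. ring. }
  intros t Ht.
  assert (Hb3 : forall r, 0 < r < L -> 0 < bump L r ^ 3)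
    by (intros r Hr'; apply pow_lt; unfold bump; nra).
  assert (Z : 4 * (bump L t ^ 3 * E t ^ 2) = 0).
  { apply (RInt_nonneg_zero (fun t => 4 * (bump L t ^ 3 * E t ^ 2)) L HL); [| |exact HR|exact Ht].
    - intros r Hr'. apply (smooth2_continuous_t Uc (fun _ t => 4 * (bump L t ^ 3 * E t ^ 2)) 0 r);
        [smooth2_tac HUc|apply HcI, Hr'].
    - intros r Hr'. specialize (Hb3 r Hr').
      assert (0 <= E r ^ 2) by apply pow2_ge_0. nra. }
  specialize (Hb3 t Ht). change (E t = 0). apply NNPP. intros Hz. assert (0 < E t ^ 2) by (apply pow2_gt_0, Hz). nra.
Qed.

(** * The binormal of an elastic momentum strip *)

Lemma vdot_ext x w : (forall y, vdot x y = vdot w y) -> x = w.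
Proof.
  intros H. assert (H1 := H (1, 0, 0)). assert (H2 := H (0, 1, 0)). assert (H3 := H (0, 0, 1)).
  unfold vdot in *; cbn in *. apply R3_eq; unfold X1, X2, X3 in *; lra.
Qed.

Lemma vnorm_vscale a u : vdot u u = 1 -> vnorm (vscale a u) = Rabs a.
Proof.
  intros H. unfold vnorm. replace (vdot (vscale a u) (vscale a u)) with (Rsqr a * vdot u u)
    by (unfold vdot, vscale, Rsqr; cbn; ring).
  rewrite H, Rmult_1_r. apply sqrt_Rsqr_abs.
Qed.

Lemma vD_frenet_B U G s t : frenet_family U G -> U s t ->
  vD (frenet_B (G s)) t = vscale (- twist_rate (G s) t) (frenet_N (G s) t).
Proof.
  intros H Hu. apply vdot_ext. intros y. rewrite (frenet_parseval U G s t _ y H Hu).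
  destruct (frenet_Dt U G s t H Hu) as [_ [_ [_ [_ [_ [_ [-> [-> ->]]]]]]]].
  rewrite (vdot_comm y (frenet_N (G s) t)). unfold vdot, vscale; cbn. ring.
Qed.

Lemma eq_on_const_Derive a b f k : eq_on a b f (fun _ => k) -> eq_on a b (Derive f) (fun _ => 0).
Proof. intros H t Ht. rewrite (eq_on_Derive _ _ _ _ H t Ht). apply Derive_const. Qed.

(** From B' = - p N the speed of B is |p|; the sign [sg] turns this into the smooth expression
    [sg * twist_rate]. In the determinant the derivative of p drops out, leaving p^2 <B x N, N'> = -
    p^2 <T, N'> = p^2 q. *)
Lemma binormal_geometry U c L sg : frenet_family U (fun _ => c) ->
  (forall t, 0 < t < L -> U 0 t) -> sg * sg = 1 -> (forall t, 0 < t < L -> 0 < sg * twist_rate c t) ->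
  eq_on 0 L (speed (frenet_B c)) (fun t => sg * twist_rate c t) /\
  eq_on 0 L (geod_curvature (frenet_B c)) (fun t => bend_rate c t / (sg * twist_rate c t)).
Proof.
  intros H HI Hsg Hp. assert (HU : open2 U) by apply H.
  assert (E1 : eq_on 0 L (vD (frenet_B c)) (fun r => vscale (- twist_rate c r) (frenet_N c r))).
  { intros t Ht. apply (vD_frenet_B U (fun _ => c) 0 t H (HI t Ht)). }
  assert (Es : eq_on 0 L (speed (frenet_B c)) (fun t => sg * twist_rate c t)).
  { intros t Ht. unfold speed. rewrite (E1 t Ht), vnorm_vscale.
    - rewrite Rabs_Ropp. specialize (Hp t Ht).
      assert (sg = 1 \/ sg = -1) as [-> | ->] by nra.
      + rewrite Rabs_pos_eq; lra.
      + rewrite Rabs_left; lra.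
    - apply (frenet_orthonormal U (fun _ => c) 0 t H (HI t Ht)). }
  split; [exact Es|].
  intros t Ht. unfold geod_curvature, vdet. rewrite (Es t Ht), (E1 t Ht), (eq_on_vD _ _ _ _ E1 t Ht).
  assert (Hf : smooth2 U (fun _ t => - twist_rate c t)) by (apply smooth2_opp; [exact HU|exact (smooth2_twist_rate U _ H)]).
  rewrite (vD_scale (fun r => - twist_rate c r) (frenet_N c)).
  - destruct (frenet_orthonormal U (fun _ => c) 0 t H (HI t Ht)) as [O1 [O2 [O3 [O4 [O5 O6]]]]].
    destruct (frenet_Dt U (fun _ => c) 0 t H (HI t Ht)) as [_ [_ [_ [D4 _]]]].
    cbv beta in *. unfold frenet_N in *. set (B := frenet_B c t) in *. set (T := frenet_T c t) in *.
    set (N' := vD (fun t => vcross (frenet_B c t) (frenet_T c t)) t) in *.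
    change (vD (frenet_N c) t) with N'. fold B T.
    set (p := twist_rate c t) in *. set (q := bend_rate c t) in *. set (p' := Derive _ t).
    replace (vdot _ _) with (p ^ 2 * (vdot T B * vdot B N' - vdot B B * vdot N' T))
      by (unfold vdot, vcross, vadd, vscale; cbn; ring).
    rewrite O5, O3, D4. specialize (Hp t Ht). fold p in Hp.
    assert (p <> 0) by (intros Z; rewrite Z in Hp; lra).
    assert (sg <> 0) by (intros Z; rewrite Z in Hp; lra).
    replace (p ^ 2) with ((sg * sg) * p ^ 2) by (rewrite Hsg; ring).
    field. split; assumption.
  - exact (smooth2_ex_derive_t U _ 0 t Hf (HI t Ht)).
  - exact (smoothV_ex_t U _ 0 t (smoothV_N U _ H) (HI t Ht)).
Qed.

(* The N-component of the conservation of the force vector is the Euler-Lagrange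
   equation of the binormal. *)
Lemma binormal_EL mu L c a : 0 < L -> frenet_curve L c -> a <> 0 ->
  (forall t, 0 <= t <= L -> s1 c t = a) ->
  (forall t, 0 < t < L -> vD (strip_force mu c) t = vzero) ->
  (forall t, 0 <= t <= L -> vD (frenet_B c) t <> vzero) /\
  forall t, 0 < t < L -> spherical_EL (- ((2 / a) ^ 2 * mu)) (frenet_B c) t = 0.
Proof.
  intros HL Hc Ha Hs HF.
  destruct (frenet_curve_family L c Hc) as [U [H HI]].
  assert (HU : open2 U) by apply H.
  assert (Hv : forall t, 0 <= t <= L -> 0 < speed c t).
  { intros t Ht. apply (speed_pos U (fun _ => c) 0 t (frenet_family_regular _ _ H) (HI t Ht)). }
  assert (Hq : forall t, 0 <= t <= L -> 0 < bend_rate c t).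
  { intros t Ht. apply (bend_rate_pos U (fun _ => c) 0 t H (HI t Ht)). }
  assert (Hk : forall t, 0 <= t <= L -> curvature c t = bend_rate c t / speed c t).
  { intros t Ht. apply (curvature_bend_rate U (fun _ => c) 0 t H (HI t Ht)). }
  assert (Hl : forall t, 0 <= t <= L -> mod_torsion c t = twist_rate c t / bend_rate c t).
  { intros t Ht. apply (mod_torsion_rates U (fun _ => c) 0 t H (HI t Ht)). }
  (* The condition s1 = a expresses the speed by the rates. It also shows that the twist rate has
     the sign of a and never vanishes, so that the binormal is a regular curve. *)
  assert (Hspeed : forall t, 0 <= t <= L ->
    a * speed c t = 2 * twist_rate c t * (1 + (twist_rate c t / bend_rate c t) ^ 2)).
  { intros t Ht. rewrite <- (Hs t Ht). unfold s1. rewrite (Hk t Ht), (Hl t Ht).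
    specialize (Hv t Ht). specialize (Hq t Ht). field. lra. }
  set (sg := if Rlt_dec 0 a then 1 else -1).
  assert (Hsg : sg * sg = 1) by (unfold sg; destruct Rlt_dec; ring).
  assert (Hsa : 0 < sg * a) by (unfold sg; destruct Rlt_dec; [lra|destruct (Rdichotomy _ _ Ha); lra]).
  assert (Hp : forall t, 0 <= t <= L -> 0 < sg * twist_rate c t).
  { intros t Ht. assert (E := Hspeed t Ht). specialize (Hv t Ht).
    assert (0 <= (twist_rate c t / bend_rate c t) ^ 2) by apply pow2_ge_0.
    apply (Rmult_lt_reg_r (2 * (1 + (twist_rate c t / bend_rate c t) ^ 2))); [lra|].
    rewrite Rmult_0_l. replace (sg * twist_rate c t * (2 * (1 + (twist_rate c t / bend_rate c t) ^ 2)))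
      with (sg * a * speed c t) by (rewrite Rmult_assoc, E; ring). nra. }
  split.
  { intros t Ht. rewrite (vD_frenet_B U (fun _ => c) 0 t H (HI t Ht)). intros Z.
    destruct (frenet_orthonormal U (fun _ => c) 0 t H (HI t Ht)) as [_ [O2 _]].
    assert (twist_rate c t = 0).
    { transitivity (- vdot (vscale (- twist_rate c t) (frenet_N c t)) (frenet_N c t)).
      - replace (vdot _ _) with (- twist_rate c t * vdot (frenet_N c t) (frenet_N c t))
          by (unfold vdot, vscale; cbn; ring). rewrite O2. ring.
      - rewrite Z. rewrite vdot_comm, vdot_vzero_r. ring. }
    specialize (Hp t Ht). rewrite H0 in Hp. lra. }
  assert (HIo : forall t, 0 < t < L -> U 0 t) by (intros t Ht; apply HI; lra).
  assert (Hpo : forall t, 0 < t < L -> 0 < sg * twist_rate c t) by (intros t Ht; apply Hp; lra).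
  destruct (binormal_geometry U c L sg H HIo Hsg Hpo) as [Es Ek].
  set (kk := fun t => bend_rate c t / (sg * twist_rate c t)) in *.
  assert (Hsc : smooth2 U (fun _ t => sg * twist_rate c t)).
  { apply smooth2_mult; [exact HU|apply smooth2_const, HU|exact (smooth2_twist_rate U _ H)]. }
  (* [kk] is the geodesic curvature of the binormal as a quotient of rates; it is smooth where its
     denominator is positive. *)
  set (U' := fun s t => U s t /\ 0 < sg * twist_rate c t).
  assert (HU' : open2 U') by exact (open2_pos U _ HU Hsc).
  assert (HI' : forall t, 0 < t < L -> U' 0 t) by (intros t Ht; split; auto).
  assert (Hkk : smooth2 U' (fun _ => kk)).
  { unfold kk. apply smooth2_div; [exact HU'| | |].
    - apply smooth2_sub with U; [intros ? ? [? _]; assumption|exact (smooth2_bend_rate U _ H)].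
    - apply smooth2_sub with U; [intros ? ? [? _]; assumption|exact Hsc].
    - intros s t [_ h]. lra. }
  assert (Hkp : forall t, 0 < t < L -> 0 < kk t).
  { intros t Ht. unfold kk. apply Rdiv_lt_0_compat; [apply Hq; lra|apply Hpo, Ht]. }
  assert (Ek' := eq_on_Derive _ _ _ _ Ek).
  set (arc := fun t => Derive kk t / (sg * twist_rate c t)).
  assert (Ea : eq_on 0 L (arc_Dk (frenet_B c)) arc).
  { intros t Ht. unfold arc_Dk, arc. rewrite (Ek' t Ht), (Es t Ht). reflexivity. }
  assert (Ha' : smooth2 U' (fun _ => arc)).
  { unfold arc. apply smooth2_div; [exact HU'|exact (smooth2_Dt U' _ Hkk)| |].
    - apply smooth2_sub with U; [intros ? ? [? _]; assumption|exact Hsc].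
    - intros s t [_ h]. lra. }
  assert (Eq1 : forall t, 0 < t < L -> bend_rate c t = kk t * (sg * twist_rate c t)).
  { intros t Ht. unfold kk. specialize (Hpo t Ht). field. split; intros Z; rewrite Z in Hpo; lra. }
  assert (Ev1 : forall t, 0 < t < L -> speed c t = 2 * twist_rate c t * (1 + 1 / kk t ^ 2) / a).
  { intros t Ht. assert (E := Hspeed t ltac:(lra)). rewrite (Eq1 t Ht) in E.
    specialize (Hpo t Ht). specialize (Hkp t Ht).
    assert (twist_rate c t <> 0) by (intros Z; rewrite Z in Hpo; lra).
    assert (sg <> 0) by (intros Z; rewrite Z in Hpo; lra).
    replace ((twist_rate c t / (kk t * (sg * twist_rate c t))) ^ 2) with (1 / ((sg * sg) * kk t ^ 2)) in E
      by (field; repeat split; try assumption; lra).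
    rewrite Hsg, Rmult_1_l in E. rewrite <- E. field. exact Ha. }
  assert (E2 : eq_on 0 L (s2 c) (fun _ => 0)).
  { intros t Ht. unfold s2. rewrite (eq_on_const_Derive 0 L (s1 c) a); [|intros r Hr; apply Hs; lra|exact Ht].
    unfold Rdiv. ring. }
  (* Since lambda = sg / k, the condition 2 kappa lambda (1 + lambda^2) = a gives kappa (1 +
     lambda^2) = a sg k / 2. Everything is thus expressed by k, p and a. *)
  assert (Ekl : forall t, 0 < t < L ->
    curvature c t * (1 + mod_torsion c t ^ 2) = a * sg * kk t / 2 /\
    mod_torsion c t ^ 2 = 1 / kk t ^ 2).
  { intros t Ht. rewrite (Hk t), (Hl t) by lra. assert (E := Ev1 t Ht).
    assert (E' := Eq1 t Ht). specialize (Hpo t Ht). specialize (Hkp t Ht).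
    assert (twist_rate c t <> 0) by (intros Z; rewrite Z in Hpo; lra).
    assert (sg <> 0) by (intros Z; rewrite Z in Hpo; lra).
    assert (Hr : (twist_rate c t / bend_rate c t) ^ 2 = 1 / kk t ^ 2).
    { rewrite E'. replace ((twist_rate c t / (kk t * (sg * twist_rate c t))) ^ 2) with (1 / ((sg * sg) * kk t ^ 2))
        by (field; repeat split; try assumption; lra). rewrite Hsg, Rmult_1_l. reflexivity. }
    rewrite Hr. split; [|reflexivity]. rewrite E, E'.
    assert (0 < kk t ^ 2) by (apply pow_lt; lra).
    field. repeat split; try assumption; nra. }
  assert (E3 : eq_on 0 L (s3 c) (fun t => a * sg / 2 * (kk t - 1 / kk t))).
  { intros t Ht. destruct (Ekl t Ht) as [A1 A2]. unfold s3. rewrite A1, A2.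
    specialize (Hkp t Ht). field. lra. }
  assert (Xkk : forall t, 0 < t < L -> ex_derive kk t)
    by (intros t Ht; exact (smooth2_ex_derive_t U' _ 0 t Hkk (HI' t Ht))).
  assert (E3' : forall t, 0 < t < L -> Derive (s3 c) t = a * sg / 2 * (Derive kk t * (1 + 1 / kk t ^ 2))).
  { intros t Ht. rewrite (eq_on_Derive _ _ _ _ E3 t Ht). specialize (Xkk t Ht). specialize (Hkp t Ht).
    clearbody kk. apply is_derive_unique. auto_derive.
    - repeat split; try assumption. lra.
    - change (fun x => kk x) with kk. field. lra. }
  (* As s2 = 0, this component is s3' / v. The factor 1 + 1 / k^2 of s3' cancels against that of v,
     leaving the derivative of k by the arclength of the binormal. The constant a^2 / 4 later
     rescales mu to (2 / a)^2 mu. *)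
  assert (HN : eq_on 0 L (fun t => vdot (strip_force mu c t) (frenet_N c t))
                         (fun t => a ^ 2 / 4 * arc t)).
  { intros t Ht. destruct (strip_force_dot mu U (fun _ => c) 0 t H (HIo t Ht)) as [_ [FN _]].
    etransitivity; [exact FN|]. rewrite (E2 t Ht), (E3' t Ht), (Ev1 t Ht).
    unfold arc. specialize (Hpo t Ht). specialize (Hkp t Ht).
    assert (twist_rate c t <> 0) by (intros Z; rewrite Z in Hpo; lra).
    assert (sg <> 0) by (intros Z; rewrite Z in Hpo; lra).
    replace (a ^ 2 / 4 * (Derive kk t / (sg * twist_rate c t)))
      with (a ^ 2 / 4 * ((sg * sg) * Derive kk t / (sg * twist_rate c t))) by (rewrite Hsg; field; split; assumption).
    assert (0 < kk t ^ 2) by (apply pow_lt; lra).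
    field. repeat split; try assumption; nra. }
  intros t Ht. assert (Ht' : 0 <= t <= L) by lra.
  (* The force F is constant, so <F, N>' = <F, N'>; its T and B components, paired with - q and p,
     supply the terms of order zero. *)
  assert (HD : a ^ 2 / 4 * Derive arc t = vdot (strip_force mu c t) (vD (frenet_N c) t)).
  { assert (D1 := eq_on_Derive _ _ _ _ HN t Ht).
    rewrite Derive_scal in D1. rewrite <- D1.
    rewrite (Derive_dot (strip_force mu c) (frenet_N c)).
    - rewrite (HF t Ht), (vdot_comm vzero), vdot_vzero_r. ring.
    - exact (smoothV_ex_t U _ 0 t (smoothV_strip_force mu U _ H) (HIo t Ht)).
    - exact (smoothV_ex_t U _ 0 t (smoothV_N U _ H) (HIo t Ht)). }
  rewrite (frenet_parseval U (fun _ => c) 0 t _ _ H (HIo t Ht)) in HD.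
  destruct (frenet_Dt U (fun _ => c) 0 t H (HIo t Ht)) as [_ [_ [_ [D4 [D5 [D6 _]]]]]].
  destruct (strip_force_dot mu U (fun _ => c) 0 t H (HIo t Ht)) as [FT [_ FB]].
  cbv beta in *. rewrite FT, FB, D4, D5, D6 in HD.
  rewrite (eq_on_const_Derive 0 L (s2 c) 0 E2 t Ht), (Hs t Ht'), (E3 t Ht) in HD.
  destruct (Ekl t Ht) as [A1 A2].
  rewrite <- (Rpow_mult_distr (curvature c t)), A1, (Ev1 t Ht), (Eq1 t Ht) in HD.
  unfold spherical_EL. rewrite (eq_on_Derive _ _ _ _ Ea t Ht), (Es t Ht), (Ek t Ht). fold (kk t).
  specialize (Hpo t Ht). specialize (Hkp t Ht).
  assert (Hp0 : twist_rate c t <> 0) by (intros Z; rewrite Z in Hpo; lra).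
  assert (0 < kk t ^ 2) by (apply pow_lt; lra).
  set (p := twist_rate c t) in *. set (k := kk t) in *. change (bend_rate c t / (sg * p)) with k.
  set (X := Derive arc t) in *. clearbody p k X.
  assert (HX : X = - (sg * p) * (((sg * sg) * k ^ 3) / 2 + (1 + 2 * mu / a ^ 2) * k)).
  { apply (Rmult_eq_reg_l (a ^ 2 / 4)); [|nra]. rewrite HD. field. repeat split; try assumption; try nra. }
  rewrite HX, Hsg. field. exact Ha.
Qed.

Lemma elastic_momentum_binormal mu L c : 0 < L -> elastic_momentum_strip mu L c ->
  spherical_elastic (- ((2 / s1 c 0) ^ 2 * mu)) L (frenet_B c).
Proof.
  intros HL [[Hc [a [Ha Hs]]] Hel].
  rewrite (Hs 0) by lra.
  destruct (binormal_EL mu L c a HL Hc Ha Hs (elastic_strip_force mu L c HL Hel)) as [Hr HE].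
  destruct (frenet_curve_family L c Hc) as [U [H HI]].
  apply spherical_elastic_of_EL; try assumption.
  - apply (smoothV_curve U); [exact HL|apply H|exact HI|exact (smoothV_B U _ H)].
  - intros t Ht. apply (frenet_orthonormal U (fun _ => c) 0 t H (HI t Ht)).
Qed.

(** * The strip over a spherical elastic curve *)

(** The Frenet frame has positive curvature by convention, whereas a geodesic curvature may be
    negative; the constant sign [sg] reconciles the two without absolute values. *)
Lemma constant_sign f L : 0 < L -> (forall t, 0 <= t <= L -> continuous f t) ->
  (forall t, 0 <= t <= L -> f t <> 0) ->
  exists sg, sg * sg = 1 /\ forall t, 0 <= t <= L -> 0 < sg * f t.
Proof.
  intros HL Hc Hn.
  assert (K : forall g, (forall t, 0 <= t <= L -> continuous g t) ->
    (forall t, 0 <= t <= L -> g t <> 0) -> 0 < g 0 -> forall t, 0 <= t <= L -> 0 < g t).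
  { intros g Hg Hgn H0 t Ht. apply NNPP. intros Hneg.
    assert (Hgt := Hgn t Ht).
    assert (0 < t).
    { destruct (Req_dec t 0) as [Z|Z]; [rewrite Z in Hneg; contradiction|lra]. }
    (* The sign is reversed because this form of the intermediate value theorem starts from a
       negative value. *)
    destruct (IVT_interv (fun r => - g r) 0 t) as [z [Hz1 Hz2]].
    - intros r Hr. apply continuity_pt_opp. apply continuity_pt_filterlim, Hg. lra.
    - assumption.
    - lra.
    - destruct (Rdichotomy _ _ Hgt); lra.
    - apply (Hgn z); lra. }
  destruct (Rdichotomy _ _ (Hn 0 ltac:(lra))) as [H0|H0].
  - exists (-1). split; [ring|]. intros t Ht. replace (-1 * f t) with (- f t) by ring.
    apply (K (fun r => - f r)); [| |lra|exact Ht].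
    + intros r Hr. apply (continuous_opp f), Hc, Hr.
    + intros r Hr Z. apply (Hn r Hr). lra.
  - exists 1. split; [ring|]. intros t Ht. rewrite Rmult_1_l. apply K; assumption.
Qed.

(** One differentiation of [f] lands among smooth functions, so adjoining [f] to them gives a stable
    class. *)
Lemma smooth2_antiderivative U f g : open2 U -> smooth2 U (fun _ t => g t) ->
  (forall s t, U s t -> is_derive f t (g t)) -> smooth2 U (fun _ t => f t).
Proof.
  intros HU Hg Hf.
  apply (smooth2_coind U (fun h => h = (fun _ t => f t) \/ smooth2 U h) HU); [|now left].
  intros h [-> | Hh].
  - split.
    + intros s t Hu. apply (continuity_1d_2d_pt_comp f (fun _ v => v)).
      * apply continuity_pt_filterlim, (@ex_derive_continuous R_AbsRing R_NormedModule).
        exists (g t). exact (Hf s t Hu).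
      * apply continuity_2d_pt_id2.
    + exists (fun _ _ => 0), (fun _ t => g t).
      split; [right; apply smooth2_const, HU|]. split; [right; exact Hg|].
      intros s t Hu. split; [apply @is_derive_const|exact (Hf s t Hu)].
  - split; [intros s t; apply smooth2_cont, Hh|].
    exists (fun s t => Derive (fun z => h z t) s), (fun s t => Derive (h s) t).
    split; [right; apply smooth2_Ds, Hh|]. split; [right; apply smooth2_Dt, Hh|].
    intros s t Hu. split; apply Derive_correct.
    + eapply smooth2_ex_derive_s; eassumption.
    + exact (smooth2_ex_derive_t U h s t Hh Hu).
Qed.

Lemma is_derive_RInt_smooth U d L g t : 0 < d -> 0 < L ->
  (forall s t, box d (- d) (L + d) s t -> U s t) -> smooth2 U (fun _ t => g t) ->
  - d < t < L + d -> is_derive (fun r => RInt g 0 r) t (g t).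
Proof.
  intros Hd HL HU Hg Ht.
  assert (Hc : forall r, - d < r < L + d -> continuous g r).
  { intros r Hr. apply (smooth2_continuous_t U (fun _ => g) 0 r Hg), HU. split; lra. }
  apply is_derive_RInt with 0; [|apply Hc, Ht].
  eapply filter_imp; [|exact (interval_locally _ _ _ Ht)]. intros r Hr. cbv beta in Hr.
  apply (RInt_correct (V := R_CompleteNormedModule)).
  apply (ex_RInt_continuous (V := R_CompleteNormedModule)).
  intros z Hz. apply Hc. revert Hz. unfold Rmin, Rmax. destruct Rle_dec; lra.
Qed.

Lemma vRInt_smooth U c L : 0 < L -> open2 U -> (forall t, 0 <= t <= L -> U 0 t) ->
  smoothV U (fun _ => c) ->
  exists d, 0 < d /\ smoothV (box d (- d) (L + d)) (fun _ t => vRInt c 0 t) /\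
    forall t, - d < t < L + d -> vD (fun r => vRInt c 0 r) t = c t.
Proof.
  intros HL HU HI [H1 [H2 H3]]. destruct (tube_box U L HL HU HI) as [d [Hd Hb]].
  assert (D1 := fun t => is_derive_RInt_smooth U d L _ t Hd HL Hb H1).
  assert (D2 := fun t => is_derive_RInt_smooth U d L _ t Hd HL Hb H2).
  assert (D3 := fun t => is_derive_RInt_smooth U d L _ t Hd HL Hb H3).
  exists d. split; [exact Hd|]. split.
  - split; [|split].
    + apply (smooth2_antiderivative _ _ (fun t => X1 (c t)) (box_open _ _ _));
        [exact (smooth2_sub _ _ _ Hb H1)|intros s t [_ Ht]; exact (D1 t Ht)].
    + apply (smooth2_antiderivative _ _ (fun t => X2 (c t)) (box_open _ _ _));
        [exact (smooth2_sub _ _ _ Hb H2)|intros s t [_ Ht]; exact (D2 t Ht)].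
    + apply (smooth2_antiderivative _ _ (fun t => X3 (c t)) (box_open _ _ _));
        [exact (smooth2_sub _ _ _ Hb H3)|intros s t [_ Ht]; exact (D3 t Ht)].
  - intros t Ht. apply R3_eq; apply is_derive_unique; [apply D1|apply D2|apply D3]; exact Ht.
Qed.

(** The structure equations of the frame (c, T, n) in unit speed, c' = T, T' = k n - c, n' = - k T.
    They are restricted to the open interval because sphere condition and unit speed are given on
    [0, L] only. *)
Lemma unit_sphere_structure L c : 0 < L -> smooth_curve L c -> spherical_curve L c ->
  (forall t, 0 <= t <= L -> speed c t = 1) ->
  forall t, 0 < t < L ->
    vdot (frenet_T c t) (frenet_T c t) = 1 /\ vdot (c t) (c t) = 1 /\
    vdot (frenet_T c t) (c t) = 0 /\
    vD c t = frenet_T c t /\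
    vD (frenet_T c) t = vadd (vscale (geod_curvature c t) (sphere_n c t)) (vscale (-1) (c t)) /\
    vD (sphere_n c) t = vscale (- geod_curvature c t) (frenet_T c t).
Proof.
  intros HL Hc HS Hv.
  assert (Hr : forall t, 0 <= t <= L -> vD c t <> vzero).
  { intros t Ht Z. assert (E := Hv t Ht). unfold speed in E.
    assert (E2 := vnorm_sqr (vD c t)). rewrite E, Z, vdot_vzero_r in E2. lra. }
  destruct (regular_curve_family L c Hc Hr) as [U [H HI]].
  set (V := fun s t => U s t /\ box 1 0 L s t).
  assert (HV : sphere_family V (fun _ => c)).
  { split; [split; [|split]|].
    - apply open2_and; [apply H|apply box_open].
    - apply smoothV_sub with U; [intros ? ? [? _]; assumption|apply H].
    - intros u w [Huw _]. apply H with u, Huw.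
    - intros u w [_ [_ Hw]]. apply HS. lra. }
  intros t Ht. assert (Hu : V 0 t) by (split; [apply HI|split]; lra).
  destruct (sphere_orthonormal V (fun _ => c) 0 t HV Hu) as [O1 [O2 [O3 [O4 [O5 O6]]]]].
  destruct (sphere_Dt V (fun _ => c) 0 t HV Hu) as [D1 [D2 [D3 [D4 [D5 D6]]]]].
  assert (P := fun x y => sphere_parseval V (fun _ => c) 0 t x y HV Hu).
  assert (Ek := geod_curvature_rate V (fun _ => c) 0 t HV Hu).
  assert (Ht' : 0 <= t <= L) by lra.
  cbv beta in *. rewrite (Hv t Ht') in D2, Ek.
  assert (Ek' : geod_rate c t = geod_curvature c t) by lra.
  split; [exact O1|]. split; [exact O2|]. split; [exact O4|]. split; [|split].
  - rewrite (vD_speed_T V (fun _ => c) 0 t (proj1 HV) Hu), (Hv t Ht').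
    unfold vscale. apply R3_eq; cbn [X1 X2 X3 fst snd]; ring.
  - apply vdot_ext. intros y. rewrite P, D1, D2, D3, Ek', (vdot_comm y (c t)), (vdot_comm y (sphere_n c t)).
    unfold vdot, vadd, vscale; cbn [X1 X2 X3 fst snd]; ring.
  - apply vdot_ext. intros y. rewrite P, D4, D5, D6, Ek', (vdot_comm y (frenet_T c t)).
    unfold vdot, vadd, vscale; cbn [X1 X2 X3 fst snd]; ring.
Qed.

(** The derivative of [c] is m n with m = 1 + 1 / k^2, so its Frenet frame is (n, - sg T, sg b),
    where T = b'. The twist rate is 1 as b has unit speed, and the bend rate is |k|; hence lambda =
    1 / |k| and 1 + lambda^2 = m. The speed m is thus the one that makes s1 = 2 (1 + lambda^2) / m
    constant. *)
Lemma strip_over_spherical_curve mu L b c : 0 < L -> spherical_elastic (- mu) L b ->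
  (forall t, 0 <= t <= L -> speed b t = 1) ->
  (forall t, 0 <= t <= L -> geod_curvature b t <> 0) ->
  smooth_curve L c ->
  (forall t, 0 <= t <= L ->
     vD c t = vscale (1 + 1 / geod_curvature b t ^ 2) (vcross (b t) (vD b t))) ->
  elastic_momentum_strip mu L c /\
  sadowsky mu L c = RInt (fun t => 1 + geod_curvature b t ^ 2) 0 L - mu * curve_length L c.
Proof.
  intros HL Hel Hv Hk Hc HDc.
  assert (HE := spherical_elastic_EL (- mu) L b HL Hel).
  destruct Hel as [Hb [HS [Hr _]]].
  assert (HST := unit_sphere_structure L b HL Hb HS Hv).
  destruct (regular_curve_family L b Hb Hr) as [U0 [HU0 HI0]].
  set (k := geod_curvature b) in *.
  assert (Hks0 : smooth2 U0 (fun _ => k)) by exact (smooth2_geod U0 _ HU0).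
  set (U := fun s t => U0 s t /\ 0 < k t ^ 2).
  assert (HU : open2 U).
  { apply (open2_pos U0 (fun _ t => k t ^ 2)); [apply HU0|]. apply smooth2_pow; [apply HU0|exact Hks0]. }
  assert (HI : forall t, 0 <= t <= L -> U 0 t).
  { intros t Ht. split; [apply HI0, Ht|apply pow2_gt_0, Hk, Ht]. }
  assert (HUU : forall s t, U s t -> U0 s t) by (intros s t [h _]; exact h).
  assert (Hks : smooth2 U (fun _ => k)) by exact (smooth2_sub _ _ _ HUU Hks0).
  assert (Hbs : smoothV U (fun _ => b)) by (apply smoothV_sub with U0; [exact HUU|apply HU0]).
  set (m := fun t => 1 + 1 / k t ^ 2).
  assert (Hms : smooth2 U (fun _ => m)).
  { unfold m. apply smooth2_plus; [exact HU|apply smooth2_const, HU|].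
    apply smooth2_div; [exact HU|apply smooth2_const, HU|apply smooth2_pow; assumption|].
    intros s t [_ h]. lra. }
  assert (Hm : forall t, 0 <= t <= L -> 0 < m t).
  { intros t Ht. unfold m. assert (0 < k t ^ 2) by (apply pow2_gt_0, Hk, Ht).
    assert (0 < 1 / k t ^ 2) by (apply Rdiv_lt_0_compat; lra). lra. }
  set (T := frenet_T b) in *. set (n := sphere_n b) in *.
  assert (HTs : smoothV U (fun _ => T))
    by (apply smoothV_sub with U0; [exact HUU|exact (smoothV_T U0 _ HU0)]).
  assert (Hns : smoothV U (fun _ => n))
    by (apply smoothV_sub with U0; [exact HUU|exact (smoothV_sphere_n U0 _ HU0)]).
  destruct (constant_sign k L HL) as [sg [Hsg Hsk]].
  { intros t Ht. exact (smooth2_continuous_t U (fun _ => k) 0 t Hks (HI t Ht)). }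
  { exact Hk. }
  assert (Hsg0 : sg <> 0) by (intros Z; rewrite Z in Hsg; lra).
  assert (HIo : forall t, 0 < t < L -> U 0 t) by (intros t Ht; apply HI; lra).
  assert (Xk : forall t, 0 < t < L -> ex_derive k t)
    by (intros t Ht; exact (smooth2_ex_derive_t U _ 0 t Hks (HIo t Ht))).
  assert (Xm : forall t, 0 < t < L -> ex_derive m t)
    by (intros t Ht; exact (smooth2_ex_derive_t U _ 0 t Hms (HIo t Ht))).
  assert (Xb : forall t, 0 < t < L -> ex_vD b t)
    by (intros t Ht; exact (smoothV_ex_t U _ 0 t Hbs (HIo t Ht))).
  assert (XT : forall t, 0 < t < L -> ex_vD T t)
    by (intros t Ht; exact (smoothV_ex_t U _ 0 t HTs (HIo t Ht))).
  assert (Xn : forall t, 0 < t < L -> ex_vD n t)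
    by (intros t Ht; exact (smoothV_ex_t U _ 0 t Hns (HIo t Ht))).
  assert (F1 : eq_on 0 L (vD c) (fun t => vscale (m t) (n t))).
  { intros t Ht. destruct (HST t Ht) as [_ [_ [_ [E _]]]].
    rewrite (HDc t) by lra. rewrite E. reflexivity. }
  (* The derivative of m n is m' n - m k T, and n x T = - b because n = b x T. *)
  assert (F2 : forall t, 0 < t < L ->
    vcross (vD c t) (vD (vD c) t) = vscale (m t ^ 2 * k t) (b t)).
  { intros t Ht. destruct (HST t Ht) as [O1 [O2 [O4 [_ [_ E]]]]].
    rewrite (eq_on_vD _ _ _ _ F1 t Ht), (F1 t Ht), (vD_scale m n t (Xm t Ht) (Xn t Ht)), E.
    unfold n, sphere_n. fold T. fold (k t).
    apply vdot_ext. intros y.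
    transitivity (m t ^ 2 * k t * (vdot (T t) (T t) * vdot (b t) y - vdot (T t) (b t) * vdot (T t) y));
      [|rewrite O1, O4]; unfold vdot, vadd, vscale, vcross; cbn [X1 X2 X3 fst snd]; ring. }
  destruct (smooth_curve_smoothV L c Hc) as [dc [Hdc Hcs]].
  (* A Frenet curve has to be nondegenerate at the ends too, so the identity is extended by
     continuity. *)
  assert (F2c : forall t, 0 <= t <= L ->
    vcross (vD c t) (vD (vD c) t) = vscale (m t ^ 2 * k t) (b t)).
  { apply (smoothV_eq_closed (box 1 (- dc) (L + dc)) U
      (fun _ t => vcross (vD c t) (vD (vD c) t)) (fun _ t => vscale (m t ^ 2 * k t) (b t)) L HL).
    - exact (smoothV_osculating _ _ (box_open _ _ _) Hcs).
    - apply smoothV_scale; [exact HU|smooth2_tac HU|exact Hbs].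
    - intros t Ht. split; lra.
    - exact HI.
    - exact F2. }
  assert (Hfr : frenet_curve L c).
  { split; [exact Hc|]. intros t Ht.
    assert (P : 0 < vdot (vcross (vD c t) (vD (vD c) t)) (vcross (vD c t) (vD (vD c) t))).
    { rewrite (F2c t Ht).
      replace (vdot _ _) with ((m t ^ 2 * k t) ^ 2 * vdot (b t) (b t))
        by (unfold vdot, vscale; cbn [X1 X2 X3 fst snd]; ring).
      rewrite (HS t Ht), Rmult_1_r. apply pow2_gt_0.
      apply Rmult_integral_contrapositive. split; [|apply Hk, Ht].
      apply pow_nonzero. specialize (Hm t Ht). lra. }
    split; [apply vdot_pos_neq, (vcross_pos _ _ P)|apply vdot_pos_neq, P]. }
  destruct (frenet_curve_family L c Hfr) as [W [HW HWI]].
  assert (HWo : forall t, 0 < t < L -> W 0 t) by (intros t Ht; apply HWI; lra).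
  assert (Gv : eq_on 0 L (speed c) m).
  { intros t Ht. unfold speed. rewrite (F1 t Ht), vnorm_vscale.
    - apply Rabs_pos_eq. left. apply Hm. lra.
    - destruct (HST t Ht) as [O1 [O2 [O4 _]]]. unfold n, sphere_n. fold T.
      transitivity (vdot (T t) (T t) * vdot (b t) (b t) - vdot (T t) (b t) ^ 2);
        [unfold vdot, vcross; cbn [X1 X2 X3 fst snd]; ring|rewrite O1, O2, O4; ring]. }
  assert (GT : eq_on 0 L (frenet_T c) n).
  { intros t Ht. unfold frenet_T. rewrite (Gv t Ht), (F1 t Ht).
    assert (0 < m t) by (apply Hm; lra).
    apply R3_eq; unfold vscale; cbn [X1 X2 X3 fst snd]; field; lra. }
  (* Normalizing m^2 k b divides by m^2 |k|, so the Frenet binormal is b or - b according to the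
     sign of k. *)
  assert (GB : eq_on 0 L (frenet_B c) (fun t => vscale sg (b t))).
  { intros t Ht. assert (0 < m t) by (apply Hm; lra). assert (0 < sg * k t) by (apply Hsk; lra).
    unfold frenet_B. rewrite (F2 t Ht), vnorm_vscale by (apply HS; lra).
    replace (Rabs (m t ^ 2 * k t)) with (m t ^ 2 * (sg * k t)).
    - replace (vscale sg (b t)) with (vscale (/ sg) (b t)).
      + assert (k t <> 0) by (apply Hk; lra).
        apply R3_eq; unfold vscale; cbn [X1 X2 X3 fst snd]; field; repeat split; try assumption; lra.
      + f_equal. apply (Rmult_eq_reg_l sg); [|exact Hsg0]. rewrite Hsg. field. exact Hsg0.
    - rewrite Rabs_mult, (Rabs_pos_eq (m t ^ 2)) by (apply pow2_ge_0). f_equal.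
      assert (sg = 1 \/ sg = -1) as [Z | Z] by nra; rewrite Z in *.
      + rewrite Rabs_pos_eq; lra.
      + rewrite Rabs_left; lra. }
  assert (GN : eq_on 0 L (frenet_N c) (fun t => vscale (- sg) (T t))).
  { intros t Ht. destruct (HST t Ht) as [_ [O2 [O4 _]]].
    unfold frenet_N. rewrite (GT t Ht), (GB t Ht). unfold n, sphere_n. fold T.
    apply vdot_ext. intros y.
    transitivity (sg * (vdot (T t) (b t) * vdot (b t) y - vdot (b t) (b t) * vdot (T t) y));
      [|rewrite O2, O4]; unfold vdot, vscale, vcross; cbn [X1 X2 X3 fst snd]; ring. }
  assert (Gq : eq_on 0 L (bend_rate c) (fun t => sg * k t)).
  { intros t Ht. destruct (HST t Ht) as [O1 [_ [_ [_ [_ E]]]]]. unfold bend_rate.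
    rewrite (GN t Ht), (eq_on_vD _ _ _ _ GT t Ht), E. fold (k t).
    transitivity (sg * k t * vdot (T t) (T t));
      [unfold vdot, vscale; cbn [X1 X2 X3 fst snd]; ring|rewrite O1; ring]. }
  assert (Gp : eq_on 0 L (twist_rate c) (fun _ => 1)).
  { intros t Ht. destruct (HST t Ht) as [_ [O2 [_ [_ [E _]]]]]. unfold twist_rate.
    rewrite (GB t Ht), (eq_on_vD _ _ _ _ GN t Ht).
    rewrite (vD_scale (fun _ => - sg) T t (ex_derive_const _ _) (XT t Ht)), Derive_const, E.
    transitivity (sg * sg * (vdot (b t) (b t) - k t * vdot (n t) (b t)));
      [unfold vdot, vadd, vscale; fold (k t); cbn [X1 X2 X3 fst snd]; ring|].
    replace (vdot (n t) (b t)) with 0 by (unfold n, sphere_n, vdot, vcross; cbn [X1 X2 X3 fst snd]; ring).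
    rewrite O2, Hsg. ring. }
  assert (Gk : eq_on 0 L (curvature c) (fun t => sg * k t / m t)).
  { intros t Ht. rewrite (curvature_bend_rate W (fun _ => c) 0 t HW (HWo t Ht)), (Gq t Ht), (Gv t Ht). reflexivity. }
  assert (Gl : eq_on 0 L (mod_torsion c) (fun t => 1 / (sg * k t))).
  { intros t Ht. rewrite (mod_torsion_rates W (fun _ => c) 0 t HW (HWo t Ht)), (Gq t Ht), (Gp t Ht). reflexivity. }
  assert (Hl2 : forall t, 0 < t < L -> 1 + (1 / (sg * k t)) ^ 2 = m t).
  { intros t Ht. unfold m. assert (k t <> 0) by (apply Hk; lra).
    replace ((1 / (sg * k t)) ^ 2) with (1 / ((sg * sg) * k t ^ 2)) by (field; split; assumption).
    rewrite Hsg, Rmult_1_l. reflexivity. }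
  assert (G1 : eq_on 0 L (s1 c) (fun _ => 2)).
  { intros t Ht. unfold s1. rewrite (Gk t Ht), (Gl t Ht), (Hl2 t Ht).
    assert (k t <> 0) by (apply Hk; lra). assert (0 < m t) by (apply Hm; lra).
    field. repeat split; try assumption; lra. }
  assert (Hs1 : forall t, 0 <= t <= L -> s1 c t = 2).
  { apply (smooth2_eq_closed W W (fun _ => s1 c) (fun _ _ => 2) L HL); try assumption.
    - exact (smooth2_s1 W _ HW).
    - apply smooth2_const, HW. }
  assert (Hmk : forall t, 0 < t < L -> k t ^ 2 * m t = k t ^ 2 + 1).
  { intros t Ht. unfold m. assert (k t <> 0) by (apply Hk; lra). field. assumption. }
  (* The bending density per length is k^2, and the speed m turns it into k^2 m = 1 + k^2. This is
     the energy formula; with m it also fixes the T component of the force. *)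
  assert (Hkap : forall t, 0 < t < L -> curvature c t ^ 2 * (1 + mod_torsion c t ^ 2) ^ 2 = k t ^ 2).
  { intros t Ht. rewrite (Gk t Ht), (Gl t Ht), (Hl2 t Ht). assert (0 < m t) by (apply Hm; lra).
    replace (k t ^ 2) with (sg * sg * k t ^ 2) by (rewrite Hsg; ring). field. lra. }
  split; [split; [split; [exact Hfr|exists 2; split; [lra|exact Hs1]]|]|].
  - apply elastic_strip_of_force; [exact HL|exact Hfr|].
    assert (G2 : eq_on 0 L (s2 c) (fun _ => 0)).
    { intros t Ht. unfold s2. rewrite (eq_on_const_Derive 0 L (s1 c) 2 G1 t Ht). unfold Rdiv. ring. }
    assert (G3 : eq_on 0 L (s3 c) (fun t => sg * (k t - 1 / k t))).
    { intros t Ht. unfold s3. rewrite (Gk t Ht), (Gl t Ht), (Hl2 t Ht).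
      assert (k t <> 0) by (apply Hk; lra). assert (0 < m t) by (apply Hm; lra).
      replace ((1 / (sg * k t)) ^ 2) with (1 / ((sg * sg) * k t ^ 2)) by (field; split; assumption).
      rewrite Hsg. field. split; [assumption|lra]. }
    assert (G3' : forall t, 0 < t < L -> Derive (s3 c) t = sg * (Derive k t * m t)).
    { intros t Ht. rewrite (eq_on_Derive _ _ _ _ G3 t Ht). assert (k t <> 0) by (apply Hk; lra).
      specialize (Xk t Ht). unfold m. clear - Xk H. clearbody k. apply is_derive_unique. auto_derive.
      - repeat split; assumption.
      - change (fun x => k x) with k. field. assumption. }
    set (F := fun t => vadd (vadd (vscale ((k t ^ 2 + mu) / 2) (n t)) (vscale (- Derive k t) (T t)))
                           (vscale (- k t) (b t))).
    assert (GF : eq_on 0 L (strip_force mu c) F).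
    { intros t Ht. unfold strip_force, F.
      rewrite (Hkap t Ht), (GT t Ht), (GN t Ht), (GB t Ht), (G3' t Ht), (G2 t Ht), (Gv t Ht),
        (Gq t Ht), (Gp t Ht), (G1 t Ht), (G3 t Ht), (eq_on_const_Derive 0 L (s2 c) 0 G2 t Ht).
      assert (k t <> 0) by (apply Hk; lra). assert (0 < m t) by (apply Hm; lra).
      assert (Em : 1 / k t = k t * m t - k t) by (unfold m; field; assumption).
      f_equal; [f_equal|].
      - transitivity (vscale (- ((sg * sg) * Derive k t)) (T t)); [|rewrite Hsg, Rmult_1_l; reflexivity].
        apply R3_eq; unfold vscale; cbn [X1 X2 X3 fst snd]; field; lra.
      - rewrite Em. transitivity (vscale (- ((sg * sg) * k t)) (b t)); [|rewrite Hsg, Rmult_1_l; reflexivity].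
        apply R3_eq; unfold vscale; cbn [X1 X2 X3 fst snd]; field; lra. }
    intros t Ht. rewrite (eq_on_vD _ _ _ _ GF t Ht).
    destruct (HST t Ht) as [_ [_ [_ [E1 [E2 E3]]]]].
    assert (Hdk : smooth2 U (fun _ => Derive k)) by exact (smooth2_Dt U _ Hks).
    assert (Xdk : ex_derive (Derive k) t) by exact (smooth2_ex_derive_t U _ 0 t Hdk (HIo t Ht)).
    assert (HEt := HE t Ht). unfold spherical_EL in HEt.
    assert (Earc : eq_on 0 L (arc_Dk b) (Derive k)).
    { intros r Hr'. unfold arc_Dk. rewrite (Hv r) by lra. rewrite Rinv_1. apply Rmult_1_r. }
    rewrite (eq_on_Derive _ _ _ _ Earc t Ht), (Hv t) in HEt by lra. fold (k t) in HEt.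
    assert (Y1 : smoothV U (fun _ t => vscale ((k t ^ 2 + mu) / 2) (n t))).
    { apply smoothV_scale; [exact HU|unfold Rdiv; smooth2_tac HU|exact Hns]. }
    assert (Y2 : smoothV U (fun _ t => vscale (- Derive k t) (T t))).
    { apply smoothV_scale; [exact HU|smooth2_tac HU|exact HTs]. }
    assert (Y3 : smoothV U (fun _ t => vscale (- k t) (b t))).
    { apply smoothV_scale; [exact HU|smooth2_tac HU|exact Hbs]. }
    assert (Y12 := smoothV_add U _ _ HU Y1 Y2). cbv beta in Y12.
    assert (Z1 : ex_derive (fun t => (k t ^ 2 + mu) / 2) t).
    { specialize (Xk t Ht). clear - Xk. clearbody k. auto_derive. exact Xk. }
    assert (D1 : Derive (fun t => (k t ^ 2 + mu) / 2) t = k t * Derive k t).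
    { specialize (Xk t Ht). clear - Xk. clearbody k. apply is_derive_unique. auto_derive; [exact Xk|].
      change (fun x => k x) with k. field. }
    unfold F.
    rewrite (vD_add (fun t => vadd (vscale ((k t ^ 2 + mu) / 2) (n t)) (vscale (- Derive k t) (T t)))
      (fun t => vscale (- k t) (b t)) t (smoothV_ex_t U _ 0 t Y12 (HIo t Ht)) (smoothV_ex_t U _ 0 t Y3 (HIo t Ht))).
    rewrite (vD_add (fun t => vscale ((k t ^ 2 + mu) / 2) (n t)) (fun t => vscale (- Derive k t) (T t)) t
      (smoothV_ex_t U _ 0 t Y1 (HIo t Ht)) (smoothV_ex_t U _ 0 t Y2 (HIo t Ht))).
    rewrite (vD_scale (fun t : R => (k t ^ 2 + mu) / 2) n t Z1 (Xn t Ht)).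
    rewrite (vD_scale (fun t : R => - Derive k t) T t (ex_derive_opp _ _ Xdk) (XT t Ht)).
    rewrite (vD_scale (fun t : R => - k t) b t (ex_derive_opp _ _ (Xk t Ht)) (Xb t Ht)).
    rewrite D1, !Derive_opp, E1, E2, E3. fold (k t).
    (* The n and b components of the derivative cancel through the structure equations; only the T
       component needs this equation for k''. *)
    assert (Ekk : Derive (Derive k) t = - (k t ^ 3 * / 2 + (1 - - mu * / 2) * k t)) by lra.
    apply R3_eq; unfold vadd, vscale, vzero; cbn [X1 X2 X3 fst snd]; rewrite Ekk; field.
  - assert (Ck : ex_RInt (fun t => 1 + k t ^ 2) 0 L).
    { apply (ex_RInt_continuous (V := R_CompleteNormedModule)).
      rewrite Rmin_left, Rmax_right by lra. intros t Ht.
      apply (smooth2_continuous_t U (fun _ t => 1 + k t ^ 2) 0 t); [smooth2_tac HU|apply HI, Ht]. }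
    assert (Cv : ex_RInt (speed c) 0 L).
    { apply (ex_RInt_continuous (V := R_CompleteNormedModule)).
      rewrite Rmin_left, Rmax_right by lra. intros t Ht.
      exact (smooth2_continuous_t W _ 0 t (smooth2_speed W _ (frenet_family_regular _ _ HW)) (HWI t Ht)). }
    unfold curve_length, sadowsky.
    transitivity (RInt (fun t => minus (1 + k t ^ 2) (scal mu (speed c t))) 0 L).
    + apply RInt_ext. rewrite Rmin_left, Rmax_right by lra. intros t Ht.
      rewrite (Hkap t Ht), (Gv t Ht). assert (E := Hmk t Ht).
      change ((k t ^ 2 - mu) * m t = (1 + k t ^ 2) - mu * m t). lra.
    + rewrite (RInt_minus (V := R_CompleteNormedModule) (fun t => 1 + k t ^ 2) (fun t => scal mu (speed c t)));
        [|exact Ck|apply (ex_RInt_scal (V := R_CompleteNormedModule)), Cv].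
      rewrite (RInt_scal (V := R_CompleteNormedModule) (speed c)) by exact Cv. reflexivity.
Qed.

(* Homothety by a factor a > 0 fixes the binormal but divides s1 by a and mu by
   a^2.  The multiplier of B in the first part is therefore -mu for strips
   normalised by s1 = 2 or s1 = -2 (the curves of the second part have s1 = 2),
   and -(2 / s1)^2 mu in general. *)
Theorem theorem1 :
  (forall (mu L : R) (gamma : R -> R3),
     0 < L ->
     elastic_momentum_strip mu L gamma ->
     spherical_elastic (- ((2 / s1 gamma 0) ^ 2 * mu)) L (frenet_B gamma))
  /\
  (forall (mu Lhat : R) (B : R -> R3),
     0 < Lhat ->
     spherical_elastic (- mu) Lhat B ->
     (forall t, 0 <= t <= Lhat -> speed B t = 1) ->
     (forall t, 0 <= t <= Lhat -> geod_curvature B t <> 0) ->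
     (exists t1 t2, 0 <= t1 <= Lhat /\ 0 <= t2 <= Lhat /\
        geod_curvature B t1 <> geod_curvature B t2) ->
     let lambda := geod_curvature B in
     let T := fun t => vcross (B t) (vD B t) in
     let gamma := fun t =>
       vRInt (fun s => vscale (1 + 1 / lambda s ^ 2) (T s)) 0 t in
     elastic_momentum_strip mu Lhat gamma /\
     sadowsky mu Lhat gamma =
       RInt (fun t => 1 + lambda t ^ 2) 0 Lhat - mu * curve_length Lhat gamma).
Proof.
  split; [exact elastic_momentum_binormal|].
  intros mu L b HL Hel Hv Hk _ k T c.
  assert (Hel' := Hel). destruct Hel' as [Hb [_ [Hr _]]].
  destruct (regular_curve_family L b Hb Hr) as [U0 [HU0 HI0]].
  assert (Hks0 : smooth2 U0 (fun _ => k)) by exact (smooth2_geod U0 _ HU0).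
  assert (HO : open2 U0) by apply HU0.
  assert (Hbs : smoothV U0 (fun _ => b)) by apply HU0.
  assert (Hk2 : smooth2 U0 (fun _ t => k t ^ 2)) by (apply smooth2_pow; assumption).
  (* The integrand has to be smooth slightly beyond [0, L], where k could vanish; the domain is cut
     down accordingly. *)
  set (U := fun s t => U0 s t /\ 0 < k t ^ 2).
  assert (HU : open2 U) by exact (open2_pos U0 _ HO Hk2).
  assert (HUU : forall s t, U s t -> U0 s t) by (intros s t [h _]; exact h).
  assert (HI : forall t, 0 <= t <= L -> U 0 t).
  { intros t Ht. split; [apply HI0, Ht|apply pow2_gt_0, Hk, Ht]. }
  destruct (vRInt_smooth U (fun s => vscale (1 + 1 / k s ^ 2) (T s)) L HL HU HI) as [d [Hd [Hcs HDc]]].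
  { apply smoothV_scale; [exact HU| |].
    - apply smooth2_plus; [exact HU|apply smooth2_const, HU|].
      apply smooth2_div; [exact HU|apply smooth2_const, HU|exact (smooth2_sub _ _ _ HUU Hk2)|].
      intros s t [_ h]. lra.
    - apply smoothV_sub with U0; [exact HUU|].
      apply (smoothV_cross U0 (fun _ => b) (fun _ => vD b) HO Hbs), (smoothV_Dt U0 _ Hbs). }
  apply (strip_over_spherical_curve mu L b c HL Hel Hv Hk).
  - apply (smoothV_curve (box d (- d) (L + d))); [exact HL|apply box_open| |exact Hcs].
    intros t Ht. split; lra.
  - intros t Ht. apply HDc. lra.
Qed.
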